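(* Let $n \geq 2$ and let $f, g \colon \mathbb{C} \to \mathrm{SL}_n(\mathbb{C})$ be algebraic embeddings. If $n \geq 3$, then there exists an algebraic automorphism $\varphi$ of $\mathrm{SL}_n(\mathbb{C})$ such that $\varphi \circ f = g$. If $n = 2$, then there exists a holomorphic automorphism $\varphi$ of $\mathrm{SL}_2(\mathbb{C})$ such that $\varphi \circ f = g$.
   Context: $\mathrm{SL}_n(\mathbb{C})$ is the smooth affine variety (and complex manifold) of complex $n \times n$-matrices of determinant $1$. An algebraic embedding is a closed embedding of algebraic varieties, i.e. a morphism that is an isomorphism onto a Zariski closed subvariety; for a morphism from $\mathbb{C}$ this is equivalent to being proper, injective and immersive (nowhere vanishing derivative). An algebraic automorphism of $\mathrm{SL}_n(\mathbb{C})$ is an automorphism of it as an algebraic variety (not necessarily a group homomorphism); a holomorphic automorphism is a biholomorphic self-map of the complex manifold. *)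

(* Defs.v *)
From HB Require Import structures.
From mathcomp Require Import all_boot all_order all_algebra.
From mathcomp Require Import all_classical all_reals all_analysis.
(* mpoly is not imported: its notations clash with those of the analysis
   library. mpoly.mpoly N K is {mpoly K[N]} and mpoly.meval v p is p.@[v]. *)
From mathcomp Require mpoly.

Set Implicit Arguments.
Unset Strict Implicit.
Unset Printing Implicit Defensive.

Import Order.TTheory GRing.Theory Num.Theory.
Import numFieldNormedType.Exports.

Local Open Scope classical_set_scope.
Local Open Scope ring_scope.

Section SpecialLinear.
(* C is meant to be R[i] for R : realType; it is an abstract numeric field
   because the library puts topologies and norms on those. *)
Variables (C : numFieldType) (n : nat).

Definition SL : Type := {A : 'M[C]_n | \det A == 1}.

(* The n * n variables of p are matched with the matrix entries by mxvec. *)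
Definition evalSL (p : mpoly.mpoly (n * n) C) (A : SL) : C :=
  mpoly.meval (fun k => mxvec (val A) 0 k) p.

(* SL is closed in the affine space of matrices, so its Zariski topology is
   given by zero loci of polynomials in the matrix entries. *)
Definition zariski_closed (Z : set SL) : Prop :=
  exists S : set (mpoly.mpoly (n * n) C),
    Z = [set A | forall p, S p -> evalSL p A = 0].

(* Regular functions on a Zariski closed subset Z of SL: the coordinate ring of
   Z consists of the restrictions of polynomials in the matrix entries. Values
   of r outside Z are irrelevant. *)
Definition regular_on (Z : set SL) (r : SL -> C) : Prop :=
  exists p : mpoly.mpoly (n * n) C, forall A, Z A -> r A = evalSL p A.

Definition line_morphism (f : C -> SL) : Prop :=
  forall i j, exists p : {poly C}, forall t, val (f t) i j = p.[t].

(* r is the inverse of f : C -> f(C); it is a morphism f(C) -> C. *)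
Definition algebraic_embedding (f : C -> SL) : Prop :=
  [/\ line_morphism f,
      zariski_closed (range f)
    & exists r : SL -> C, regular_on (range f) r /\ cancel f r].

Definition algebraic_morphism (phi : SL -> SL) : Prop :=
  forall i j, regular_on setT (fun A => val (phi A) i j).

Definition algebraic_automorphism (phi : SL -> SL) : Prop :=
  algebraic_morphism phi /\
  exists psi : SL -> SL,
    [/\ algebraic_morphism psi, cancel phi psi & cancel psi phi].

(* SL is a closed complex submanifold of the space of matrices: a self-map is
   holomorphic when near each point it is the restriction of a holomorphic map
   between open sets of matrices. Since 'M[C]_n is a normed C-module, with
   C = R[i], [differentiable] means having a C-linear differential. *)
Definition holomorphic_map (phi : SL -> SL) : Prop :=
  forall A : SL, exists (U : set 'M[C]_n) (h : 'M[C]_n -> 'M[C]_n),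
    [/\ open U, U (val A), forall M, U M -> differentiable h M
      & forall B : SL, U (val B) -> val (phi B) = h (val B)].

Definition holomorphic_automorphism (phi : SL -> SL) : Prop :=
  holomorphic_map phi /\
  exists psi : SL -> SL,
    [/\ holomorphic_map psi, cancel phi psi & cancel psi phi].

End SpecialLinear.

(* Main.v *)
Require Import Defs.
From HB Require Import structures.
From mathcomp Require Import all_boot all_order all_algebra.
From mathcomp Require Import complex.
From mathcomp Require Import all_classical all_reals all_analysis.
From mathcomp Require Import ring.
From mathcomp Require mpoly.

Set Implicit Arguments.
Unset Strict Implicit.
Unset Printing Implicit Defensive.

Import Order.TTheory GRing.Theory Num.Theory.
Import numFieldNormedType.Exports.

Local Open Scope classical_set_scope.
Local Open Scope ring_scope.

(* An embedded line is a matrix A over C[t] of determinant 1 whose difference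
   quotients have no common zero. Every such A is moved by automorphisms of SL_n
   to one standard line; an A such that u A v is affine and nonconstant for some
   constant vectors u and v can be moved there.

   The basic move adds q times row j to row i. If the rows other than row i
   embed the line, then q is a polynomial in their entries, by Nakayama's lemma,
   and the move extends to an algebraic automorphism. For n >= 3, after a generic
   constant change of basis two rows embed the line, a third row is thus free,
   and it can be chosen so as to create an affine entry. (If there is no suitable
   change of basis, then all A(s) - A(t) have rank at most 1 and A is explicit.)

   For n = 2 a single row (x, y) cannot be assumed to embed the line, but it can
   be given at most double points, none of them on x = 0. If A and the result of
   the move embed the line, then the move extends to a holomorphic automorphism,
   row i += (z Phi + H) row j, where z is the entry of row i above or below x and
   Phi, H are entire functions of (x, y) such that 1 + x Phi has no zero.
   Such moves lead from A to A R, where R is a product of three generic shears: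
   they are applied to the columns of E A, where E is a generic shear, and E is
   undone at the end. The line A R is standard for generic R, by induction on the
   length of a factorization of A into shears. *)

(** * Generic parameters and difference quotients *)

(** A shear extends to an automorphism if its coefficient extends to a function that the shear does
    not change; a polynomial in the other rows is such a function. For n = 2 the other row is a
    plane curve (x, y), and at a double point q may take two values while x and y agree. The entry z
    must then enter the coefficient, although the shear changes it, to z (1 + x Phi) + x H; the move
    is invertible because 1 + x Phi has no zero. A polynomial without zeros is constant, so 1 + x
    Phi is made from exponentials, the only source of transcendental maps here. Double points can be
    handled because 1 and z span the functions on a pair of points. They have to avoid x = 0,
    because only for nonzero x does the determinant x w - y z force z to separate the two branches.

    R multiplies from the right and the factors of A from the left. They do not interfere, so one
    generic R can serve all partial products. *)

Section Cofinite.
Variable C : numClosedFieldType.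
Implicit Types (p q : {poly C}) (P Q : C -> Prop).

(** A generic parameter. The witness is a polynomial, so that conditions intersect by
    multiplication. *)
Definition cofin P := exists2 d : {poly C}, d != 0 & forall c, d.[c] != 0 -> P c.

Lemma cofin_poly p : p != 0 -> cofin (fun c => p.[c] != 0).
Proof. by exists p. Qed.

Lemma cofinW P Q : (forall c, P c -> Q c) -> cofin P -> cofin Q.
Proof. by move=> PQ [d d0 H]; exists d => // c /H /PQ. Qed.

Lemma cofinT P : (forall c, P c) -> cofin P.
Proof. by move=> H; exists 1; rewrite ?oner_neq0. Qed.

Lemma cofinI P Q : cofin P -> cofin Q -> cofin (fun c => P c /\ Q c).
Proof.
move=> [d d0 H] [e e0 K]; exists (d * e); first by rewrite mulf_neq0.
by move=> c; rewrite hornerM mulf_eq0 negb_or => /andP[/H ? /K].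
Qed.

(** In characteristic 0 the integers below [size d] are distinct, and too many to be all roots of
    [d]. *)
Lemma cofin_ex P : cofin P -> exists c, P c.
Proof.
move=> [d d0 H].
have [/allP h|] := boolP (all (root d) [seq i%:R : C | i <- iota 0 (size d)]).
  have /= := @max_poly_roots _ d [seq i%:R : C | i <- iota 0 (size d)] d0.
  rewrite size_map size_iota ltnn => /(_ _ _) h'; exfalso.
  suff: false by []; apply: h'; first by apply/allP.
  rewrite map_inj_uniq ?iota_uniq // => i j /eqP.
  by rewrite eqr_nat => /eqP.
by move=> /allPn[x _ rx]; exists x; apply: H.
Qed.

Lemma cofin_seq (T : eqType) (s : seq T) (P : T -> C -> Prop) :
  (forall x, x \in s -> cofin (P x)) -> cofin (fun c => forall x, x \in s -> P x c).
Proof.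
elim: s => [|y s IH] H; first exact: cofinT.
have Hs : forall x, x \in s -> cofin (P x).
  by move=> x xs; apply: H; rewrite inE xs orbT.
have Hy : cofin (P y) by apply: H; rewrite inE eqxx.
by apply: cofinW (cofinI Hy (IH Hs)) => c [Py Ps] x; rewrite inE => /predU1P[->|/Ps].
Qed.

Lemma roots_seq p : p != 0 -> exists s : seq C, forall x, root p x = (x \in s).
Proof.
move=> p0; have [s sE] := closed_field_poly_normal p.
by exists s => x; rewrite {1}sE rootZ ?lead_coef_eq0 // root_prod_XsubC.
Qed.

Lemma cofin_roots p (P : C -> C -> Prop) : p != 0 ->
  (forall x, root p x -> cofin (P x)) -> cofin (fun c => forall x, root p x -> P x c).
Proof.
move=> /roots_seq[s sE] H.
have /cofin_seq : forall x, x \in s -> cofin (P x) by move=> x; rewrite -sE => /H.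
by apply: cofinW => c h x; rewrite sE => /h.
Qed.

Lemma cofin_lin (a b : C) : (b = 0 -> a != 0) -> cofin (fun c => a + c * b != 0).
Proof.
move=> ab; have h : a%:P + 'X * b%:P != 0.
  apply/eqP => h; have := congr1 (fun p => p.[0]) h; have := congr1 (fun p => p.[1]) h.
  rewrite !hornerE => + a0; rewrite a0 add0r => /ab.
  by rewrite a0 eqxx.
by apply: cofinW (cofin_poly h) => c; rewrite !hornerE.
Qed.

End Cofinite.

Section DifferenceQuotient.
Variable C : numClosedFieldType.
Implicit Types (p q : {poly C}) (s t : C).

(* [dq p t s] is (p(s) - p(t)) / (s - t), and p'(t) for s = t; hence the vanishing
   of difference quotients detects both multiple points and critical points. *)
Definition dqp p t := (p - p.[t]%:P) %/ ('X - t%:P).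
Definition dq p t s := (dqp p t).[s].

Lemma dqpE p t : ('X - t%:P) * dqp p t = p - p.[t]%:P.
Proof.
rewrite mulrC divpK // dvdp_XsubCl /root !hornerE subrr //.
Qed.

Lemma dqp_uniq p t c q : p - c%:P = ('X - t%:P) * q -> dqp p t = q.
Proof.
move=> pE; have cE : p.[t] = c.
  have := congr1 (fun x => x.[t]) pE; rewrite !hornerE subrr mul0r.
  by move/eqP; rewrite subr_eq0 => /eqP.
by rewrite /dqp cE pE mulKp // polyXsubC_eq0.
Qed.

Lemma dqpD p q t : dqp (p + q) t = dqp p t + dqp q t.
Proof.
apply: (@dqp_uniq _ _ (p.[t] + q.[t])).
by rewrite mulrDr !dqpE polyCD; ring.
Qed.

Lemma dqpC c t : dqp c%:P t = 0.
Proof. by apply: (@dqp_uniq _ _ c); rewrite subrr mulr0. Qed.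

Lemma dqpM p q t : dqp (p * q) t = dqp p t * q + p.[t]%:P * dqp q t.
Proof.
apply: (@dqp_uniq _ _ (p.[t] * q.[t])).
rewrite mulrDr mulrA dqpE mulrCA dqpE polyCM; ring.
Qed.

Lemma dqpX t : dqp 'X t = 1.
Proof. by apply: (@dqp_uniq _ _ t); rewrite mulr1. Qed.

Lemma dqD p q t s : dq (p + q) t s = dq p t s + dq q t s.
Proof. by rewrite /dq dqpD hornerD. Qed.
Lemma dqC c t s : dq c%:P t s = 0.
Proof. by rewrite /dq dqpC horner0. Qed.
Lemma dq0 t s : dq 0 t s = 0.
Proof. exact: dqC. Qed.
Lemma dq1 t s : dq 1 t s = 0.
Proof. exact: dqC. Qed.
Lemma dqM p q t s : dq (p * q) t s = dq p t s * q.[s] + p.[t] * dq q t s.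
Proof. by rewrite /dq dqpM !hornerE. Qed.
Lemma dqX t s : dq 'X t s = 1.
Proof. by rewrite /dq dqpX hornerE. Qed.
Lemma dqCM c p t s : dq (c%:P * p) t s = c * dq p t s.
Proof. by rewrite dqM dqC mul0r add0r hornerC. Qed.
Lemma dqN p t s : dq (- p) t s = - dq p t s.
Proof. by rewrite -mulN1r -polyCN dqCM mulN1r. Qed.
Lemma dqB p q t s : dq (p - q) t s = dq p t s - dq q t s.
Proof. by rewrite dqD dqN. Qed.
Lemma dq_sum I r (P : pred I) (F : I -> {poly C}) t s :
  dq (\sum_(i <- r | P i) F i) t s = \sum_(i <- r | P i) dq (F i) t s.
Proof. by apply: (big_morph (fun p => dq p t s)) => [p q|]; rewrite ?dqD ?dq0. Qed.

Lemma dqE p t s : (s - t) * dq p t s = p.[s] - p.[t].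
Proof. by have := congr1 (fun x => x.[s]) (dqpE p t); rewrite /dq !hornerE. Qed.

Lemma dq_eq0 p t s : dq p t s = 0 -> p.[s] = p.[t].
Proof. by move=> h; have := dqE p t s; rewrite h mulr0 => /eqP; rewrite eq_sym subr_eq0 => /eqP. Qed.

Lemma dq_sym p t s : dq p t s = dq p s t.
Proof.
have [->//|st] := eqVneq s t.
apply: (mulfI (x := s - t)); first by rewrite subr_eq0.
by rewrite dqE -[s - t]opprB mulNr dqE opprB.
Qed.

Lemma size_dqp p t : size (dqp p t) = (size p).-1.
Proof.
have [sp|sp] := leqP (size p) 1.
  by rewrite (size1_polyC sp) dqpC size_poly0 size_polyC; case: eqP.
rewrite /dqp size_divp ?polyXsubC_eq0 // size_XsubC subn1 /=; congr predn.
by rewrite size_polyDl // size_polyN (leq_ltn_trans (size_polyC_leq1 _)).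
Qed.

Lemma dqp_eq0 p t : (dqp p t == 0) = (size p <= 1)%N.
Proof. by rewrite -size_poly_eq0 size_dqp; case: (size p) => [|[]]. Qed.

Lemma rootdq p t s : root (dqp p t) s = (dq p t s == 0).
Proof. by []. Qed.

Lemma dqp_comp p q t : exists v : {poly C}, dqp (p \Po q) t = v * dqp q t.
Proof.
elim/poly_ind: p => [|p c [v vE]]; first by exists 0; rewrite comp_poly0 -[0]/(0%:P) dqpC mul0r.
exists (v * q + (p \Po q).[t]%:P).
by rewrite comp_polyD comp_polyM comp_polyX comp_polyC dqpD dqpC dqpM vE; ring.
Qed.

End DifferenceQuotient.

(** * Modules over subalgebras of C[t] *)

Section Ideals.
Variable C : numClosedFieldType.
Implicit Types (p q k : {poly C}) (I G : {poly C} -> Prop).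

Definition is_ideal I :=
  (forall p q, I p -> I q -> I (p + q)) /\ (forall a p, I p -> I (a * p)).

(** The intersection of the ideals that contain [G]: membership is exploited by naming a suitable
    ideal. *)
Definition gen_ideal G k := forall I, is_ideal I -> (forall g, G g -> I g) -> I k.

Lemma gen_ideal_is_ideal G : is_ideal (gen_ideal G).
Proof.
split=> [p q hp hq I iI GI|a p hp I iI GI].
  by apply: iI.1; [apply: hp|apply: hq].
by apply: iI.2; apply: hp.
Qed.

Lemma gen_ideal_gen G g : G g -> gen_ideal G g.
Proof. by move=> Gg I _; apply. Qed.

(** Descent on the size of an element [p] of [I]: at a root [s] of [p], an element [q] that does not
    vanish at [s] is not divisible by [p], and [q %% p] is smaller. *)
Lemma weak_nullstellensatz I : is_ideal I ->
  (forall s, exists2 p, I p & p.[s] != 0) -> I 1.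
Proof.
move=> [ID IM] H; have [p Ip p0] := H 0.
have {p0}: p != 0 by apply: contraNneq p0 => ->; rewrite horner0.
have [n] := ubnP (size p); elim: n p Ip => // n IH p Ip sp p0.
have [/size_poly1P[c c0 pE]|s1] := boolP (size p == 1).
  have -> : 1 = c^-1%:P * p by rewrite pE -polyCM mulVf.
  exact: IM.
have [s ps] := closed_rootP _ s1.
have [q Iq qs] := H s.
apply: (IH (q %% p)).
- rewrite (_ : q %% p = q + (- (q %/ p)) * p); first by apply: ID => //; apply: IM.
  by rewrite {2}(divp_eq q p); ring.
- by have := ltn_modp q p; rewrite p0 => /leq_trans; apply.
- apply/eqP => /modp_eq0P pq; move/negP: qs; apply.
  by have := dvdp_trans (_ : 'X - s%:P %| p) pq; rewrite !dvdp_XsubCl => /(_ ps).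
Qed.

Record subalg (B : {poly C} -> Prop) : Prop := Subalg {
  subalgC : forall c, B c%:P;
  subalgD : forall p q, B p -> B q -> B (p + q);
  subalgM : forall p q, B p -> B q -> B (p * q) }.

Record submod (B S : {poly C} -> Prop) : Prop := Submod {
  submod0 : S 0;
  submodD : forall p q, S p -> S q -> S (p + q);
  submodM : forall b s, B b -> S s -> S (b * s) }.

Lemma subalg_submod B : subalg B -> submod B B.
Proof. by case=> BC BD BM; split=> //; exact: (BC 0). Qed.

Lemma subalg_comp B p a : subalg B -> B p -> B (a \Po p).
Proof.
move=> [BC BD BM] Bp; elim/poly_ind: a => [|a c Ba].
  by rewrite comp_poly0; apply: (BC 0).
by rewrite comp_polyD comp_polyM comp_polyX comp_polyC; apply: BD => //; apply: BM.
Qed.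

Lemma submod_sum B S T (r : seq T) (F : T -> {poly C}) :
  submod B S -> (forall i, S (F i)) -> S (\sum_(i <- r) F i).
Proof.
move=> [S0 SD _] H; elim: r => [|i r IH]; first by rewrite big_nil.
by rewrite big_cons; apply: SD.
Qed.

Definition vanishing_in B (t : C) k := B k /\ k.[t] = 0.

(** One factor is added at a time; repetitions in [ts] account for multiplicities. If g in [B]
    vanishes at [t] and u in [S] is congruent to a modulo the previous product, then g u in [S] is
    congruent to g a modulo the new one. The [j] all of whose multiples can be approximated in this
    way form an ideal, which thus contains everything generated by such g. *)
Lemma submod_mod_prod B S (ts : seq C) : submod B S ->
  (forall t, t \in ts -> forall k, exists2 s, S s & gen_ideal (vanishing_in B t) (k - s)) ->
  forall k, exists2 s, S s & \prod_(t <- ts) ('X - t%:P) %| k - s.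
Proof.
move=> [S0 SD SM]; elim: ts => [|t ts IH] H k.
  by exists 0; rewrite ?big_nil ?dvd1p.
have {}IH := IH (fun u us => H u (mem_behead (s := t :: ts) us)).
have [s Ss] := H t (mem_head _ _) k.
rewrite big_cons; set m := _ * _.
pose I j := forall a, exists2 u, S u & m %| a * j - u.
have iI : is_ideal I.
  split=> [p q Ip Iq a|b p Ip a]; last by rewrite mulrA.
  have [[u Su mu] [v Sv mv]] := (Ip a, Iq a).
  exists (u + v); first exact: SD.
  by rewrite mulrDr opprD addrACA dvdp_add.
have gI g : vanishing_in B t g -> I g.
  move=> [Bg gt] a; have [u Su mu] := IH a; exists (g * u); first exact: SM.
  rewrite [a * g]mulrC -mulrBr; apply: dvdp_mul => //.
  by rewrite dvdp_XsubCl; apply/eqP.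
move=> /(_ I iI gI 1)[u Su]; rewrite mul1r => mu.
by exists (s + u); [exact: SD|rewrite opprD addrA].
Qed.

(** Repeated division by [p]: the powers of 'X below [d] generate C[t] over C[p]. *)
Lemma expand_in_powers p d : size p = d.+1 -> (0 < d)%N ->
  forall k, exists a : 'I_d -> {poly C}, k = \sum_(i < d) (a i \Po p) * 'X^i.
Proof.
move=> sp d0 k; have [n] := ubnP (size k); elim: n k => // n IH k sk.
have p0 : p != 0 by rewrite -size_poly_eq0 sp.
have small q : (size q <= d)%N -> q = \sum_(i < d) (q`_i)%:P * 'X^i.
  move=> sq; rewrite -{1}[q]coefK poly_def; under [RHS]eq_bigr do rewrite mul_polyC.
  rewrite (big_ord_widen d (fun i => q`_i *: 'X^i)) // big_mkcond /=.
  apply: eq_bigr => i _; case: ltnP => // /(nth_default 0) ->.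
  by rewrite scale0r.
have [skd|skd] := leqP (size k) d.
  by exists (fun i => (k`_i)%:P); rewrite {1}[k]small //; under [RHS]eq_bigr do rewrite comp_polyC.
have [|a aE] := IH (k %/ p).
  rewrite size_divp // sp /=; apply: leq_trans (_ : (size k <= n)%N) => //.
  by rewrite ltn_subrL d0 (leq_ltn_trans _ skd).
exists (fun i => a i * 'X + ((k %% p)`_i)%:P).
have sm : (size (k %% p)%R <= d)%N by have := ltn_modp k p; rewrite p0 sp ltnS.
rewrite {1}(divp_eq k p) {1}aE {1}[k %% p]small // mulr_suml -big_split /=.
apply: eq_bigr => i _; rewrite comp_polyD comp_polyM comp_polyX comp_polyC; ring.
Qed.

(* The determinant trick: modulo S, the powers of 'X satisfy a linear system
   over C[p] whose matrix is the identity modulo p. *)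
Lemma conductor B S p : subalg B -> submod B S -> B p -> (1 < size p)%N ->
  (forall k, exists2 s, S s & p %| k - s) ->
  exists2 F, F.[0] = 1 & forall k, S ((F \Po p) * k).
Proof.
move=> sB mS Bp sp H.
have [d d0 spd] : exists2 d, (0 < d)%N & size p = d.+1.
  by case: (size p) sp => // -[] // d _; exists d.+1.
have base := expand_in_powers spd d0.
have /choice[sa sa_P] : forall i : 'I_d, exists sa : {poly C} * ('I_d -> {poly C}),
    S sa.1 /\ 'X^i = sa.1 + p * \sum_(j < d) (sa.2 j \Po p) * 'X^j.
  move=> i; have [s Ss /dvdpP[k' kE]] := H 'X^i; have [a aE] := base k'.
  exists (s, a); split=> //=; rewrite -aE mulrC -kE; ring.
pose W : 'M[{poly C}]_d := 1%:M - \matrix_(i, j) ('X * (sa i).2 j).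
have WE i : \sum_j (W i j \Po p) * 'X^j = (sa i).1.
  have [_ E] := sa_P i.
  under eq_bigr do rewrite !mxE comp_polyB comp_polyM comp_polyX mulrBl.
  rewrite sumrB (bigD1 i) //= eqxx big1 => [|j /negPf ji]; last first.
    by rewrite eq_sym ji comp_polyC mul0r.
  rewrite comp_polyC mul1r addr0 E -addrA; under [X in - X]eq_bigr do rewrite -mulrA.
  by rewrite -mulr_sumr subrr addr0.
have detW k : S ((\det W \Po p) * k).
  have [a ->] := base k; rewrite mulr_sumr; apply: (submod_sum _ mS) => i.
  rewrite mulrCA; apply: (submodM mS); first exact: subalg_comp.
  have -> : (\det W \Po p) * 'X^i = \sum_l (\adj W i l \Po p) * (sa l).1.
    under [RHS]eq_bigr do rewrite -WE mulr_sumr.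
    rewrite exchange_big /=; have := mul_adj_mx W => /matrixP adjE.
    transitivity (\sum_j ((\det W)%:M i j \Po p) * 'X^j).
      rewrite (bigD1 i) //= big1 => [|j /negPf ji].
        by rewrite mxE eqxx addr0.
      by rewrite mxE eq_sym ji comp_polyC mul0r.
    apply: eq_bigr => j _; rewrite -adjE mxE linear_sum /= mulr_suml.
    by apply: eq_bigr => l _; rewrite comp_polyM mulrA.
  apply: (submod_sum _ mS) => l; apply: (submodM mS); first exact: subalg_comp.
  by have [] := sa_P l.
exists (\det W) => //.
rewrite -[LHS]/(horner_eval 0 _) -det_map_mx /= -[RHS](det1 C d); congr (\det _).
apply/matrixP => i j; rewrite !mxE /horner_eval hornerD hornerN hornerM hornerX mul0r subr0.
by case: (i == j); rewrite hornerE.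
Qed.

(* Nakayama's lemma for the extension C[t] of B. *)
Lemma submod_full B S p : subalg B -> submod B S -> B p -> (1 < size p)%N ->
  (forall t k, exists2 s, S s & gen_ideal (vanishing_in B t) (k - s)) ->
  forall k, S k.
Proof.
move=> sB mS Bp sp H.
have K m : m != 0 -> forall k, exists2 s, S s & m %| k - s.
  move=> m0; have [ts mE] := closed_field_poly_normal m.
  move=> k; have [s Ss ms] := submod_mod_prod mS (fun t (_ : t \in ts) => H t) k.
  by exists s => //; rewrite mE dvdpZl ?lead_coef_eq0.
have p0 : p != 0 by apply: contraTneq sp => ->; rewrite size_poly0.
(* All multiples of the conductor lie in [S], so it remains to solve the problem modulo the
   conductor. *)
have [F F0 FS] := conductor sB mS Bp sp (K _ p0).
have Fp : F \Po p != 0.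
  rewrite comp_poly_eq0 //; apply: contra_eq_neq F0 => ->.
  by rewrite horner0 eq_sym oner_eq0.
move=> k; have [s Ss /dvdpP[u uE]] := K _ Fp k.
rewrite -(subrK s k) uE mulrC; exact: (submodD mS).
Qed.

End Ideals.

(** * Elimination *)

Section Elimination.
Variable C : numClosedFieldType.
Implicit Types (p q : {poly C}).

Lemma coprimep_no_common_root p q : p != 0 ->
  (forall s, root p s -> ~~ root q s) -> coprimep p q.
Proof.
move=> p0 H; rewrite /coprimep; apply: contraT => /closed_rootP[s].
by rewrite root_gcd => /andP[/H/negPf->].
Qed.

(** Besides a ring of functions, [Q] may be a property that is proved by induction over polynomial
    expressions. *)
Record fring T (Q : (T -> C) -> Prop) : Prop := Fring {
  fringC : forall c, Q (fun=> c);
  fringD : forall f g, Q f -> Q g -> Q (fun x => f x + g x);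
  fringM : forall f g, Q f -> Q g -> Q (fun x => f x * g x) }.

Section Fring.
Variables (T : Type) (Q : (T -> C) -> Prop).
Hypothesis rQ : fring Q.

Lemma fring_sum I (r : seq I) (P : pred I) (F : I -> T -> C) :
  (forall i, Q (F i)) -> Q (fun x => \sum_(i <- r | P i) F i x).
Proof.
move=> H; elim: r => [|i r IH].
  by under eq_fun do rewrite big_nil; apply: fringC.
under eq_fun do rewrite big_cons; case: (P i) => //.
exact: fringD.
Qed.

Lemma fring_prod I (r : seq I) (P : pred I) (F : I -> T -> C) :
  (forall i, Q (F i)) -> Q (fun x => \prod_(i <- r | P i) F i x).
Proof.
move=> H; elim: r => [|i r IH].
  by under eq_fun do rewrite big_nil; apply: fringC.
under eq_fun do rewrite big_cons; case: (P i) => //.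
exact: fringM.
Qed.

Lemma fring_exp f n : Q f -> Q (fun x => f x ^+ n).
Proof.
move=> Qf; elim: n => [|n IH]; first by under eq_fun do rewrite expr0; apply: fringC.
by under eq_fun do rewrite exprS; apply: fringM.
Qed.

Lemma fring_det n (A : T -> 'M[C]_n) :
  (forall i j, Q (fun x => A x i j)) -> Q (fun x => \det (A x)).
Proof.
move=> H; apply: fring_sum => s; apply: (fringM rQ); first exact: fringC.
by apply: fring_prod => i.
Qed.

(** Polynomials in one further variable with coefficients in [Q]; the size bound is uniform in the
    parameter. *)
Definition fam (F : T -> {poly C}) :=
  exists n, (forall x, size (F x) <= n)%N /\ forall i, Q (fun x => (F x)`_i).

Lemma fam_const p : fam (fun=> p).
Proof. by exists (size p); split=> // i; apply: fringC. Qed.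

Lemma fam_polyC f : Q f -> fam (fun x => (f x)%:P).
Proof.
move=> Qf; exists 1; split=> [x|i]; first exact: size_polyC_leq1.
under eq_fun do rewrite coefC; case: eqP => // _; exact: fringC.
Qed.

Lemma famD F G : fam F -> fam G -> fam (fun x => F x + G x).
Proof.
move=> [n [sF QF]] [m [sG QG]]; exists (maxn n m); split=> [x|i].
  by rewrite (leq_trans (size_polyD _ _)) // geq_max !leq_max sF sG orbT.
by under eq_fun do rewrite coefD; apply: fringD.
Qed.

Lemma famM F G : fam F -> fam G -> fam (fun x => F x * G x).
Proof.
move=> [n [sF QF]] [m [sG QG]]; exists (n + m); split=> [x|i].
  rewrite (leq_trans (size_polyMleq _ _)) // (leq_trans (leq_pred _)) //.
  by rewrite leq_add.
under eq_fun do rewrite coefM; apply: fring_sum => j; exact: fringM.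
Qed.

Lemma fam_dqp F f : fam F -> Q f -> fam (fun x => dqp (F x) (f x)).
Proof.
move=> [n [sF QF]] Qf.
have E : (fun x => dqp (F x) (f x)) =
    fun x => \sum_(j < n) ((F x)`_j)%:P * dqp 'X^j (f x).
  apply: funext => x; rewrite -{1}[F x]coefK poly_def.
  rewrite (big_ord_widen n (fun j => (F x)`_j *: 'X^j)) // big_mkcond /=.
  rewrite (big_morph (fun p => dqp p (f x)) (fun p q => dqpD p q (f x)) (dqpC 0 (f x))).
  apply: eq_bigr => j _; case: ltnP => [_|/(nth_default 0) ->].
    by rewrite -mul_polyC dqpM dqpC mul0r add0r hornerC.
  by rewrite mul0r (dqpC 0).
have dX j : fam (fun x => dqp 'X^j (f x)).
  elim: j => [|j IH].
    by under eq_fun do rewrite expr0 (dqpC 1); apply: fam_const.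
  under eq_fun do rewrite exprS dqpM dqpX mul1r hornerX.
  by apply: famD; [exact: fam_const|apply: famM => //; exact: fam_polyC].
rewrite E; elim: {E} n {sF} => [|n IH].
  by under eq_fun do rewrite big_ord0; apply: fam_const.
under eq_fun do rewrite big_ord_recr /=.
by apply: famD => //; apply: famM => //; apply: fam_polyC.
Qed.

(* The Sylvester determinant of [a x] and [b x] with formal sizes independent of [x]. *)
Lemma elimination (a b : T -> {poly C}) m : fam a -> fam b ->
  (forall x, size (a x) = m.+1) ->
  exists D : T -> C, [/\ Q D,
    forall x s, root (a x) s -> root (b x) s -> D x = 0 &
    forall x, (forall s, root (a x) s -> ~~ root (b x) s) -> D x != 0].
Proof.
move=> [? [_ Qa]] [l [sb Qb]] sa.
pose r x (i : 'I_(l + m)) := match fintype.split i with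
  | inl i => 'X^i * a x | inr i => 'X^i * b x end.
pose S x : 'M[C]_(l + m) := \matrix_(i, j) (r x i)`_j.
have sr x i : (size (r x i) <= l + m)%N.
  rewrite /r; case: (@fintype.split l m i) => j; rewrite (leq_trans (size_polyMleq _ _)) //.
    by rewrite size_polyXn addSn /= sa -addSnnS leq_add2r.
  rewrite size_polyXn addSn /= addnC leq_add //; exact: ltnW.
exists (fun x => \det (S x)); split=> [|x s ra rb|x H].
- apply: fring_det => i j.
  rewrite (_ : (fun x => S x i j) = fun x => (r x i)`_j); last first.
    by apply: funext => x; rewrite mxE.
  rewrite /r; case: (@fintype.split l m i) => k; under eq_fun do rewrite coefXnM.
    by case: (j < k)%N => //; apply: fringC.
  by case: (j < k)%N => //; apply: fringC.
- have m0 : (0 < m)%N.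
    rewrite lt0n; apply: contraTneq ra => m0; move: (sa x); rewrite m0 => /eqP.
    by move=> /size_poly1P[c c0 ->]; rewrite rootC.
  (* The powers of a common root [s] form a kernel vector. *)
  apply/eqP; rewrite -det_tr; apply/det0P; exists (\row_j s ^+ j).
    have lm : (0 < l + m)%N by rewrite addn_gt0 m0 orbT.
    apply/eqP => /rowP/(_ (Ordinal lm)); rewrite !mxE expr0 => /eqP.
    by rewrite oner_eq0.
  apply/rowP => i; rewrite !mxE.
  under eq_bigr do rewrite !mxE mulrC.
  rewrite -(horner_coef_wide s (sr x i)) /r; case: (@fintype.split l m i) => k; rewrite hornerM.
    by rewrite (rootP ra) mulr0.
  by rewrite (rootP rb) mulr0.
apply/det0P => -[v v0 vS].
(* A kernel vector is a relation u a + w b = 0 with [w] of size at most [m]. As [a x] has size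
   [m.+1] and is coprime to [b x], it divides [w], so [w] and then [u] vanish. *)
have E : (\sum_(i < l) v 0 (lshift m i) *: 'X^i) * a x +
         (\sum_(i < m) v 0 (rshift l i) *: 'X^i) * b x = 0.
  transitivity (\sum_i v 0 i *: r x i).
    rewrite big_split_ord /= !mulr_suml; congr (_ + _).
      apply: eq_bigr => i _; by rewrite /r (unsplitK (inl i)) scalerAl.
    apply: eq_bigr => i _; by rewrite /r (unsplitK (inr i)) scalerAl.
  apply/polyP => j; rewrite coef0 coef_sum; under eq_bigr do rewrite coefZ.
  have [jl|jl] := ltnP j (l + m).
    by have /rowP/(_ (Ordinal jl)) := vS; rewrite !mxE => E; rewrite -[RHS]E; apply: eq_bigr => i _; rewrite mxE.
  by apply: big1 => i _; rewrite (nth_default 0) ?mulr0 // (leq_trans (sr x i)).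
set u := \sum_(i < l) _ in E; set w := \sum_(i < m) _ in E.
have a0 : a x != 0 by rewrite -size_poly_eq0 sa.
have co : coprimep (a x) (b x) by apply: coprimep_no_common_root.
have w0 : w = 0.
  have : a x %| w.
    rewrite -(Gauss_dvdpl _ co); apply/dvdpP; exists (- u).
    by rewrite mulNr; apply/eqP; rewrite -addr_eq0 addrC E.
  move=> /dvdp_leq; case: eqVneq => // w0 /(_ isT); rewrite sa ltnNge.
  rewrite (_ : w = \poly_(i < m) (if insub i is Some k then v 0 (rshift l k) else 0)).
    by rewrite size_poly.
  by rewrite poly_def; apply: eq_bigr => i _; rewrite valK.
have u0 : u = 0.
  by move/eqP: E; rewrite w0 mul0r addr0 mulf_eq0 (negPf a0) orbF => /eqP.
case/negP: v0; apply/eqP/rowP => i; rewrite mxE -(splitK i); case: (@fintype.split l m i) => j /=.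
  have := congr1 (fun p : {poly C} => p`_j) u0; rewrite coef0 coef_sum (bigD1 j) //= coefZ coefXn eqxx mulr1.
  by rewrite big1 ?addr0 // => k kj; rewrite coefZ coefXn eq_sym val_eqE (negPf kj) mulr0.
have := congr1 (fun p : {poly C} => p`_j) w0; rewrite coef0 coef_sum (bigD1 j) //= coefZ coefXn eqxx mulr1.
by rewrite big1 ?addr0 // => k kj; rewrite coefZ coefXn eq_sym val_eqE (negPf kj) mulr0.
Qed.

End Fring.
End Elimination.

(** * Double points of plane curves *)

Section DoublePoints.
Variable C : numClosedFieldType.
Implicit Types (p q X Y W : {poly C}).

Definition polyfun1 (f : C -> C) := exists p, forall t, f t = p.[t].
Definition polyfun2 (f : C * C -> C) :=
  exists F, fam polyfun1 F /\ forall x, f x = (F x.1).[x.2].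

Lemma fring_polyfun1 : fring polyfun1.
Proof.
split=> [c|f g [p pE] [q qE]|f g [p pE] [q qE]].
- by exists c%:P => t; rewrite hornerC.
- by exists (p + q) => t; rewrite hornerD pE qE.
- by exists (p * q) => t; rewrite hornerM pE qE.
Qed.
Hint Resolve fring_polyfun1 : core.

Lemma polyfun1_horner p : polyfun1 (fun t => p.[t]).
Proof. by exists p. Qed.
Hint Resolve polyfun1_horner : core.

Lemma polyfun1_id : polyfun1 id.
Proof. by exists 'X => t; rewrite hornerX. Qed.
Hint Resolve polyfun1_id : core.

Lemma fring_polyfun2 : fring polyfun2.
Proof.
split=> [c|f g [F [fF FE]] [G [fG GE]]|f g [F [fF FE]] [G [fG GE]]].
- by exists (fun=> c%:P); split=> [|x]; rewrite ?hornerC //; apply: fam_const.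
- exists (fun t => F t + G t); split=> [|x]; rewrite ?hornerD ?FE ?GE //.
  exact: famD.
- exists (fun t => F t * G t); split=> [|x]; rewrite ?hornerM ?FE ?GE //.
  exact: famM.
Qed.
Hint Resolve fring_polyfun2 : core.

Lemma polyfun2_fst f : polyfun1 f -> polyfun2 (fun x => f x.1).
Proof.
move=> Qf; exists (fun t => (f t)%:P); split=> [|x]; last by rewrite hornerC.
exact: fam_polyC.
Qed.

Lemma polyfun2_snd : polyfun2 snd.
Proof. by exists (fun=> 'X); split=> [|x]; rewrite ?hornerX //; apply: fam_const. Qed.
Hint Resolve polyfun2_snd : core.

(** The vector is sought on the moment curve, with coordinates the powers of one [c]; there each
    condition is a nonzero polynomial in [c]. *)
Lemma generic_functional (I : finType) (T : eqType) (L : seq T) (d : T -> I -> C) :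
  (forall x, x \in L -> exists i, d x i != 0) ->
  exists c : I -> C, forall x, x \in L -> \sum_i c i * d x i != 0.
Proof.
move=> H; suff /cofin_ex[c cP] : cofin (fun c => forall x, x \in L ->
    \sum_i c ^+ enum_rank i * d x i != 0) by exists (fun i => c ^+ enum_rank i).
apply: cofin_seq => x /H[i di].
have p0 : \sum_i d x i *: 'X^(enum_rank i) != 0.
  apply: contra_neq di => /(congr1 (fun p : {poly C} => p`_(enum_rank i))).
  rewrite coef0 coef_sum (bigD1 i) //= coefZ coefXn eqxx mulr1 big1 ?addr0 // => j ji.
  rewrite coefZ coefXn eq_sym val_eqE (inj_eq enum_rank_inj) (negPf ji) mulr0 //.
apply: cofinW (cofin_poly p0) => c; rewrite horner_sum.
by under eq_bigr do rewrite hornerZ hornerXn mulrC.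
Qed.

(* One parameter without a partner is enough: the resultant expressing that [t]
   has a partner does not vanish identically. *)
Lemma finite_double (I : finType) (X : I -> {poly C}) t1 :
  (forall s, exists i, dq (X i) t1 s != 0) ->
  exists2 D, D != 0 & forall t s, (forall i, dq (X i) t s = 0) -> root D t /\ root D s.
Proof.
move=> H; have [i0 Hi0] := H 0.
have a0 t : dqp (X i0) t != 0.
  by rewrite dqp_eq0 -(dqp_eq0 _ t1); apply: contraNneq Hi0 => e; rewrite /dq e horner0.
have [L LE] := roots_seq (a0 t1).
(* At [t1] one combination of all the difference quotients has no root in common with that of
   [X i0], so the resultant of two polynomials suffices. *)
have [c cP] := @generic_functional I _ L (fun s i => dq (X i) t1 s) (fun s _ => H s).
have fa : fam polyfun1 (dqp (X i0)) by apply: fam_dqp => //; apply: fam_const.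
have fb : fam polyfun1 (fun t => \sum_i (c i)%:P * dqp (X i) t).
  elim: (index_enum I) => [|i r IH].
    by under eq_fun do rewrite big_nil; apply: fam_const.
  under eq_fun do rewrite big_cons; apply: famD => //; apply: famM => //.
    exact: fam_const.
  by apply: fam_dqp => //; apply: fam_const.
have sa t : size (dqp (X i0) t) = (size (X i0)).-2.+1.
  rewrite size_dqp; move: (a0 0); rewrite dqp_eq0 -ltnNge.
  by case: (size _) => [|[]].
have [D [[p pE] D1 D2]] := elimination fring_polyfun1 fa fb sa.
have bE t s : (\sum_i (c i)%:P * dqp (X i) t).[s] = \sum_i c i * dq (X i) t s.
  by rewrite horner_sum; under eq_bigr do rewrite hornerM hornerC.
exists p.
  have : D t1 != 0.
    by apply: D2 => s rs; rewrite /root bE; apply: cP; rewrite -LE.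
  by rewrite pE; apply: contraNneq => ->; rewrite horner0.
have K t s : (forall i, dq (X i) t s = 0) -> root p t.
  move=> h; rewrite /root -pE; apply/eqP/(D1 t s); first by rewrite rootdq h.
  by rewrite /root bE big1 // => i _; rewrite h mulr0.
by move=> t s h; split; [apply: (K t s)|apply: (K s t)] => // i; rewrite dq_sym.
Qed.

Lemma finite_double2 X Y t1 : (forall s, dq X t1 s = 0 -> dq Y t1 s != 0) ->
  exists2 D, D != 0 & forall t s, dq X t s = 0 -> dq Y t s = 0 -> root D t /\ root D s.
Proof.
move=> H; have [|D D0 DP] := @finite_double _ (fun b : bool => if b then X else Y) t1.
  move=> s; have [/H|] := eqVneq (dq X t1 s) 0; first by exists false.
  by exists true.
by exists D => // t s h k; apply: DP => -[].
Qed.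

(* [dbl x y]: the curve (x, y) has only double points (tangential ones
   included), and none of them lies on the line x = 0. *)
Definition dbl (x y : {poly C}) :=
  [/\ (1 < size x)%N,
      forall t s, dq x t s = 0 -> dq y t s = 0 -> x.[s] != 0
    & forall t, exists s (a b : {poly C}), a * dqp x t + b * dqp y t = 'X - s%:P].

(** The curve (X, Y) misses the origin and has finitely many double points; a generic line Y + k X =
    0 through the origin avoids them all. *)
Lemma pencil_good X Y t1 : (forall s, X.[s] = 0 -> Y.[s] != 0) ->
  (forall s, dq X t1 s = 0 -> dq Y t1 s != 0) ->
  cofin (fun k => (1 < size (Y + k%:P * X)%R)%N /\
    forall t s, (Y + k%:P * X).[t] = 0 -> dq (Y + k%:P * X) t s = 0 -> dq X t s != 0).
Proof.
move=> cop H; have [D D0 DP] := finite_double2 H.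
apply: cofinI.
  apply: cofinW (cofin_lin (H 0)) => k; apply: contraNltn => s1.
  by rewrite -dqCM -dqD /dq; move: s1; rewrite -(dqp_eq0 _ t1) => /eqP ->; rewrite horner0.
have : forall t, root D t -> cofin (fun k => Y.[t] + k * X.[t] != 0).
  by move=> t _; apply: cofin_lin => /cop.
move=> /(cofin_roots D0); apply: cofinW => k K t s Yt dY; apply/negP => /eqP dX.
have dY0 : dq Y t s = 0 by move: dY; rewrite dqD dqCM dX mulr0 addr0.
have [/K] := DP _ _ dX dY0.
by move: Yt; rewrite !hornerE => ->; rewrite eqxx.
Qed.

Section GenericDouble.
Variables X Y W : {poly C}.
Hypothesis sY : (1 < size Y)%N.
Hypothesis W0 : W != 0.
Let w : {poly C} := W \Po Y.
(** The difference quotient of [th m l] at [t] up to a multiple of [dqp Y t]; both parameters enter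
    with the factor [w.[t]]. *)
Let P m l t : {poly C} := dqp X t + w.[t]%:P * (m%:P * ('X + t%:P) + l%:P).
Let th m l : {poly C} := X + w * (m%:P * 'X^2 + l%:P * 'X).

Let dthE m l t : exists v : {poly C}, dqp (th m l) t = P m l t + v * dqp Y t.
Proof.
have [v vE] := dqp_comp W Y t.
exists (v * (m%:P * 'X^2 + l%:P * 'X)); rewrite dqpD dqpM vE /P /w.
rewrite (_ : dqp (m%:P * 'X^2 + l%:P * 'X) t = m%:P * ('X + t%:P) + l%:P); first by ring.
by rewrite expr2 dqpD !dqpM !dqpC !dqpX !hornerC hornerX; ring.
Qed.

Let PE m l t s : (P m l t).[s] = dq X t s + w.[t] * (m * (s + t)) + l * w.[t].
Proof. by rewrite /P !(hornerD, hornerM, hornerC, hornerX) /dq; ring. Qed.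

(** Holds whenever [dqp Y t] and [P m l t] have two common roots, possibly equal: the difference
    quotients of both at [s] then vanish at [s'], and in that of [P m l t] the parameter [l] drops
    out. *)
Let tri m t := exists s s', [/\ root (dqp Y t) s, root (dqp (dqp Y t) s) s' &
  dq (dqp X t) s s' + m * w.[t] = 0].

Let a0 t : dqp Y t != 0. Proof. by rewrite dqp_eq0 -ltnNge. Qed.

Let tri_cofin t1 : w.[t1] != 0 -> cofin (fun m => ~ tri m t1).
Proof.
move=> wt1.
have : forall s, root (dqp Y t1) s -> cofin (fun m => forall s', root (dqp (dqp Y t1) s) s' ->
    dq (dqp X t1) s s' + m * w.[t1] != 0).
  move=> s rs; apply: cofin_roots => [|s' _]; last by apply: cofin_lin => /eqP; rewrite (negPf wt1).
  by rewrite dqp_eq0 -ltnNge; apply: root_size_gt1 (a0 t1) rs.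
move=> /(cofin_roots (a0 t1)); apply: cofinW => m H [s [s' [rs rs' /eqP]]].
by apply/negP; apply: H.
Qed.

(** Elimination of [s'] and then of [s] from the equations of [tri]; [t1] shows that the result is
    not identically zero. For [Y] of degree 1 there is no [s]. *)
Let tri_elim m t1 : ~ tri m t1 -> exists2 D, D != 0 & forall t, tri m t -> root D t.
Proof.
move=> nt; have [sY2|sY2] := leqP (size Y) 2.
  exists 1; first exact: oner_neq0.
  move=> t [s [s' [rs _ _]]]; exfalso.
  have /eqP/size_poly1P[c c0 aE] : size (dqp Y t) = 1.
    by rewrite size_dqp; case: (size Y) sY sY2 => [|[|[]]].
  by move: rs; rewrite aE rootC (negPf c0).
have fdY : fam polyfun1 (dqp Y) by apply: fam_dqp => //; apply: fam_const.
have dfst F : fam polyfun1 F -> fam polyfun2 (fun x : C * C => F x.1).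
  move=> [n [sF QF]]; exists n; split=> [x //|i]; exact: (polyfun2_fst (QF i)).
have fa : fam polyfun2 (fun x : C * C => dqp (dqp Y x.1) x.2).
  by apply: fam_dqp => //; apply: dfst.
have fb : fam polyfun2 (fun x : C * C => dqp (dqp X x.1) x.2 + (m * w.[x.1])%:P).
  apply: famD => //.
    by apply: fam_dqp => //; apply: (dfst (dqp X)); apply: fam_dqp => //; apply: fam_const.
  apply: (dfst (fun t => (m * w.[t])%:P)); apply: fam_polyC => //.
  by apply: fringM => //; apply: fringC.
have sa (x : C * C) : size (dqp (dqp Y x.1) x.2) = (size Y - 3).+1.
  by rewrite !size_dqp; case: (size Y) sY2 => [|[|[|n]]] //=; rewrite subSS subSS subn1.
have [D2 [[F [fF FE]] D21 D22]] := elimination fring_polyfun2 fa fb sa.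
have sa1 t : size (dqp Y t) = (size Y - 2).+1.
  by rewrite size_dqp; case: (size Y) sY2 => [|[|n]] //=; rewrite subSS subSS subn0.
have [D1 [[D DE] D11 D12]] := elimination fring_polyfun1 fdY fF sa1.
exists D.
  have : D1 t1 != 0.
    apply: D12 => s rs; rewrite /root -(FE (t1, s)); apply: D22 => s' rs'.
    apply/negP => /rootP; rewrite hornerD hornerC => h; apply: nt.
    by exists s, s'.
  by rewrite DE; apply: contraNneq => ->; rewrite horner0.
move=> t [s [s' [rs rs' h]]]; rewrite /root -DE; apply/eqP/(D11 t s) => //.
by rewrite /root -(FE (t, s)); apply/eqP/(D21 (t, s) s') => //; rewrite /root hornerD hornerC; apply/eqP.
Qed.

(** A generic [m] leaves finitely many triple parameters, the roots of [D], and a generic [l]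
    removes all partners of those with [w.[t]] nonzero. Where [w] vanishes, the hypothesis on (X, Y)
    takes over; W(0) = 0 puts the points on Y = 0 into this case. *)
Lemma generic_double : W.[0] = 0 ->
  (forall t s, W.[Y.[t]] = 0 -> dq Y t s = 0 -> dq X t s != 0) ->
  cofin (fun m => cofin (fun l => dbl Y (X + (W \Po Y) * (m%:P * 'X^2 + l%:P * 'X)))).
Proof.
move=> W00 good.
have w0 : w != 0 by rewrite comp_poly_eq0.
have [t1 wt1] := cofin_ex (cofin_poly w0).
apply: cofinW (tri_cofin wt1) => m /tri_elim[D D0 DP].
have : forall t, root D t -> cofin (fun l => w.[t] != 0 -> forall s, root (dqp Y t) s ->
    (P m l t).[s] != 0).
  move=> t _; have [wt|wt] := eqVneq w.[t] 0; first exact: cofinT.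
  have : forall s, root (dqp Y t) s -> cofin (fun l => (P m l t).[s] != 0).
    move=> s _; have : cofin (fun l => (dq X t s + w.[t] * (m * (s + t))) + l * w.[t] != 0).
      by apply: cofin_lin => /eqP; rewrite (negPf wt).
    by apply: cofinW => l; rewrite PE.
  by move=> /(cofin_roots (a0 t)); apply: cofinW.
move=> /(cofin_roots D0); apply: cofinW => l H.
have dthX t s : w.[t] = 0 -> dq Y t s = 0 -> dq (th m l) t s = dq X t s.
  move=> wt dY; have [v vE] := dthE m l t.
  by rewrite {1}/dq vE hornerD hornerM PE wt -/(dq Y t s) dY; ring.
split=> // [t s dY dth|t].
  apply: contraTneq isT => Ys; have Yt : W.[Y.[t]] = 0 by rewrite -(dq_eq0 dY) Ys.
  by have := good t s Yt dY; rewrite -dthX ?dth ?eqxx // /w horner_comp.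
suff [s [a [b abE]]] : exists s (a b : {poly C}), a * dqp Y t + b * P m l t = 'X - s%:P.
  have [v vE] := dthE m l t.
  exists s, (a - b * v), b; rewrite -abE -/(th m l) vE; ring.
have coprime_case : (forall s, root (dqp Y t) s -> ~~ root (P m l t) s) ->
    exists s (a b : {poly C}), a * dqp Y t + b * P m l t = 'X - s%:P.
  move=> /(coprimep_no_common_root (a0 t))/Bezout_eq1_coprimepP[[a b] /= ab].
  (* A parameter without partner: any [s] will do. *)
  exists 0, ('X * a), ('X * b); rewrite -!mulrA -mulrDr ab mulr1 subr0 //.
have [wt|wt] := eqVneq w.[t] 0.
  apply: coprime_case => s rs; rewrite /root PE wt mul0r mulr0 !addr0.
  by apply: good; [rewrite -horner_comp|apply/eqP].
have [Dt|Dt] := boolP (root D t).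
  by apply: coprime_case => s rs; apply: H.
set g := gcdp (dqp Y t) (P m l t).
have g0 : g != 0 by rewrite gcdp_eq0 (negPf (a0 t)).
have [sg|sg] := eqVneq (size g) 1.
  apply: coprime_case => s rs; apply: contraT; rewrite negbK => rP.
  have : root g s by rewrite root_gcd rs rP.
  by move/eqP/size_poly1P: sg => [c c0 ->]; rewrite rootC (negPf c0).
have /closed_rootP[s rg] := sg.
have [g' gE] : exists g', g = g' * ('X - s%:P) by apply/factor_theorem.
(* A further root of the gcd would make [t] a triple parameter, that is, a root of [D]. *)
have sg' : size g' = 1.
  apply/eqP; apply: contraNT Dt => /closed_rootP[s' rg'].
  have /dvdpP[h hE] := dvdp_gcdl (dqp Y t) (P m l t).
  have /dvdpP[k kE] := dvdp_gcdr (dqp Y t) (P m l t).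
  have dYE : dqp (dqp Y t) s = h * g'.
    by apply: (@dqp_uniq _ _ _ 0); rewrite subr0 hE -/g gE; ring.
  have dPE : dqp (P m l t) s = k * g'.
    by apply: (@dqp_uniq _ _ _ 0); rewrite subr0 kE -/g gE; ring.
  apply: DP; exists s, s'; split.
  - by rewrite hE rootM rg orbT.
  - by rewrite dYE rootM rg' orbT.
  have : (dqp (P m l t) s).[s'] = 0 by rewrite dPE hornerM (rootP rg') mulr0.
  move=> <-; rewrite /P dqpD dqpM dqpC mul0r add0r hornerC dqpD dqpM dqpC dqpD dqpX !dqpC.
  by rewrite !(hornerD, hornerM, hornerC, horner0, hornerX) /dq; ring.
have [[a b] /= /eqpf_eq[c c0 abE]] := Bezoutp (dqp Y t) (P m l t).
move/eqP/size_poly1P: sg' => [e e0 g'E].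
exists s, ((c * e)^-1%:P * a), ((c * e)^-1%:P * b).
rewrite -!mulrA -mulrDr abE -/g gE g'E -mul_polyC !mulrA -!polyCM.
by rewrite -mulrA mulVf ?mul1r // mulf_neq0.
Qed.

End GenericDouble.
End DoublePoints.

(** * Shears and equivalence of lines in SL_n *)

Section Transvections.
Variables (R : comNzRingType) (n : nat).
Implicit Types (i j k l : 'I_n) (q : R).

Definition tv i j q : 'M[R]_n := 1%:M + q *: delta_mx i j.

Lemma tv_mulE m i j q (A : 'M[_]_(n, m)) k (l : 'I_m) :
  (tv i j q *m A) k l = A k l + (if k == i then q * A j l else 0).
Proof.
rewrite mulmxDl mul1mx mxE; congr (_ + _); rewrite -scalemxAl mxE mxE (bigD1 j) //=.
rewrite mxE eqxx andbT big1 => [|u /negPf uj]; last by rewrite mxE uj andbF mul0r.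
by case: eqP => _; rewrite addr0 ?mul1r ?mul0r ?mulr0.
Qed.

Lemma tvD i j q q' : i != j -> tv i j q *m tv i j q' = tv i j (q + q').
Proof.
move=> /negPf ij; apply/matrixP => k l; rewrite tv_mulE !mxE.
rewrite [l == j]eq_sym [j == i]eq_sym ij /= mulr0 addr0.
by case: (k == i); case: (j == l); case: (k == l); rewrite /= ?mulr0 ?mulr1 ?addr0 // ; ring.
Qed.

Lemma tv0 i j : tv i j 0 = 1%:M.
Proof. by rewrite /tv scale0r addr0. Qed.

Lemma tvK m i j q (A : 'M[_]_(n, m)) : i != j -> tv i j (- q) *m (tv i j q *m A) = A.
Proof. by move=> ij; rewrite mulmxA tvD // addNr tv0 mul1mx. Qed.

Lemma tvKV m i j q (A : 'M[_]_(n, m)) : i != j -> tv i j q *m (tv i j (- q) *m A) = A.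
Proof. by move=> ij; rewrite mulmxA tvD // addrN tv0 mul1mx. Qed.

Lemma det_tv i j q : i != j -> \det (tv i j q) = 1.
Proof.
have low (u v : 'I_n) : (v < u)%N -> \det (tv u v q) = 1.
  move=> vu; rewrite det_trig; last first.
    apply/is_trig_mxP => a b ab; rewrite !mxE -!val_eqE /= (ltn_eqF ab) add0r.
    case: eqP => [au|]; case: eqP => [bv|] /=; rewrite ?mulr0 //.
    by move: ab vu; rewrite au bv => /ltn_trans/[apply]; rewrite ltnn.
  rewrite big1 // => a _; rewrite !mxE eqxx.
  case: eqP => [->|]; rewrite ?mulr0 ?addr0 // -val_eqE /= eq_sym (ltn_eqF vu).
  by rewrite mulr0 addr0.
rewrite neq_ltn => /orP[ij|/low //].
rewrite -det_tr -[RHS](low _ _ ij); congr (\det _).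
by apply/matrixP => a b; rewrite !mxE eq_sym [in RHS]andbC.
Qed.

Lemma tr_tv i j q : (tv i j q)^T = tv j i q.
Proof. by apply/matrixP => a b; rewrite !mxE eq_sym [in RHS]andbC. Qed.

End Transvections.

Section Equivalence.
Variables (C : numClosedFieldType) (n : nat).
Implicit Types (A : 'M[{poly C}]_n) (M : 'M[C]_n) (S : 'I_n -> 'I_n -> Prop).
Implicit Types (K : ('M[C]_n -> C) -> Prop) (h : 'M[C]_n -> 'M[C]_n).

Definition evmx m m' (A : 'M[{poly C}]_(m, m')) (t : C) := map_mx (horner_eval t) A.

Lemma evmxE m m' (A : 'M[{poly C}]_(m, m')) t i j : evmx A t i j = (A i j).[t].
Proof. by rewrite mxE. Qed.

Lemma evmxM m m' m'' (A : 'M[{poly C}]_(m, m')) (B : 'M[_]_(m', m'')) t :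
  evmx (A *m B) t = evmx A t *m evmx B t.
Proof. exact: map_mxM. Qed.

Lemma det_evmx A t : \det (evmx A t) = (\det A).[t].
Proof. by rewrite det_map_mx. Qed.

Lemma evmx_tv i j q t : evmx (tv i j q) t = tv i j q.[t] :> 'M[_]_n.
Proof.
apply/matrixP => k l; rewrite !mxE /horner_eval hornerD hornerM.
by case: (k == l); case: (_ && _); rewrite !hornerE.
Qed.

Lemma evmx_tr m m' (A : 'M[{poly C}]_(m, m')) t : evmx A^T t = (evmx A t)^T.
Proof. by apply/matrixP => i j; rewrite !mxE. Qed.

Lemma evmx_const m m' (M : 'M[C]_(m, m')) t : evmx (map_mx polyC M) t = M.
Proof. by apply/matrixP => i j; rewrite !mxE /horner_eval hornerC. Qed.

Definition mxmap K h := forall i j, K (fun M => h M i j).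

(** The instances are the polynomial and the entire functions, so that one argument yields both
    kinds of automorphisms. *)
Record mxclass K : Prop := Mxclass {
  mxclass_fring : fring K;
  mxclass_coord : forall i j, K (fun M => M i j);
  mxclass_comp : forall f h, K f -> mxmap K h -> K (fun M => f (h M)) }.

(** Polynomials in the entries with indices in [S], as the smallest ring of functions containing
    these entries: induction over polynomials is then mere application. *)
Definition polyf S (f : 'M[C]_n -> C) :=
  forall Q, fring Q -> (forall i j, S i j -> Q (fun M => M i j)) -> Q f.

Lemma fring_polyf S : fring (polyf S).
Proof.
split=> [c|f g Pf Pg|f g Pf Pg] Q rQ QS; first exact: fringC.
  by apply: fringD => //; [apply: Pf|apply: Pg].
by apply: fringM => //; [apply: Pf|apply: Pg].
Qed.

Lemma polyf_coord S i j : S i j -> polyf S (fun M => M i j).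
Proof. by move=> Sij Q _; apply. Qed.

Lemma polyf_mxclass S K f : mxclass K -> polyf S f -> K f.
Proof. by move=> cK; apply=> [|i j _]; [exact: mxclass_fring|exact: mxclass_coord]. Qed.

Lemma mxclass_polyf : mxclass (polyf (fun _ _ => True)).
Proof.
split; [exact: fring_polyf|by move=> i j; apply: polyf_coord|].
move=> f h Pf Ph; apply: (Pf (fun g => polyf _ (g \o h))).
  have [rC rD rM] := fring_polyf (fun _ _ => True).
  by split=> [c|g g' H H'|g g' H H']; [exact: rC|exact: (rD _ _ H H')|exact: (rM _ _ H H')].
by move=> i j _; apply: Ph.
Qed.

Section Class.
Variable K : ('M[C]_n -> C) -> Prop.
Hypothesis cK : mxclass K.
Let rK := mxclass_fring cK.

Lemma mxmap_id : mxmap K id.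
Proof. by move=> i j; apply: mxclass_coord. Qed.

Lemma mxmap_const M : mxmap K (fun=> M).
Proof. by move=> i j; apply: fringC. Qed.

Lemma mxmap_comp h h' : mxmap K h -> mxmap K h' -> mxmap K (h \o h').
Proof. by move=> Kh Kh' i j; apply: (mxclass_comp cK (Kh i j)). Qed.

Lemma mxmap_mul h h' : mxmap K h -> mxmap K h' -> mxmap K (fun M => h M *m h' M).
Proof.
move=> Kh Kh' i j; under eq_fun do rewrite mxE.
by apply: fring_sum => // k; apply: fringM.
Qed.

Lemma mxmap_tr h : mxmap K h -> mxmap K (fun M => (h M)^T).
Proof. by move=> Kh i j; under eq_fun do rewrite mxE. Qed.

Lemma mxmap_tv i j f : K f -> mxmap K (fun M => tv i j (f M)).
Proof.
move=> Kf k l; under eq_fun do rewrite !mxE.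
by apply: fringD => //; [exact: fringC|apply: fringM => //; exact: fringC].
Qed.

(* [h] and [h'] are inverse to each other on matrices of determinant 1 only. *)
Definition eqv A A' := exists h h',
  [/\ mxmap K h, mxmap K h',
      forall M, \det M = 1 -> [/\ \det (h M) = 1, \det (h' M) = 1, h' (h M) = M & h (h' M) = M]
    & forall t, h (evmx A t) = evmx A' t].

Lemma eqv_refl A : eqv A A.
Proof. by exists id, id; split=> //; exact: mxmap_id. Qed.

Lemma eqv_trans A B D : eqv A B -> eqv B D -> eqv A D.
Proof.
move=> [h [h' [Kh Kh' H E]]] [g [g' [Kg Kg' G F]]]; exists (g \o h), (h' \o g').
split; [exact: mxmap_comp|exact: mxmap_comp| |by move=> t /=; rewrite E F].
move=> M M1; have [h1 h'1 hK hV] := H _ M1; have [g1 g'1 gK gV] := G _ M1.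
have [a1 a2 a3 a4] := G _ h1; have [b1 b2 b3 b4] := H _ g'1.
by split=> //=; rewrite ?a3 ?b4.
Qed.

Lemma eqv_det A B : \det A = 1 -> eqv A B -> \det B = 1.
Proof.
move=> A1 [h [h' [_ _ H E]]].
apply/eqP; rewrite -subr_eq0; apply: contraT => d0.
have [t] := cofin_ex (cofin_poly d0).
by rewrite hornerD hornerN hornerC -det_evmx -E; have [|->] := H (evmx A t); rewrite ?det_evmx ?A1 ?hornerC // subrr eqxx.
Qed.

Lemma eqv_sym A B : \det A = 1 -> eqv A B -> eqv B A.
Proof.
move=> A1 [h [h' [Kh Kh' H E]]]; exists h', h; split=> // [M /H[]//|t].
by rewrite -E; have [|_ _ -> _] := H (evmx A t); rewrite ?det_evmx ?A1 ?hornerC.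
Qed.

Lemma eqv_tr A B : eqv A B -> eqv A^T B^T.
Proof.
move=> [h [h' [Kh Kh' H E]]].
have Ktr g : mxmap K g -> mxmap K (fun M => (g M^T)^T).
  move=> Kg; apply: mxmap_tr; apply: (mxmap_comp Kg); apply: (mxmap_tr mxmap_id).
exists (fun M => (h M^T)^T), (fun M => (h' M^T)^T); split; [exact: Ktr|exact: Ktr| |].
  move=> M M1; rewrite !det_tr !trmxK; have [|-> -> -> ->] := H M^T; first by rewrite det_tr.
  by rewrite trmxK.
by move=> t; rewrite !evmx_tr trmxK E.
Qed.

Lemma eqv_mull s A : \det s = 1 -> eqv A (map_mx polyC s *m A).
Proof.
move=> s1; have us : s \in unitmx by rewrite unitmxE s1 unitr1.
exists (fun M => s *m M), (fun M => invmx s *m M); split.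
- by apply: mxmap_mul; [exact: mxmap_const|exact: mxmap_id].
- by apply: mxmap_mul; [exact: mxmap_const|exact: mxmap_id].
- by move=> M M1; rewrite !det_mulmx det_inv s1 M1 invr1 mulr1 mulKVmx // mulKmx.
- by move=> t; rewrite evmxM evmx_const.
Qed.

Lemma eqv_mulr s A : \det s = 1 -> eqv A (A *m map_mx polyC s).
Proof.
move=> s1; have := @eqv_tr A^T _ (eqv_mull A^T (_ : \det s^T = 1)).
by rewrite trmxK trmx_mul trmxK matrix.map_trmx trmxK; apply; rewrite det_tr.
Qed.

(** The shears do not change [f], so the shear with coefficient [- f] is the inverse map. *)
Lemma eqv_shear i j f A q : i != j -> K f ->
  (forall c M, f (tv i j c *m M) = f M) -> (forall t, f (evmx A t) = q.[t]) ->
  eqv A (tv i j q *m A).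
Proof.
move=> ij Kf fI fq.
have K1 : mxmap K (fun M => tv i j (f M) *m M).
  by apply: mxmap_mul; [exact: mxmap_tv|exact: mxmap_id].
have K2 : mxmap K (fun M => tv i j (- f M) *m M).
  apply: mxmap_mul; last exact: mxmap_id; apply: mxmap_tv.
  by under eq_fun do rewrite -mulN1r; apply: fringM => //; apply: fringC.
exists (fun M => tv i j (f M) *m M), (fun M => tv i j (- f M) *m M); split=> //.
  by move=> M M1; rewrite !det_mulmx !det_tv // !fI M1 mulr1 tvK // tvKV.
by move=> t; rewrite evmxM evmx_tv fq.
Qed.

End Class.

(** The entries with indices in [S] embed the line by themselves. *)
Definition emb S A := forall t s, exists i j, S i j /\ dq (A i j) t s != 0.

Definition inalg S A (q : {poly C}) :=
  exists2 f, polyf S f & forall t, f (evmx A t) = q.[t].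

Lemma inalg_subalg S A : subalg (inalg S A).
Proof.
have [rC rD rM] := fring_polyf S.
split=> [c|p q [f Pf fp] [g Pg gq]|p q [f Pf fp] [g Pg gq]].
- by exists (fun=> c) => [|t]; rewrite ?hornerC //; apply: rC.
- by exists (fun M => f M + g M) => [|t]; rewrite ?hornerD ?fp ?gq //; apply: rD.
- by exists (fun M => f M * g M) => [|t]; rewrite ?hornerM ?fp ?gq //; apply: rM.
Qed.

Lemma inalg_coord (S : 'I_n -> 'I_n -> Prop) A i j : S i j -> inalg S A (A i j).
Proof.
move=> Sij; exists (fun M => M i j) => [|t]; last by rewrite evmxE.
exact: polyf_coord.
Qed.

(** Nakayama for the algebra as a module over itself: its elements that vanish at [t], divided by 'X
    - t, have no common zero by [emb], so they generate the full ideal of [t]. *)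
Lemma emb_inalg S A q : emb S A -> inalg S A q.
Proof.
move=> eA; have sB := inalg_subalg S A; have [BC BD BM] := sB.
have [i [j [Sij d0]]] := eA 0 0.
apply: (submod_full sB (subalg_submod sB) (inalg_coord A Sij)).
  by rewrite ltnNge -(dqp_eq0 _ 0); apply: contraNN d0 => /eqP; rewrite /dq => ->; rewrite horner0.
move=> t k; exists k.[t]%:P; first exact: BC.
have [gD gM] := gen_ideal_is_ideal (vanishing_in (inalg S A) t).
rewrite -dqpE mulrC; apply: (gM); rewrite -[_ - _]mulr1.
apply: (@weak_nullstellensatz _ (fun a => gen_ideal (vanishing_in (inalg S A) t) (('X - t%:P) * a))).
  split=> [a b Ha Hb|a b Hb]; first by rewrite mulrDr; apply: gD.
  by rewrite mulrCA; apply: gM.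
move=> s; have [k' [l [Skl d]]] := eA t s; exists (dqp (A k' l) t) => //.
rewrite dqpE; apply: gen_ideal_gen; split; last by rewrite hornerD hornerN hornerC subrr.
by apply: BD; [exact: inalg_coord|rewrite -polyCN; apply: BC].
Qed.

Lemma row_move_alg K i j A q : mxclass K -> i != j -> inalg (fun k _ => k != i) A q ->
  eqv K A (tv i j q *m A).
Proof.
move=> cK ij [f Pf fq]; apply: (eqv_shear cK ij (polyf_mxclass cK Pf)) => //.
apply: (Pf (fun g => forall c M, g (tv i j c *m M) = g M)).
  split=> [//|g g' G G' c M|g g' G G' c M]; by rewrite G G'.
by move=> k l ki c M; rewrite tv_mulE (negPf ki) addr0.
Qed.

Lemma row_move K i j A q : mxclass K -> i != j -> emb (fun k _ => k != i) A ->
  eqv K A (tv i j q *m A).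
Proof. by move=> cK ij eA; apply: row_move_alg => //; apply: emb_inalg. Qed.

End Equivalence.

(** * Generation of SL_n(C[t]) by shears *)

Section Generation.
Variable C : numClosedFieldType.

(** As no [g a] equals an [f b], the matrix units involved multiply to 0, and 1 plus a combination
    of them is a product of shears. *)
Lemma tv_sum_ind (R : comNzRingType) n J (Q : 'M[R]_n -> Prop) (s : seq J) (f g : J -> 'I_n) c M :
  (forall a b, g a != f b) -> (forall a q X, Q X -> Q (tv (f a) (g a) q *m X)) ->
  Q M -> Q ((1%:M + \sum_(a <- s) c a *: delta_mx (f a) (g a)) *m M).
Proof.
move=> ne HQ QM; elim: s => [|a r IH]; first by rewrite big_nil addr0 mul1mx.
have := HQ a (c a) _ IH; rewrite mulmxA big_cons /tv; set D := \sum_(_ <- _) _.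
have z : (c a *: delta_mx (f a) (g a)) *m D = 0.
  rewrite /D mulmx_sumr big1 // => b _.
  by rewrite -scalemxAl -scalemxAr mul_delta_mx_0 ?scaler0.
by rewrite mulmxDl mul1mx mulmxDr mulmx1 z addr0 -addrA [D + _]addrC.
Qed.

Lemma tv_block (R : comNzRingType) m (i j : 'I_m) (q : R) :
  tv (rshift 1 i) (rshift 1 j) q = block_mx 1%:M 0 0 (tv i j q) :> 'M[_]_(1 + m).
Proof.
rewrite /tv (_ : delta_mx _ _ = block_mx 0 0 0 (delta_mx i j) :> 'M[_]_(1 + m)).
  by rewrite scale_block_mx scalar_mx_block add_block_mx !scaler0 !addr0.
apply/matrixP => k l; rewrite -(splitK k) -(splitK l).
case: (fintype.split k) => a; case: (fintype.split l) => b; rewrite /= ?block_mxEul ?block_mxEur ?block_mxEdl ?block_mxEdr !mxE;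
  by rewrite ?eq_lrshift ?eq_rlshift ?(inj_eq (@rshift_inj _ _)) ?andbF.
Qed.

(** Euclid's algorithm on column 0 leaves a single nonzero entry, which divides the determinant and
    is thus constant. It is made a 1 in the corner, and the lower right block is treated by
    induction. *)
Lemma SL_poly_ind m (Q : 'M[{poly C}]_m -> Prop) : Q 1%:M ->
  (forall i j q M, i != j -> Q M -> Q (tv i j q *m M)) ->
  forall M, \det M = 1 -> Q M.
Proof.
elim: m Q => [|m IH] Q Q1 QT M M1.
  by rewrite (_ : M = 1%:M) //; apply/matrixP => -[].
have QTV i j q X : i != j -> Q (tv i j q *m X) -> Q X.
  by move=> ij QX; rewrite -(tvK q X ij); apply: QT.
have base X : \det X = 1 -> (forall i, X i 0 = (i == 0)%:R) -> Q X.
  move=> X1 X0; pose X' : 'M[_]_(1 + m) := X.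
  have l0 (j : 'I_1) : lshift m j = 0 :> 'I_m.+1 by apply/val_inj; case: j => -[].
  have XE : X' = block_mx 1%:M (ursubmx X') 0 (drsubmx X').
    rewrite -[LHS]submxK; congr block_mx; apply/matrixP => i j.
      by rewrite !mxE /X' !l0 X0 (ord1 i) (ord1 j).
    by rewrite !mxE /X' l0 X0.
  have X'1 : \det (drsubmx X') = 1.
    by have := congr1 (fun Z => \det Z) XE; rewrite det_ublock det1 mul1r => <-.
  suff : Q X' by []; rewrite XE.
  move: (ursubmx X') => r; move: {XE} (drsubmx X') X'1 => Y Y1.
  pose Q' Y := Q (block_mx 1%:M r 0 Y : 'M[_]_(1 + m)); rewrite -[Q _]/(Q' Y).
  apply: IH Y1 => [|i j q Z ij QZ]; last first.
    rewrite /Q' (_ : block_mx _ _ _ _ = tv (rshift 1 i) (rshift 1 j) q *m block_mx 1%:M r 0 Z).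
      by apply: QT => //; rewrite (inj_eq (@rshift_inj _ _)).
    by rewrite tv_block mulmx_block !mul1mx !mul0mx !mulmx0 !addr0 add0r.
  have := @tv_sum_ind _ _ _ Q (index_enum 'I_m) (fun=> 0) (@rshift 1 m) (fun j => r 0 j) 1%:M.
  rewrite mulmx1 /Q' (_ : block_mx _ _ _ _ =
      1%:M + \sum_j r 0 j *: delta_mx 0 (@rshift 1 m j) :> 'M[_]_(1 + m)); first by apply=> // a q Z; apply: QT.
  transitivity ((block_mx 1%:M 0 0 1%:M : 'M[{poly C}]_(1 + m)) +
      \sum_j r 0 j *: (delta_mx (0 : 'I_(1 + m)) (@rshift 1 m j) : 'M[_]_(1 + m))); last first.
    by rewrite -scalar_mx_block.
  apply/matrixP => k l; rewrite [RHS]mxE summxE.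
  under eq_bigr do rewrite !mxE.
  rewrite -(splitK k) -(splitK l).
  case: (fintype.split k) => a; case: (fintype.split l) => b /=; rewrite ?block_mxEul ?block_mxEur ?block_mxEdl ?block_mxEdr.
  - by rewrite big1 ?addr0 // => j _; rewrite eq_lrshift andbF mulr0.
  - rewrite (bigD1 b) //= eqxx andbT [a]ord1 (_ : (lshift m 0 == 0) = true) // mulr1 mxE add0r big1 ?addr0 //.
    by move=> j /negPf jb; rewrite (inj_eq (@rshift_inj _ _)) [b == j]eq_sym jb andbF mulr0.
  - by rewrite big1 ?addr0 // => j _; rewrite ?andbF ?mulr0 /= ?mulr0.
  - by rewrite big1 ?addr0 // => j _; rewrite ?andbF ?mulr0 /= ?mulr0.
have col X i c : \det X = 1 -> i != 0 -> c != 0 -> X i 0 = c%:P ->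
    (forall k, k != i -> X k 0 = 0) -> Q X.
  move=> X1 i0 c0 Xi Xk; have i0' : 0 != i by rewrite eq_sym.
  apply: (QTV 0 i c^-1%:P) => //; apply: (QTV i 0 (- c%:P)) => //.
  apply: base => [|k]; first by rewrite !det_mulmx !det_tv // !mul1r.
  rewrite !tv_mulE eqxx; have [->|ki] := eqVneq k i.
    by rewrite (negPf i0) addr0 Xi Xk // add0r -polyCM mulVf // mulr1 addrN.
  by rewrite Xk // add0r addr0 Xi -polyCM mulVf //; case: eqP.
have [w] := ubnP (\sum_i size (M i 0%R)); elim: w M M1 => // w IHw M M1 sw.
have [[i j] /= /and4P[ij Mi Mj sij]|no] := pickP (fun ij : 'I_m.+1 * 'I_m.+1 =>
    [&& ij.1 != ij.2, M ij.1 0 != 0, M ij.2 0 != 0 & (size (M ij.2 0%R) <= size (M ij.1 0%R))%N]).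
  apply: (QTV i j (- (M i 0 %/ M j 0))) => //; apply: IHw.
    by rewrite det_mulmx det_tv // mul1r.
  rewrite ltnS in sw; apply: leq_trans sw; rewrite (bigD1 i) //= [X in (_ < X)%N](bigD1 i) //=.
  rewrite -addSn leq_add //; last first.
    by apply: leq_sum => k ki; rewrite tv_mulE (negPf ki) addr0.
  rewrite tv_mulE eqxx; apply: leq_trans sij.
  by rewrite {1}(divp_eq (M i 0) (M j 0)) mulNr addrAC subrr add0r ltn_modp.
have [i Mi] : exists i, M i 0 != 0.
  apply/existsP; apply: contra_eqT M1 => /existsPn M0.
  by rewrite (expand_det_col M 0) big1 1?eq_sym ?oner_neq0 // => i _; move: (M0 i); rewrite negbK => /eqP ->; rewrite mul0r.
have Mk k : k != i -> M k 0 = 0.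
  move=> ki; apply: contra_neq_eq ki => Mk; apply/eqP; apply: contraT => ki.
  have := no (k, i); have := no (i, k); rewrite /= Mi Mk ki [i == k]eq_sym ki /= => h1 h2.
  by have := leq_total (size (M i 0%R)) (size (M k 0%R)); rewrite h1 h2.
have [c c0 Mic] : exists2 c, c != 0 & M i 0 = c%:P.
  have : M i 0 %| 1.
    rewrite -M1 (expand_det_col M 0) (bigD1 i) //= big1 ?addr0 ?dvdp_mulr // => k ki.
    by rewrite Mk // mul0r.
  by rewrite dvdp1 => /size_poly1P.
have [i0|i0] := eqVneq i 0; last exact: (col M i c).
have [m0|m0] := posnP m.
  apply: base => // k; have one (u : 'I_m.+1) : u = 0.
    by apply/val_inj; case: u => u /=; rewrite {1}m0; case: u.
  rewrite [k]one eqxx -M1 (expand_det_col M 0) (bigD1 0) //= big1 => [|u]; last by rewrite [u]one eqxx.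
  rewrite addr0 /cofactor /= addn0 expr0 mul1r.
  suff -> : \det (row' 0 (col' 0 M)) = 1 by rewrite mulr1.
  by move: (row' _ _); rewrite /= m0 => Z; rewrite det_mx00.
have [k k0] : exists k : 'I_m.+1, k != 0.
  by exists ord_max; rewrite -val_eqE /= -lt0n.
have k0' : 0 != k by rewrite eq_sym.
(* The constant stands in the corner; two shears carry it to row [k], because [col] makes the 1 in
   the corner from a constant in another row. *)
apply: (QTV k 0 1) => //; apply: (QTV 0 k (- 1)) => //; apply: (col _ k c) => //.
- by rewrite !det_mulmx !det_tv // !mul1r.
- by rewrite !tv_mulE eqxx (negPf k0) addr0 mul1r Mk ?i0 // add0r -Mic i0.
- move=> u uk; rewrite !tv_mulE (negPf uk) addr0 eqxx; have [->|u0] := eqVneq u 0.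
    by rewrite [M k 0]Mk ?i0 // add0r mul1r mulN1r addrN.
  by rewrite addr0 Mk // i0.
Qed.

End Generation.

(** * The standard line *)

(** A triangular matrix with first row [u], whose entry at (1, 1) corrects the determinant; if
    [u 0 0] is 0, a shear makes it nonzero beforehand. *)
Lemma SL_complete_row (F : fieldType) m (u : 'rV[F]_m.+2) : u != 0 ->
  exists s : 'M[_]_m.+2, \det s = 1 /\ row 0 s = u.
Proof.
have main (v : 'rV[F]_m.+2) : v 0 0 != 0 -> exists s : 'M[_]_m.+2, \det s = 1 /\ row 0 s = v.
  move=> v0; exists (\matrix_(i, j) if i == 0 then v 0 j else
    if i == j then if i == 1 then (v 0 0)^-1 else 1 else 0); split; last first.
    by apply/rowP => j; rewrite !mxE.
  rewrite -det_tr det_trig; last first.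
    apply/is_trig_mxP => i j ij; rewrite !mxE -!val_eqE /= (gtn_eqF ij).
    by rewrite (gtn_eqF (leq_ltn_trans (leq0n _) ij)).
  rewrite !big_ord_recl big1 => [|i _]; rewrite !mxE //= ?eqxx //.
  by rewrite mulr1 mulfV.
move=> /rV0Pn[k uk]; have [u0|u0] := eqVneq (u 0 0) 0; last exact: main.
have k0 : k != 0 by apply: contra_neq uk => ->.
have [|s [s1 sE]] := main (u *m tv k 0 1).
  rewrite mulmxDr mulmx1 scale1r !mxE u0 add0r (bigD1 k) //= big1 => [|i ik].
    by rewrite mxE !eqxx mulr1 addr0.
  by rewrite mxE (negPf ik) mulr0.
exists (s *m tv k 0 (-1)); split; first by rewrite det_mulmx s1 mul1r det_tv.
by rewrite row_mul sE -mulmxA tvD // addrN tv0 mulmx1.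
Qed.

Lemma SL_complete_col (F : fieldType) m (u : 'cV[F]_m.+2) : u != 0 ->
  exists s : 'M[_]_m.+2, \det s = 1 /\ col 0 s = u.
Proof.
move=> u0; have [|s [s1 sE]] := @SL_complete_row F m u^T; first by rewrite trmx_eq0.
by exists s^T; rewrite det_tr -tr_row sE trmxK.
Qed.

Section Standard.
Variables (C : numClosedFieldType).

Lemma emb_row n (A B : 'M[{poly C}]_n) (S : 'I_n -> 'I_n -> Prop) :
  (forall i j, S i j -> A i j = B i j) -> emb S A -> emb S B.
Proof.
by move=> AB eA t s; have [i [j [Sij d]]] := eA t s; exists i, j; rewrite -AB.
Qed.

Lemma emb_sub n (A : 'M[{poly C}]_n) (S S' : 'I_n -> 'I_n -> Prop) :
  (forall i j, S i j -> S' i j) -> emb S A -> emb S' A.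
Proof.
by move=> SS eA t s; have [i [j [Sij d]]] := eA t s; exists i, j; split=> //; apply: SS.
Qed.

(** The matrix [A' *m invmx A] fixes row 0, so it is a product of shears of the other rows. Row 0
    stays the same throughout and embeds the line, so each of these shears extends. *)
Lemma same_row m (K : ('M[C]_m.+1 -> C) -> Prop) (A A' : 'M[{poly C}]_m.+1) :
  mxclass K -> \det A = 1 -> \det A' = 1 -> row 0 A = row 0 A' ->
  emb (fun k _ => k = 0) A -> eqv K A A'.
Proof.
move=> cK A1 A'1 rA eA; have uA : A \in unitmx by rewrite unitmxE A1 unitr1.
pose X := A' *m invmx A.
have X1 : \det X = 1 by rewrite det_mulmx det_inv A1 A'1 invr1 mulr1.
have X0 : row 0 X = row 0 1%:M by rewrite row_mul -rA -row_mul mulmxV.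
pose Q Y := row 0 Y = row 0 1%:M /\ eqv K A (Y *m A).
suff [_] : Q X by rewrite /X mulmxKV.
have Q1 : Q 1%:M by split=> //; rewrite mul1mx; apply: eqv_refl.
have QT i j q Y : i != j -> i != 0 -> Q Y -> Q (tv i j q *m Y).
  move=> ij i0 [Y0 eY]; split.
    by apply/rowP => l; rewrite -Y0 [LHS]mxE [RHS]mxE tv_mulE eq_sym (negPf i0) addr0.
  apply: (eqv_trans cK eY); rewrite -mulmxA; apply: row_move => //.
  apply: (@emb_sub _ _ (fun k _ => k = 0)) => [k l ->|]; first by rewrite eq_sym.
  apply: emb_row eA => k l ->; have /rowP/(_ l) : row 0 A = row 0 (Y *m A).
    by rewrite row_mul Y0 -row_mul mul1mx.
  by rewrite !mxE.
pose X' : 'M[_]_(1 + m) := X.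
have XE : X' = block_mx 1%:M 0 (dlsubmx X') (drsubmx X').
  have l0 (j : 'I_1) : lshift m j = 0 :> 'I_m.+1 by apply/val_inj; case: j => -[].
  rewrite -[LHS]submxK; congr block_mx; apply/matrixP => i j; have /rowP := X0.
    by move=> /(_ 0); rewrite !mxE /X' !l0 => ->; rewrite (ord1 i) (ord1 j) eqxx.
  by move=> /(_ (rshift 1 j)); rewrite !mxE /X' !l0.
have X'1 : \det (drsubmx X') = 1.
  by have := congr1 (fun Z => \det Z) XE; rewrite det_lblock det1 mul1r => <-.
suff : Q X' by []; rewrite XE; move: (dlsubmx X') => b.
move: {XE} (drsubmx X') X'1 => Z Z1; move: Z Z1 b.
apply: SL_poly_ind => [b|i j q Z ij QZ b]; last first.
  rewrite (_ : block_mx _ _ _ _ =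
      tv (rshift 1 i) (rshift 1 j) q *m block_mx 1%:M 0 (tv i j (- q) *m b) Z).
    by apply: QT => //; rewrite (inj_eq (@rshift_inj _ _)).
  by rewrite tv_block mulmx_block !mul1mx !mul0mx ?mulmx0 ?addr0 ?add0r tvKV.
have := @tv_sum_ind _ _ _ Q (index_enum 'I_m) (@rshift 1 m) (fun=> 0) (fun j => b j 0) 1%:M.
rewrite mulmx1 (_ : block_mx _ _ _ _ =
    1%:M + \sum_j b j 0 *: delta_mx (@rshift 1 m j) 0 :> 'M[_]_(1 + m)).
  by apply=> // a q V; apply: QT.
transitivity ((block_mx 1%:M 0 0 1%:M : 'M[{poly C}]_(1 + m)) +
      \sum_j b j 0 *: (delta_mx (@rshift 1 m j) (0 : 'I_(1 + m)) : 'M[_]_(1 + m))); last first.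
  by rewrite -scalar_mx_block.
apply/matrixP => k l; rewrite [RHS]mxE summxE; under eq_bigr do rewrite !mxE.
rewrite -(splitK k) -(splitK l).
case: (fintype.split k) => a; case: (fintype.split l) => c /=;
  rewrite ?block_mxEul ?block_mxEur ?block_mxEdl ?block_mxEdr.
- by rewrite big1 ?addr0 // => j _; rewrite eq_lrshift mulr0.
- by rewrite big1 ?addr0 // => j _; rewrite ?andbF ?mulr0 /= ?mulr0.
- rewrite (bigD1 a) //= eqxx [c]ord1 (_ : (lshift m 0 == 0) = true) // mulr1 mxE add0r big1 ?addr0 //.
  by move=> j /negPf jb; rewrite (inj_eq (@rshift_inj _ _)) [a == j]eq_sym jb mulr0.
- by rewrite big1 ?addr0 // => j _; rewrite ?andbF ?mulr0 /= ?mulr0.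
Qed.

Variable m : nat.
Let n := m.+2.
Implicit Types A : 'M[{poly C}]_n.

(** The block with rows (t, 1) and (t - 1, 1), completed by an identity matrix. *)
Definition std : 'M[{poly C}]_n := tv 0 1 1 *m tv 1 0 ('X - 1).

Lemma det_std : \det std = 1.
Proof. by rewrite det_mulmx !det_tv // mul1r. Qed.

Lemma std00 : std 0 0 = 'X.
Proof. by rewrite tv_mulE eqxx mul1r !mxE /=; ring. Qed.

Lemma row_std : row 0 std = row_mx 'X%:M (delta_mx 0 0) :> 'rV[{poly C}]_(1 + m.+1).
Proof.
apply/rowP => j; rewrite [LHS]mxE tv_mulE eqxx mul1r [RHS]mxE.
case: splitP => a ja; rewrite !mxE -!val_eqE /= ja; last first.
  by case: a {ja} => -[|a] ? /=; rewrite ?mulr0 ?mulr1 ?addr0 ?add0r.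
by rewrite [a]ord1 /= mulr1; ring.
Qed.

Section WithClass.
Variable K : ('M[C]_n -> C) -> Prop.
Hypothesis cK : mxclass K.

Let emb0 A b : A 0 0 = 'X + b%:P -> emb (fun k l => k = 0 /\ l = 0) A.
Proof. by move=> E t s; exists 0, 0; rewrite E dqD dqX dqC addr0 oner_neq0. Qed.

Lemma eqv_std_row A b (r : 'rV[C]_m.+1) : \det A = 1 ->
  row 0 A = row_mx ('X + b%:P)%:M (map_mx polyC r) :> 'rV_(1 + m.+1) ->
  (exists2 s : 'M[C]_m.+1, \det s = 1 & r *m s = delta_mx 0 0) -> eqv K A std.
Proof.
move=> A1 A0 [s s1 rs].
pose T : 'M[C]_(1 + m.+1) := block_mx 1%:M 0 (s *m (- b *: delta_mx 0 0)) s.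
have T1 : \det T = 1 by rewrite det_lblock det1 mul1r.
have rowE : row 0 (A *m map_mx polyC T) = row 0 std.
  have TE : map_mx polyC T = block_mx 1%:M 0 (map_mx polyC (s *m (- b *: delta_mx 0 0))) (map_mx polyC s).
    by rewrite map_block_mx map_mx1 map_mx0.
  have E : row_mx ('X + b%:P)%:M (map_mx polyC r) *m block_mx 1%:M 0
      (map_mx polyC (s *m (- b *: delta_mx 0 0))) (map_mx polyC s) =
      row_mx 'X%:M (delta_mx 0 0) :> 'rV_(1 + m.+1).
    rewrite mul_row_block mulmx1 mulmx0 add0r -!map_mxM.
    rewrite mulmxA rs -scalemxAr mul_delta_mx; congr row_mx.
      apply/matrixP => i j; by rewrite !mxE !ord1 eqxx mulr1 rmorphN /= !mulr1n addrK.
    exact: map_delta_mx.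
  by rewrite row_std row_mul A0 TE.
apply: (eqv_trans cK (eqv_mulr cK A T1)); apply: same_row => //.
- by rewrite det_mulmx A1 mul1r det_map_mx T1 rmorph1.
- exact: det_std.
apply: (@emb_row _ std) => [i j -> | t u]; first by have /rowP/(_ j) := rowE; rewrite !mxE.
by exists 0, 0; rewrite std00 dqX oner_neq0.
Qed.

(** The entry at (0, 0) embeds the line by itself, so multiples of row 0 can be subtracted from the
    other rows; remainders modulo an affine polynomial are constants. *)
Lemma clear_col A b : \det A = 1 -> A 0 0 = 'X + b%:P ->
  exists B, [/\ eqv K A B, B 0 0 = 'X + b%:P & forall i, i != 0 -> exists c, B i 0 = c%:P].
Proof.
move=> A1 A0; pose Q Y := row 0 Y = row 0 A /\ eqv K A Y.
have QA : Q A by split=> //; apply: eqv_refl.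
have QT (j : 'I_m.+1) q Y : Q Y -> Q (tv (@rshift 1 m.+1 j) 0 q *m Y).
  move=> [Y0 eY]; split.
    by apply/rowP => l; rewrite -Y0 [LHS]mxE [RHS]mxE tv_mulE addr0.
  apply: (eqv_trans cK eY); apply: row_move => //.
  apply: (@emb_sub _ _ (fun k l => k = 0 /\ l = 0)) => [k l [-> _] //|].
  by apply: (emb0 (b := b)); have /rowP/(_ 0) := Y0; rewrite !mxE A0.
have [] := @tv_sum_ind _ _ _ Q (index_enum 'I_m.+1) (@rshift 1 m.+1) (fun=> 0)
  (fun j => - (A (rshift 1 j) 0 %/ ('X + b%:P))) A _ QT QA => //.
set B := _ *m A => B0 eB; exists B; split=> //.
  by have /rowP/(_ 0) := B0; rewrite !mxE A0.
move=> i i0; have [j ->] : exists j, i = @rshift 1 m.+1 j.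
  case: (unliftP 0 i) i0 => [j ->|->]; last by rewrite eqxx.
  by exists j; apply: val_inj.
suff sB : (size (B (rshift 1 j) 0%R) <= 1)%N by exists (B (rshift 1 j) 0)`_0; apply: size1_polyC.
have -> : B (rshift 1 j) 0 = A (rshift 1 j) 0 %% ('X + b%:P).
  rewrite /B mulmxDl mul1mx mxE mulmx_suml summxE (bigD1 j) //= big1 => [|k kj].
    rewrite addr0 -scalemxAl mxE mxE (bigD1 0) //= big1 => [|l l0].
      rewrite mxE !eqxx mul1r addr0 A0.
      by rewrite {1}(divp_eq (A (rshift 1 j) 0) ('X + b%:P)); ring.
    by rewrite mxE (negPf l0) andbF mul0r.
  rewrite -scalemxAl mxE mxE big1 ?mulr0 // => l _.
  rewrite mxE; case: eqP => [/(@rshift_inj 1 m.+1) jk|]; last by rewrite mul0r.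
  by move: kj; rewrite jk eqxx.
by have := ltn_modp (A (rshift 1 j) 0) ('X + b%:P); rewrite -size_poly_gt0 size_XaddC.
Qed.

(** By [clear_col] for the transpose, the rest of row 0 becomes a constant vector [r]. It is not
    zero, since otherwise the affine entry would divide the determinant 1. *)
Lemma eqv_std_entry A b : \det A = 1 -> A 0 0 = 'X + b%:P -> eqv K A std.
Proof.
move=> A1 A0; have [||B [eB B0 Bc]] := @clear_col A^T b; rewrite ?det_tr // ?mxE //.
have {}eB : eqv K A B^T by have := eqv_tr cK eB; rewrite trmxK.
have B1 : \det B^T = 1 by apply: eqv_det eB.
apply: (eqv_trans cK eB); have {B0} : B^T 0 0 = 'X + b%:P by rewrite mxE.
have {Bc} : forall j, j != 0 -> exists c, B^T 0 j = c%:P by move=> j /Bc; rewrite mxE.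
move: B^T B1 => {eB B A A1 A0} D D1 Dc D0.
pose r : 'rV[C]_m.+1 := \row_j (D 0 (rshift 1 j))`_0.
have rE j : D 0 (@rshift 1 m.+1 j) = (r 0 j)%:P.
  by have [//|c E] := Dc (rshift 1 j); rewrite mxE E coefC.
have rowD : row 0 D = row_mx ('X + b%:P)%:M (map_mx polyC r) :> 'rV_(1 + m.+1).
  apply/rowP => j; rewrite [LHS]mxE [RHS]mxE; case: splitP => a ja.
    rewrite mxE [a]ord1 eqxx mulr1n -D0; congr (D _ _); apply: val_inj.
    by rewrite /= ja [a]ord1.
  by rewrite mxE -rE; congr (D _ _); apply: val_inj.
have r0 : r != 0.
  apply: contra_eq_neq D1 => r0; rewrite (expand_det_row D 0) (bigD1 0) //= big1 => [|j j0].
    rewrite addr0 D0; apply/eqP => /(congr1 (fun p : {poly C} => p.[- b])).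
    by rewrite hornerM hornerD hornerX !hornerC addNr mul0r => /eqP; rewrite eq_sym oner_eq0.
  have [k ->] : exists k, j = @rshift 1 m.+1 k.
    case: (unliftP 0 j) j0 => [k ->|->]; last by rewrite eqxx.
    by exists k; apply: val_inj.
  by rewrite rE r0 mxE mul0r.
have [m0|m0] := posnP m; last first.
  have [m' mE] : exists m', m = m'.+1 by exists m.-1; rewrite prednK.
  apply: (eqv_std_row D1 rowD); move: (r) r0; rewrite mE => r' r'0.
  have [s [s1 sE]] := SL_complete_row r'0; exists (invmx s); first by rewrite det_inv s1 invr1.
  by rewrite -sE -row_mul mulmxV ?unitmxE ?s1 ?unitr1 // row1.
have one (j : 'I_m.+1) : j = 0.
  by apply/val_inj; case: j => j /=; rewrite {1}m0; case: j.
have rho0 : r 0 0 != 0.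
  by apply: contra_neq r0 => r0; apply/rowP => j; rewrite [j]one r0 mxE.
(* For n = 2 the vector [r] is a single number, which SL_1 cannot normalize. Multiplication by
   diag(a, 1/a) on the left and by its inverse on the right keeps the entry at (0, 0) and multiplies
   [r] by the square of [a]. *)
pose a := sqrtC (r 0 0)^-1.
have a2 : a ^+ 2 * r 0 0 = 1 by rewrite sqrtCK mulVf.
have a0 : a != 0 by apply: contra_eq_neq a2 => ->; rewrite expr0n mul0r eq_sym oner_neq0.
pose g c : 'rV[C]_n := \row_j if j == 0 then c else c^-1.
have gd c : c != 0 -> \det (diag_mx (g c)) = 1.
  move=> c0; rewrite det_diag !big_ord_recl big1 => [|j _].
    by rewrite !mxE /= mulr1 mulfV.
  by case: j => j jm; exfalso; move: jm; rewrite m0.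
have a0' : a^-1 != 0 by rewrite invr_eq0.
apply: (eqv_trans cK (eqv_mull cK D (gd a a0))).
apply: (eqv_trans cK (eqv_mulr cK _ (gd a^-1 a0'))).
set E := _ *m _ *m _.
apply: (@eqv_std_row _ b (const_mx 1)).
- by rewrite !det_mulmx D1 !det_map_mx !gd // !rmorph1 !mulr1.
- apply/rowP => j; rewrite [LHS]mxE [RHS]mxE /E !map_diag_mx mul_mx_diag mxE mul_diag_mx !mxE eqxx.
  case: splitP => k jk; rewrite !mxE.
    have -> : j = 0 by apply: val_inj; rewrite /= jk [k]ord1.
    by rewrite eqxx D0 [k]ord1 eqxx mulr1n mulrC mulrA -polyCM mulVf // mul1r.
  have -> : j = @rshift 1 m.+1 k by apply: val_inj.
  rewrite /= rE [k]one invrK mulrAC -!polyCM -expr2 a2 //.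
- exists 1%:M; first exact: det1.
  by rewrite mulmx1; apply/rowP => j; rewrite !mxE [j]one eqxx.
Qed.

(** Completing [u], divided by [a], and [v] to matrices of determinant 1 puts the affine function
    into the corner. *)
Lemma eqv_std_affine A (u : 'rV[C]_n) (v : 'cV[C]_n) a b : \det A = 1 -> a != 0 ->
  (map_mx polyC u *m A *m map_mx polyC v) 0 0 = a%:P * 'X + b%:P -> eqv K A std.
Proof.
move=> A1 a0 E.
have nz : a%:P * 'X + b%:P != 0 :> {poly C}.
  apply/eqP => /(congr1 (fun p : {poly C} => p`_1)).
  by rewrite coefD coefCM coefX coefC /= mulr1 addr0 coef0 => /eqP; rewrite (negPf a0).
have u0 : a^-1 *: u != 0.
  rewrite scaler_eq0 invr_eq0 negb_or a0 /=; apply: contra_neq nz => u0.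
  by rewrite -E u0 map_mx0 !mul0mx mxE.
have v0 : v != 0 by apply: contra_neq nz => v0; rewrite -E v0 map_mx0 mulmx0 mxE.
have [s [s1 sE]] := SL_complete_row u0; have [t [t1 tE]] := SL_complete_col v0.
apply: (eqv_trans cK (eqv_mull cK A s1)); apply: (eqv_trans cK (eqv_mulr cK _ t1)).
apply: (@eqv_std_entry _ (a^-1 * b)).
  by rewrite !det_mulmx A1 !det_map_mx s1 t1 !rmorph1 !mulr1.
transitivity ((map_mx polyC (a^-1 *: u) *m A *m map_mx polyC v) 0 0).
  rewrite -sE -tE !mxE; apply: eq_bigr => i _; rewrite !mxE; congr (_ * _).
  by apply: eq_bigr => k _; rewrite !mxE.
by rewrite map_mxZ -!scalemxAl mxE E mulrDr !mulrA -!polyCM mulVf // mul1r.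
Qed.

Lemma eqv_std_tr : eqv K std^T std.
Proof. by apply: (@eqv_std_entry _ 0); rewrite ?det_tr ?det_std // mxE std00 addr0. Qed.

End WithClass.
End Standard.

(** * Matrices of difference quotients and degenerate lines *)

Section DifferenceMatrix.
Variable C : numClosedFieldType.

Definition dqmx m n (A : 'M[{poly C}]_(m, n)) (t s : C) : 'M[C]_(m, n) :=
  \matrix_(i, j) dq (A i j) t s.

Lemma dqmxM m n p (A : 'M[{poly C}]_(m, n)) (B : 'M[_]_(n, p)) t s :
  dqmx (A *m B) t s = dqmx A t s *m evmx B s + evmx A t *m dqmx B t s.
Proof.
apply/matrixP => i j; rewrite !mxE dq_sum -big_split /=; apply: eq_bigr => k _.
by rewrite !mxE dqM.
Qed.

Lemma dqmx_const m n (A : 'M[C]_(m, n)) t s : dqmx (map_mx polyC A) t s = 0.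
Proof. by apply/matrixP => i j; rewrite !mxE dqC. Qed.

Lemma dqmxMl m n p (A : 'M[C]_(m, n)) (B : 'M[{poly C}]_(n, p)) t s :
  dqmx (map_mx polyC A *m B) t s = A *m dqmx B t s.
Proof. by rewrite dqmxM dqmx_const mul0mx add0r evmx_const. Qed.

Lemma dqmx_tr m n (A : 'M[{poly C}]_(m, n)) t s : dqmx A^T t s = (dqmx A t s)^T.
Proof. by apply/matrixP => i j; rewrite !mxE. Qed.

Definition embT n (A : 'M[{poly C}]_n) := forall t s, dqmx A t s != 0.

Lemma embT_mull n s (A : 'M[{poly C}]_n) : \det s = 1 -> embT A -> embT (map_mx polyC s *m A).
Proof.
move=> s1 eA t u; rewrite dqmxMl; apply: contra_neq (eA t u) => h.
by rewrite -[LHS](@mulKmx _ _ _ s) ?h ?mulmx0 // unitmxE s1 unitr1.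
Qed.

Lemma embT_tr n (A : 'M[{poly C}]_n) : embT A -> embT A^T.
Proof. by move=> eA t s; rewrite dqmx_tr trmx_eq0. Qed.

Lemma embT_mulr n s (A : 'M[{poly C}]_n) : \det s = 1 -> embT A -> embT (A *m map_mx polyC s).
Proof.
move=> s1 /embT_tr/(embT_mull (_ : \det s^T = 1)) H.
rewrite -[_ *m _]trmxK trmx_mul; apply: embT_tr; rewrite matrix.map_trmx.
by apply: H; rewrite det_tr.
Qed.

(** Rank at most 1, expressed by 2 x 2 minors. *)
Definition rank1 m n (M : 'M[C]_(m, n)) :=
  forall i i' j j', M i j * M i' j' = M i j' * M i' j.

Lemma rank1P m n (M : 'M[C]_(m, n)) : rank1 M -> exists (u : 'cV[C]_m) (v : 'rV[C]_n), M = u *m v.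
Proof.
have [->|/matrix0Pn[i [j Mij]]] := eqVneq M 0.
  by exists 0, 0; rewrite mul0mx.
move=> r; exists (col j M), ((M i j)^-1 *: row i M).
apply/matrixP => k l; rewrite mxE big_ord1 !mxE.
by rewrite mulrCA (r k i j l) mulrCA mulVf ?mulr1.
Qed.

Lemma rank1_mul m n p (M : 'M[C]_(m, n)) (s : 'M[C]_(p, m)) : rank1 M -> rank1 (s *m M).
Proof.
move=> /rank1P[u [v ->]] i i' j j'; rewrite mulmxA !mxE !big_ord1; ring.
Qed.

Section Degenerate.
Variable m : nat.
Let n := m.+2.
Implicit Types A : 'M[{poly C}]_n.
Variable K : ('M[C]_n -> C) -> Prop.
Hypothesis cK : mxclass K.

(** Conjugation takes [u] to the first basis vector. Then only row 0 varies, so it embeds the line;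
    its first entry is 1 by the determinant, and adding 'X times row 0 to row 1 creates the entry
    'X. *)
Lemma eqv_std_unipotent A (u : 'cV[C]_n) (v : 'rV[{poly C}]_n) : \det A = 1 -> embT A ->
  A = 1%:M + map_mx polyC u *m v -> eqv K A (std C m).
Proof.
move=> A1 eA AE.
have u0 : u != 0.
  apply: contraTneq isT => u0; have := eA 0 0.
  by rewrite AE u0 map_mx0 mul0mx addr0 -(map_mx1 polyC) dqmx_const eqxx.
have [s [s1 sE]] := SL_complete_col u0.
have us : s \in unitmx by rewrite unitmxE s1 unitr1.
have s1' : \det (invmx s) = 1 by rewrite det_inv s1 invr1.
pose B := map_mx polyC (invmx s) *m A *m map_mx polyC s.
apply: (eqv_trans cK (eqv_mull cK A s1')); apply: (eqv_trans cK (eqv_mulr cK _ s1)).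
rewrite -/B; have B1 : \det B = 1 by rewrite !det_mulmx !det_map_mx A1 s1 s1' !rmorph1 !mulr1.
have eB : embT B by apply: embT_mulr => //; apply: embT_mull.
pose w := v *m map_mx polyC s.
have BE : B = 1%:M + delta_mx 0 0 *m w.
  have si : map_mx polyC (invmx s) *m map_mx polyC s = 1%:M.
    by rewrite -map_mxM mulVmx // map_mx1.
  rewrite /B AE mulmxDr mulmxDl mulmx1 si; congr (_ + _).
  rewrite mulmxA -mulmxA -/w -map_mxM -sE colE mulKmx //.
  by rewrite map_delta_mx.
clearbody w B.
have Bij i j : B i j = (i == j)%:R + (i == 0)%:R * w 0 j.
  by rewrite BE !mxE big_ord1 !mxE eqxx andbT.
have w0 : w 0 0 = 0.
  apply: (addrI 1); rewrite addr0 -[RHS]B1 -det_tr det_trig; last first.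
    apply/is_trig_mxP => i j ij; rewrite mxE Bij -!val_eqE /= (gtn_eqF ij).
    by rewrite (gtn_eqF (leq_ltn_trans (leq0n _) ij)) mul0r addr0.
  rewrite big_ord_recl big1 => [|i _]; rewrite !mxE Bij ?eqxx ?mul1r ?mulr1 //.
  by rewrite /= mul0r addr0.
have eB0 : emb (fun k _ => k = 0) B.
  move=> t x; have /matrix0Pn[i [j]] := eB t x; rewrite mxE Bij => d.
  exists 0, j; split=> //; move: d; have [->|i0] := eqVneq i 0; first by rewrite Bij.
  by rewrite mul0r addr0; case: (i == j); rewrite ?dq1 ?dq0 eqxx.
have e : emb (fun k _ => k != 1) B by apply: emb_sub eB0 => k l ->.
apply: (eqv_trans cK (row_move 'X cK (_ : 1 != 0) e)) => //.
apply: (@eqv_std_affine _ _ _ cK _ (delta_mx 0 1) (delta_mx 0 0) 1 0).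
- by rewrite det_mulmx det_tv // mul1r.
- exact: oner_neq0.
rewrite !map_delta_mx -rowE -colE mxE mxE tv_mulE eqxx !Bij w0 /=; ring.
Qed.

(** For M = u v and N = p q, a 2 x 2 minor of M - N is up to sign the product of a minor of (u, p)
    and a minor of (v, q). Hence the columns of M are multiples of the column of N, or the rows of M
    are multiples of the row of N. *)
Lemma rank1_split (M N : 'M[C]_n) i0 j0 : N i0 j0 != 0 -> rank1 N -> rank1 M -> rank1 (M - N) ->
  (forall i k, M i k * N i0 j0 = M i0 k * N i j0) \/ (forall i k, M i k * N i0 j0 = M i j0 * N i0 k).
Proof.
move=> N0 rN rM rMN.
have [u [v ME]] := rank1P rM; have [p [q NE]] := rank1P rN.
have {}ME i k : M i k = u i 0 * v 0 k by rewrite ME mxE big_ord1.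
have {}NE i k : N i k = p i 0 * q 0 k by rewrite NE mxE big_ord1.
have [U|/existsNP[i /existsNP[k /eqP x]]] := pselect (forall i k, M i k * N i0 j0 = M i0 k * N i j0).
  by left.
right=> i' k'; rewrite !ME !NE; have := rMN i i0 k' j0; rewrite !mxE !ME !NE => /eqP.
rewrite -subr_eq0 (_ : _ - _ = (u i0 0 * p i 0 - u i 0 * p i0 0) * (v 0 k' * q 0 j0 - v 0 j0 * q 0 k')); last by ring.
rewrite mulf_eq0 => /orP[|] /eqP h; last first.
  by apply/eqP; rewrite -subr_eq0; apply/eqP; rewrite -[RHS](mulr0 (u i' 0 * p i0 0)) -h; ring.
case/negP: x; apply/eqP; rewrite !ME !NE; apply/eqP; rewrite -subr_eq0; apply/eqP.
by rewrite -[RHS](mulr0 (- v 0 k * q 0 j0)) -h; ring.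
Qed.

(** After normalization to the value 1 at t = 0, the values of B - 1 and their differences have rank
    at most 1. By [rank1_split] they share the column or the row of one fixed value [N], so [B] or
    its transpose has the form of [eqv_std_unipotent]. *)
Lemma eqv_std_degenerate A : \det A = 1 -> embT A ->
  (forall t s, rank1 (evmx A s - evmx A t)) -> eqv K A (std C m).
Proof.
move=> A1 eA rA.
pose g := evmx A 0; have g1 : \det g = 1 by rewrite det_evmx A1 hornerC.
have ug : g \in unitmx by rewrite unitmxE g1 unitr1.
have g1' : \det (invmx g) = 1 by rewrite det_inv g1 invr1.
pose B := map_mx polyC (invmx g) *m A; apply: (eqv_trans cK (eqv_mull cK A g1')); rewrite -/B.
have B1 : \det B = 1 by rewrite det_mulmx det_map_mx A1 g1' rmorph1 mulr1.
have eB : embT B by apply: embT_mull.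
have B0 : evmx B 0 = 1%:M by rewrite evmxM evmx_const mulVmx.
have rB t s : rank1 (evmx B s - evmx B t).
  by rewrite !evmxM !evmx_const -mulmxBr; apply: rank1_mul.
clearbody B; have [s0 Bs0] : exists s, evmx B s - 1%:M != 0.
  apply: contrapT => /forallNP H; have := eB 0 1; rewrite (_ : dqmx B 0 1 = 0) ?eqxx //.
  have {}H s : evmx B s = 1%:M by apply/eqP; rewrite -subr_eq0; apply/negPn/negP/H.
  apply/matrixP => i j; rewrite !mxE -[LHS]mul1r -{1}[1]subr0 dqE.
  by rewrite -!(evmxE B) !H subrr.
pose N := evmx B s0 - 1%:M; pose M := B - 1%:M.
have ME t i j : (M i j).[t] = (evmx B t - 1%:M) i j.
  by rewrite !mxE hornerD hornerN /horner_eval; case: (i == j); rewrite ?hornerE.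
have rN : rank1 N by rewrite /N -B0; apply: rB.
have /matrix0Pn[i0 [j0 N0]] : N != 0 by [].
have split t : (forall i k, (M i k).[t] * N i0 j0 = (M i0 k).[t] * N i j0) \/
               (forall i k, (M i k).[t] * N i0 j0 = (M i j0).[t] * N i0 k).
  have rM : rank1 (evmx B t - 1%:M) by rewrite -B0; apply: rB.
  have rMN : rank1 (evmx B t - 1%:M - N) by rewrite /N opprB addrA subrK; apply: rB.
  have [h|h] := rank1_split N0 rN rM rMN; [left|right] => i k; by rewrite !ME h.
have BM : B = 1%:M + M by rewrite /M addrC subrK.
(* For each [t] one of two polynomial conditions holds; if both failed somewhere, a generic [t]
   would violate both. *)
clearbody M N; have [U|V] : (forall i k, M i k * (N i0 j0)%:P = M i0 k * (N i j0)%:P) \/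
             (forall i k, M i k * (N i0 j0)%:P = M i j0 * (N i0 k)%:P).
  apply: contrapT => /not_orP[/existsNP[i /existsNP[k /eqP x]]].
  move=> /existsNP[i' /existsNP[k' /eqP y]].
  rewrite -subr_eq0 in x; rewrite -subr_eq0 in y.
  have [t /=] := cofin_ex (cofinI (cofin_poly x) (cofin_poly y)).
  rewrite !(hornerD, hornerN, hornerM, hornerC) => -[].
  by have [h|h] := split t; rewrite !h subrr eqxx.
- apply: (@eqv_std_unipotent _ (\col_i (N i j0 / N i0 j0)) (row i0 M)) => //.
  rewrite BM; congr (_ + _); apply/matrixP => i k.
  rewrite [RHS]mxE big_ord1 !mxE polyCM mulrAC [_%:P * M _ _]mulrC -U.
  by rewrite -mulrA -polyCM mulfV // mulr1.
have K1 : eqv K B^T (std C m).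
  apply: (@eqv_std_unipotent _ (\col_i (N i0 i / N i0 j0)) (col j0 M)^T); rewrite ?det_tr //.
    exact: embT_tr.
  rewrite BM linearD /= trmx1; congr (_ + _); apply/matrixP => i k.
  rewrite [RHS]mxE big_ord1 !mxE polyCM mulrAC [_%:P * M _ _]mulrC -V.
  by rewrite -mulrA -polyCM mulfV // mulr1.
by have := eqv_tr cK K1; rewrite trmxK => /eqv_trans; apply=> //; apply: eqv_std_tr.
Qed.
End Degenerate.

(** The vector is e_i + x b. The combination can vanish only at a zero of a minor [w] of row [i] and
    b M, and [w] is a nonzero polynomial. At each of its zeros row [i] or b M is nonzero, so a
    generic [x] works. *)
Lemma generic_vector p (J : Type) (M : 'I_p -> J -> {poly C}) i j k l :
  M i k * M j l - M i l * M j k != 0 -> (forall s, exists r c, (M r c).[s] != 0) ->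
  exists v : 'I_p -> C, forall s, exists c, \sum_r v r * (M r c).[s] != 0.
Proof.
set d := _ - _ => d0 M0; have [s1 ds1] := cofin_ex (cofin_poly d0).
have [c0 Mic0] : exists c0, M i c0 != 0.
  have [ik|] := eqVneq (M i k) 0; last by exists k.
  by exists l; apply: contra_neq d0 => il; rewrite /d ik il !mul0r subr0.
have [L LE] := roots_seq Mic0; have [cs /= cP] := choice M0.
have [cs' cP'] := choice cP.
(* [Some s] asks that b M be nonzero at a zero [s] of [M i c0], and [None] that the minor of row [i]
   and b M be nonzero at [s1]. *)
pose f (o : option C) r := if o is Some s then (M r (cs' s)).[s]
  else (M i k).[s1] * (M r l).[s1] - (M i l).[s1] * (M r k).[s1].
have [|b bP] := @generic_functional C _ _ (None :: map some L) f.
  move=> [s|] _; first by exists (cs s); apply: cP'.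
  by exists j; rewrite /f -!hornerM -hornerN -hornerD.
pose bM c := \sum_r (b r)%:P * M r c.
have bME c s : (bM c).[s] = \sum_r b r * (M r c).[s].
  by rewrite /bM horner_sum; under eq_bigr do rewrite hornerM hornerC.
pose w := M i k * bM l - M i l * bM k.
have w0 : w != 0.
  have := bP None (mem_head _ _); apply: contra_neq => w0.
  have := congr1 (fun p : {poly C} => p.[s1]) w0; rewrite horner0 => e; rewrite -[RHS]e.
  rewrite hornerD hornerN !hornerM !bME !mulr_sumr -sumrB; apply: eq_bigr => r _.
  by rewrite /f /=; ring.
have : forall s, root w s -> cofin (fun x => exists c, (M i c).[s] + x * (bM c).[s] != 0).
  move=> s _; have [rs|rs] := boolP (root (M i c0) s).
    have : Some s \in None :: map some L by rewrite inE /= mem_map -?LE // => ? ? [].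
    move=> /bP; rewrite -bME => bs; have : cofin (fun x => (M i (cs' s)).[s] + x * (bM (cs' s)).[s] != 0).
      by apply: cofin_lin => /eqP; rewrite (negPf bs).
    by apply: cofinW => x; exists (cs' s).
  have : cofin (fun x => (M i c0).[s] + x * (bM c0).[s] != 0) by apply: cofin_lin.
  by apply: cofinW => x; exists c0.
move=> /(cofin_roots w0)/cofin_ex[x xP]; exists (fun r => (r == i)%:R + x * b r) => s.
have vE c : \sum_r ((r == i)%:R + x * b r) * (M r c).[s] = (M i c).[s] + x * (bM c).[s].
  rewrite bME mulr_sumr (bigD1 i) //= eqxx [X in _ = _ + X](bigD1 i) //= addrA.
  congr (_ + _); first by ring.
  by apply: eq_bigr => r /negPf ->; rewrite add0r mulrA.
have [/xP[c cE]|ws] := boolP (root w s); first by exists c; rewrite vE.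
have [ek|] := eqVneq ((M i k).[s] + x * (bM k).[s]) 0; last by exists k; rewrite vE.
exists l; rewrite vE; apply: contraNneq ws => el; apply/eqP.
rewrite /w hornerD hornerN !hornerM.
rewrite (_ : _ - _ = ((M i k).[s] + x * (bM k).[s]) * (bM l).[s] -
  ((M i l).[s] + x * (bM l).[s]) * (bM k).[s]); last by ring.
by rewrite ek el !mul0r subr0.
Qed.
End DifferenceMatrix.

(** * The case n >= 3 *)

Section Nondegenerate.
Variable C : numClosedFieldType.

Lemma dq_minor n (A : 'M[{poly C}]_n) : ~ (forall t s, rank1 (evmx A s - evmx A t)) ->
  exists t i i' j j', dqp (A i j) t * dqp (A i' j') t - dqp (A i j') t * dqp (A i' j) t != 0.
Proof.
move=> /existsNP[t /existsNP[s /existsNP[i /existsNP[i' /existsNP[j /existsNP[j' /eqP x]]]]]].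
exists t, i, i', j, j'; apply: contra_neq x => /(congr1 (fun p : {poly C} => (s - t) ^+ 2 * p.[s])).
rewrite horner0 mulr0 hornerD hornerN !hornerM => e.
have E k l : (evmx A s - evmx A t) k l = (s - t) * (dqp (A k l) t).[s].
  by rewrite dqE !mxE.
by apply/eqP; rewrite -subr_eq0 !E -[X in _ == X]e; apply/eqP; ring.
Qed.

(** At [t0] the difference quotients have a nonzero 2 x 2 minor, so [generic_vector] gives a
    combination of the rows for which [t0] has no partner. This is what [finite_double] asks for. *)
Lemma finite_double_row m (A : 'M[{poly C}]_m.+2) : \det A = 1 -> embT A ->
  ~ (forall t s, rank1 (evmx A s - evmx A t)) ->
  exists (s : 'M[C]_m.+2) (D : {poly C}), [/\ \det s = 1, D != 0 &
    forall t u, row 0 (dqmx (map_mx polyC s *m A) t u) = 0 -> root D t /\ root D u].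
Proof.
move=> A1 eA /dq_minor[t0 [i [i' [j [j' d0]]]]].
have [|v vP] := generic_vector (M := fun r c => dqp (A r c) t0) d0.
  by move=> s; have /matrix0Pn[r [c]] := eA t0 s; rewrite mxE => d; exists r, c.
have v0 : (\row_r v r) != 0 :> 'rV[C]_m.+2.
  have [c] := vP 0; apply: contraNneq => /rowP v0.
  by rewrite big1 // => r _; have := v0 r; rewrite !mxE => ->; rewrite mul0r.
have [s [s1 sE]] := SL_complete_row v0.
have rowE t u c : dqmx (map_mx polyC s *m A) t u 0 c = \sum_r v r * dq (A r c) t u.
  rewrite dqmxMl mxE; apply: eq_bigr => r _; rewrite mxE.
  by have /rowP/(_ r) := sE; rewrite !mxE => ->.
have [|D D0 DP] := @finite_double C _ (fun c => (map_mx polyC s *m A) 0 c) t0.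
  by move=> u; have [c cE] := vP u; exists c; have := rowE t0 u c; rewrite mxE => ->.
exists s, D; split=> // t u /rowP h; apply: DP => c.
by have := h c; rewrite !mxE.
Qed.

Section Ge3.
Variable m : nat.
Let n := m.+3.
Variable K : ('M[C]_n -> C) -> Prop.
Hypothesis cK : mxclass K.
Implicit Types A : 'M[{poly C}]_n.

Lemma sum_delta (R : pzRingType) k (a : 'I_k) (f : 'I_k -> R) : \sum_i (i == a)%:R * f i = f a.
Proof.
rewrite (bigD1 a) //= eqxx mul1r big1 ?addr0 // => i /negPf ->.
by rewrite mul0r.
Qed.

(** Meant for the cofactors [c] along a row: the first equation says which rows may replace it, the
    second creates an affine function. Both are solvable if c(s) and [d] are linearly independent
    for every s, as is the case for generic [d]; n >= 3 provides two indices besides [p]. *)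
Lemma free_row (c : 'I_n -> {poly C}) : (forall s, exists k, (c k).[s] != 0) ->
  exists (rho : 'I_n -> {poly C}) (d : 'I_n -> C),
    \sum_k rho k * c k = 1 /\ \sum_k rho k * (d k)%:P = 'X.
Proof.
move=> c0; have [p p0] := c0 0.
have {}p0 : c p != 0 by apply: contraNneq p0 => ->; rewrite horner0.
(* The coefficient of [d r] in the minor d_a c_b - d_b c_a. *)
pose M (r : 'I_n) (ab : 'I_n * 'I_n) := (r == ab.1)%:R * c ab.2 - (r == ab.2)%:R * c ab.1.
have np (x : 'I_n.-1) : (lift p x == p) = false by rewrite eq_sym (negPf (neq_lift _ _)).
have [||d dP] := @generic_vector C _ _ M (lift p 0) (lift p 1) (lift p 0, p) (lift p 1, p).
- have h : (lift p 0 == lift p 1) = false by rewrite (inj_eq (@lift_inj _ p)).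
  rewrite /M /= !eqxx !np [lift p 1 == _]eq_sym h !mul0r !mul1r !subr0 ?mul0r ?subr0.
  by rewrite mulf_neq0.
- move=> s; have [q q0] := c0 s; exists (lift q 0), (lift q 0, q).
  by rewrite /M /= eqxx [lift q 0 == q]eq_sym (negPf (neq_lift _ _)) mul0r subr0 mul1r.
have dE a b s : \sum_r d r * (M r (a, b)).[s] = d a * (c b).[s] - d b * (c a).[s].
  rewrite -[d a * _](sum_delta a (fun r => d r * (c b).[s])).
  rewrite -[d b * _](sum_delta b (fun r => d r * (c a).[s])) -sumrB; apply: eq_bigr => r _.
  have bE (x : bool) : (x%:R : {poly C}).[s] = x%:R by case: x; rewrite ?horner0 ?hornerC.
  by rewrite /M /= hornerD hornerN !hornerM !bE; ring.
have [r1 [r1c r1d]] : exists rho : 'I_n -> {poly C}, \sum_k rho k * c k = 1 /\ \sum_k rho k * (d k)%:P = 0.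
  apply: (@weak_nullstellensatz _ (fun g => exists rho : 'I_n -> {poly C},
     \sum_k rho k * c k = g /\ \sum_k rho k * (d k)%:P = 0)).
    split=> [g g' [r [rc rd]] [r' [rc' rd']]|a g [r [rc rd]]].
      exists (fun k => r k + r' k); split; under eq_bigr do rewrite mulrDl.
        by rewrite big_split /= rc rc'.
      by rewrite big_split /= rd rd' addr0.
    by exists (fun k => a * r k); split; under eq_bigr do rewrite -mulrA; rewrite -mulr_sumr ?rc ?rd ?mulr0.
  move=> s; have [[a b]] := dP s; rewrite dE => ab0.
  exists ((d a)%:P * c b - (d b)%:P * c a); last by rewrite hornerD hornerN !hornerM !hornerC.
  exists (fun k => (k == b)%:R * (d a)%:P - (k == a)%:R * (d b)%:P).
  split; under eq_bigr do rewrite mulrBl -!mulrA; rewrite sumrB !sum_delta //; ring.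
have [r2 [r2c r2d]] : exists rho : 'I_n -> {poly C}, \sum_k rho k * c k = 0 /\ \sum_k rho k * (d k)%:P = 1.
  apply: (@weak_nullstellensatz _ (fun g => exists rho : 'I_n -> {poly C},
     \sum_k rho k * c k = 0 /\ \sum_k rho k * (d k)%:P = g)).
    split=> [g g' [r [rc rd]] [r' [rc' rd']]|a g [r [rc rd]]].
      exists (fun k => r k + r' k); split; under eq_bigr do rewrite mulrDl.
        by rewrite big_split /= rc rc' addr0.
      by rewrite big_split /= rd rd'.
    by exists (fun k => a * r k); split; under eq_bigr do rewrite -mulrA; rewrite -mulr_sumr ?rc ?rd ?mulr0.
  move=> s; have [[a b]] := dP s; rewrite dE => ab0.
  exists ((d a)%:P * c b - (d b)%:P * c a); last by rewrite hornerD hornerN !hornerM !hornerC.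
  exists (fun k => (k == a)%:R * c b - (k == b)%:R * c a).
  split; under eq_bigr do rewrite mulrBl -!mulrA; rewrite sumrB !sum_delta //; ring.
exists (fun k => r1 k + 'X * r2 k), d.
split; under eq_bigr do rewrite mulrDl -mulrA; rewrite big_split /= -mulr_sumr.
  by rewrite r1c r2c mulr0 addr0.
by rewrite r1d r2d mulr1 add0r.
Qed.

(** A row [rho] whose product with the cofactors along row [i] is 1 differs from row [i] by a
    combination of the other rows, with coefficients [q]. The other rows embed the line, so these
    shears extend. *)
Lemma eqv_std_free_row A i : \det A = 1 -> emb (fun k _ => k != i) A -> eqv K A (std C m.+1).
Proof.
move=> A1 eA; pose c k := \adj A k i.
have Ac j : \sum_k A j k * c k = (j == i)%:R.
  by have /matrixP/(_ j i) := mul_mx_adj A; rewrite A1 !mxE.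
have [|rho [d [rc rd]]] := @free_row c.
  move=> s; apply: contrapT => /forallNP H.
  have := congr1 (fun p : {poly C} => p.[s]) (Ac i); rewrite eqxx horner_sum big1 => [/eqP|k _].
    by rewrite hornerC eq_sym oner_eq0.
  by rewrite hornerM; have /negP/negPn/eqP -> := H k; rewrite mulr0.
pose q := (\row_k rho k) *m \adj A.
have qi : q 0 i = 1 by rewrite mxE -rc; apply: eq_bigr => k _; rewrite mxE.
have qA : q *m A = \row_k rho k by rewrite -mulmxA mul_adj_mx A1 mulmx1.
clearbody q.
pose Q Y := eqv K A Y /\ forall k, k != i -> row k Y = row k A.
pose B := (1%:M + \sum_j q 0 (lift i j) *: delta_mx i (lift i j)) *m A.
have [eB _] : Q B.
  apply: (@tv_sum_ind _ _ _ Q _ (fun=> i) (lift i) _ A) => [a b|a x Y [eY rY]|].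
  - by rewrite eq_sym neq_lift.
  - split=> [|k ki]; last first.
      by rewrite -(rY k ki); apply/rowP => l; rewrite [LHS]mxE [RHS]mxE tv_mulE (negPf ki) addr0.
    apply: (eqv_trans cK eY); apply: row_move => //; first exact: neq_lift.
    apply: emb_row eA => k l ki; have /rowP/(_ l) := rY k ki.
    by rewrite !mxE.
  - by split=> //; apply: eqv_refl.
apply: (eqv_trans cK eB).
apply: (@eqv_std_affine _ _ _ cK _ (delta_mx 0 i) (\col_k d k) 1 0).
- exact: eqv_det eB.
- exact: oner_neq0.
rewrite map_delta_mx -rowE.
have -> : row i B = \row_k rho k.
  apply/rowP => l; rewrite -qA [LHS]mxE /B mulmxDl mul1mx mxE [RHS]mxE (bigD1_ord i) //= qi mul1r.
  congr (_ + _); rewrite mulmx_suml summxE; apply: eq_bigr => j _.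
  rewrite -scalemxAl mxE mxE (bigD1 (lift i j)) //= mxE !eqxx mul1r big1 ?addr0 // => k /negPf kj.
  by rewrite mxE kj andbF mul0r.
rewrite mxE; under eq_bigr do rewrite !mxE; rewrite rd polyC1 polyC0 mul1r addr0 //.
Qed.

(** Row 0 leaves finitely many pairs unseparated; a combination [w] of the other rows that separates
    these becomes row 1. *)
Lemma eqv_std_ge3 A : \det A = 1 -> embT A -> eqv K A (std C m.+1).
Proof.
move=> A1 eA; have [rA|rA] := pselect (forall t s, rank1 (evmx A s - evmx A t)).
  exact: eqv_std_degenerate.
have [s [D [s1 D0 DP]]] := finite_double_row A1 eA rA.
apply: (eqv_trans cK (eqv_mull cK A s1)).
have B1 : \det (map_mx polyC s *m A) = 1 by rewrite det_mulmx det_map_mx s1 A1 rmorph1 mul1r.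
have := embT_mull s1 eA; move: (_ *m A) B1 DP => B B1 DP eB {A A1 eA rA s s1}.
have [L LE] := roots_seq D0.
pose bad t s := row 0 (dqmx B t s) == 0.
have /choice[cl clP] : forall ts : C * C, exists c, bad ts.1 ts.2 ->
    exists i : 'I_m.+2, dq (B (lift 0 i) c) ts.1 ts.2 != 0.
  move=> [t s] /=; have [/eqP/rowP bts|_] := boolP (bad t s); last by exists 0.
  have /matrix0Pn[i [c d]] := eB t s; exists c => _.
  case: (unliftP 0 i) d => [k ->|->]; first by rewrite mxE; exists k.
  by have := bts c; rewrite mxE => ->; rewrite mxE eqxx.
(* [None] makes [w] nonzero even if there is no bad pair. *)
pose f (o : option (C * C)) (i : 'I_m.+2) :=
  if o is Some ts then dq (B (lift 0 i) (cl ts)) ts.1 ts.2 else 1.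
have [|w wP] := @generic_functional C _ _
    (None :: map some [seq ts <- allpairs pair L L | bad ts.1 ts.2]) f.
  move=> [ts|]; last by exists 0; rewrite /f oner_neq0.
  by rewrite inE /= mem_map => [|? ? []//]; rewrite mem_filter => /andP[/clP].
have w0 : \row_i w i != 0 :> 'rV[C]_m.+2.
  have := wP None (mem_head _ _); apply: contra_neq => /rowP w0.
  by rewrite big1 // => i _; have := w0 i; rewrite !mxE => ->; rewrite mul0r.
have [g [g1 gE]] := SL_complete_row w0.
pose h : 'M[C]_(1 + m.+2) := block_mx 1%:M 0 0 g.
have h1 : \det h = 1 by rewrite det_ublock det1 mul1r.
apply: (eqv_trans cK (eqv_mull cK B h1)).
pose X := map_mx polyC (h : 'M[_]_n) *m B; rewrite -/X.
have l0 : @lshift 1 m.+2 0 = ord0 :> 'I_n by apply: val_inj.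
have rl (i : 'I_m.+2) : @rshift 1 m.+2 i = lift ord0 i by apply: val_inj.
have h00 : (h : 'M[_]_n) ord0 ord0 = 1.
  have : h (@lshift 1 m.+2 0) (@lshift 1 m.+2 0) = 1 by rewrite /h block_mxEul mxE.
  by rewrite l0.
have h0r i : (h : 'M[_]_n) ord0 (lift ord0 i) = 0.
  have : h (@lshift 1 m.+2 0) (@rshift 1 m.+2 i) = 0 by rewrite /h block_mxEur mxE.
  by rewrite l0 rl.
have hr0 i : (h : 'M[_]_n) (lift ord0 i) ord0 = 0.
  have : h (@rshift 1 m.+2 i) (@lshift 1 m.+2 0) = 0 by rewrite /h block_mxEdl mxE.
  by rewrite l0 rl.
have hrr i j : (h : 'M[_]_n) (lift ord0 i) (lift ord0 j) = g i j.
  have : h (@rshift 1 m.+2 i) (@rshift 1 m.+2 j) = g i j by rewrite /h block_mxEdr.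
  by rewrite !rl.
have X0 c : X 0 c = B 0 c.
  rewrite mxE big_ord_recl big1 => [|i _]; rewrite mxE ?h00 ?h0r ?mul0r //.
  by rewrite addr0 mul1r.
have X1 c : X (lift 0 0) c = \sum_i (w i)%:P * B (lift 0 i) c.
  rewrite mxE big_ord_recl mxE hr0 mul0r add0r; apply: eq_bigr => i _.
  rewrite mxE hrr; congr (_%:P * _).
  by have /rowP/(_ i) := gE; rewrite !mxE.
apply: (@eqv_std_free_row _ (lift 0 (lift 0 0))).
  by rewrite det_mulmx B1 det_map_mx h1 rmorph1 mulr1.
move=> t s; have [bts|] := boolP (bad t s); last first.
  by move=> /rV0Pn[c]; rewrite !mxE => d; exists 0, c; rewrite X0.
exists (lift 0 0), (cl (t, s)); split=> //; rewrite X1 dq_sum.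
under eq_bigr do rewrite dqCM; apply: (wP (Some (t, s))).
have [rt rs] := DP t s (eqP bts).
rewrite inE /= mem_map => [|? ? []//]; rewrite mem_filter bts /=.
by apply/allpairsP; exists (t, s); rewrite -!LE.
Qed.

End Ge3.
End Nondegenerate.

(** * Interpolation by nowhere vanishing entire functions *)

Local Open Scope complex_scope.

Section ComplexExponential.
Variable R : realType.
Let C := R[i].
Notation Re := complex.Re.
Notation Im := complex.Im.

(** From [K] on, the terms are bounded by |x|^K / k!, and these bounds sum to at most |x|^K e. *)
Lemma series_tail (u : nat -> R) (l x : R) K : series u @ \oo --> l ->
  (forall n, `|u n| <= `|x| ^+ n / n`!%:R) -> `|x| <= 1 ->
  `|l - \sum_(k < K) u k| <= `|x| ^+ K * expR 1.
Proof.
move=> ul ub x1.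
have cv : (fun n => `|series u n - \sum_(k < K) u k|) @ \oo --> `|l - \sum_(k < K) u k|.
  by apply: cvg_norm; apply: cvgB => //; exact: cvg_cst.
rewrite -(cvg_lim _ cv) //; apply: limr_le; first by apply/cvg_ex; eexists; exact: cv.
exists K => // n /= Kn; rewrite /series /= (big_cat_nat (leq0n K) Kn) //= big_mkord addrAC subrr add0r.
apply: le_trans (ler_norm_sum _ _ _) _.
apply: (@le_trans _ _ (\sum_(K <= k < n) `|x| ^+ K * (k`!%:R)^-1)).
  rewrite big_nat [leRHS]big_nat; apply: ler_sum => k /andP[Kk _].
  apply: le_trans (ub k) _; rewrite ler_wpM2r ?invr_ge0 ?ler0n //.
  exact: ler_wiXn2l.
rewrite -mulr_sumr ler_wpM2l ?exprn_ge0 //.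
apply: (@le_trans _ _ (series (exp_coeff 1) n)).
  rewrite /series /= (big_cat_nat (leq0n K) Kn) //= -[leLHS]add0r lerD //.
    by apply: sumr_ge0 => k _; rewrite exp_coeff_ge0.
  by apply: ler_sum => k _; rewrite /exp_coeff /= expr1n mul1r.
apply: nondecreasing_cvgn_le; last exact: is_cvg_series_exp_coeff.
apply/nondecreasing_seqP => k; rewrite /series /= big_nat_recr //= lerDl.
exact: exp_coeff_ge0.
Qed.

Definition expC (z : C) : C := (expR (Re z))%:C * (cos (Im z) +i* sin (Im z)).

Lemma expCD z w : expC (z + w) = expC z * expC w.
Proof.
case: z w => [a b] [c d]; rewrite /expC /= expRD cosD sinD.
apply/eqP; rewrite eq_complex /=; apply/andP; split; apply/eqP; ring.
Qed.

Lemma expC0 : expC 0 = 1.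
Proof. by rewrite /expC /= expR0 cos0 sin0 mul1r. Qed.

Lemma expC_surj w : w != 0 -> exists z, expC z = w.
Proof.
case: w => a b w0; pose r := Num.sqrt (a ^+ 2 + b ^+ 2).
have r2 : 0 < a ^+ 2 + b ^+ 2.
  rewrite lt0r addr_ge0 ?sqr_ge0 // andbT paddr_eq0 ?sqr_ge0 // !sqrf_eq0.
  by move: w0; rewrite eq_complex.
have r0 : 0 < r by rewrite sqrtr_gt0.
have rE : r ^+ 2 = a ^+ 2 + b ^+ 2 by rewrite sqr_sqrtr // ltW.
have ar : -1 <= a / r <= 1.
  rewrite -ler_norml normrM normfV (gtr0_norm r0) ler_pdivrMr // mul1r.
  by rewrite -[leRHS]gtr0_norm // -ler_sqr ?nnegrE // !real_normK ?num_real // rE lerDl sqr_ge0.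
have sa : sin (acos (a / r)) = `|b| / r.
  rewrite sin_acos // (_ : 1 - _ = (b / r) ^+ 2).
    by rewrite sqrtr_sqr normrM normfV (gtr0_norm r0).
  rewrite !expr_div_n rE; field; exact: lt0r_neq0.
have rr : r * (a / r) = a by rewrite mulrC divfK // lt0r_neq0.
have rb : r * (`|b| / r) = `|b| by rewrite mulrC divfK // lt0r_neq0.
have [b0|b0] := leP 0 b.
  exists (ln r +i* acos (a / r)); rewrite /expC /= lnK // acosK // sa.
  by apply/eqP; rewrite eq_complex /= !mul0r subr0 addr0 rr rb ger0_norm ?eqxx.
exists (ln r +i* - acos (a / r)); rewrite /expC /= lnK // cosN sinN acosK // sa.
by apply/eqP; rewrite eq_complex /= !mul0r subr0 addr0 rr mulrN rb ltr0_norm // opprK !eqxx.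
Qed.

Definition expP K : {poly C} := \sum_(k < K) (k`!%:R)^-1 *: 'X^k.

Lemma expPE K h : (expP K).[h] = \sum_(k < K) h ^+ k / k`!%:R.
Proof.
by rewrite horner_sum; apply: eq_bigr => k _; rewrite hornerZ hornerXn mulrC.
Qed.

Lemma normC_ReIm (z : C) : `|z| <= (`|Re z| + `|Im z|)%:C.
Proof.
rewrite [z in leLHS]complexE; apply: le_trans (ler_normD _ _) _.
rewrite normrM [`|'i|]normc_def /= expr0n add0r expr1n sqrtr1 mul1r.
by rewrite !normc_def /= expr0n /= !addr0 !sqrtr_sqr rmorphD.
Qed.

Lemma normC_real (x : R) : `|x%:C| = `|x|%:C :> C.
Proof. by rewrite normc_def /= expr0n addr0 sqrtr_sqr. Qed.

Lemma normC_ge_Im (z : C) : `|Im z|%:C <= `|z|.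
Proof.
by case: z => a b /=; rewrite normc_def /= lecR -sqrtr_sqr ler_sqrt ?addr_ge0 ?sqr_ge0 // lerDr sqr_ge0.
Qed.

Lemma exp_coeff_i (y : R) k : ('i * y%:C) ^+ k / k`!%:R = cos_coeff y k +i* sin_coeff y k :> C.
Proof.
have kC : (k`!%:R)^-1 = ((k`!%:R)^-1 : R)%:C :> C by rewrite fmorphV rmorph_nat.
rewrite exprMn kC -rmorphXn -mulrA -rmorphM /= -{1}[k]odd_double_half exprD -mul2n exprM sqr_i.
rewrite (_ : (-1) ^+ k./2 = ((-1) ^+ k./2 : R)%:C :> C); last by rewrite rmorphXn rmorphN rmorph1.
rewrite /cos_coeff /sin_coeff /= -exprnP.
have [ko|ko] := boolP (odd k).
  rewrite expr1 (_ : k.-1./2 = k./2); last by rewrite -{1}[k]odd_double_half ko /= doubleK.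
  by apply/eqP; rewrite eq_complex /=; apply/andP; split; apply/eqP; ring.
by rewrite expr0 mul1r; apply/eqP; rewrite eq_complex /=; apply/andP; split; apply/eqP; ring.
Qed.

End ComplexExponential.

Section ExpTaylor.
Variable R : realType.
Let C := R[i].
Notation Re := complex.Re.
Notation Im := complex.Im.

(** With h = x + i y, the truncated series of exp x and exp(i y) are [A.[1]] and [B.[1]], where [A]
    and [B] have their terms as coefficients. The three summands of the constant bound (e - A) c, A
    (c - B) and A B - [expP]. *)
Lemma expC_taylor K : exists2 M : C, 0 <= M &
  forall h, `|h| <= 1 -> `|expC h - (expP R K).[h]| <= M * `|h| ^+ K.
Proof.
pose E : C := (expR 1)%:C; have E0 : 0 <= E by rewrite ler0c expR_ge0.
exists (2 * E + K%:R * (2 * E) + K%:R * (K + K)%:R) => [|h h1].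
  by rewrite !addr_ge0 // !mulr_ge0 ?ler0n // mulr_ge0 ?ler0n.
set x := Re h; set y := Im h.
have xh : `|x|%:C <= `|h| by exact: normc_ge_Re.
have yh : `|y|%:C <= `|h| by exact: normC_ge_Im.
have x1 : `|x| <= 1 by have := le_trans xh h1; rewrite -[1]/(1%:C) lecR.
have y1 : `|y| <= 1 by have := le_trans yh h1; rewrite -[1]/(1%:C) lecR.
have hE : h = x%:C + 'i * y%:C by exact: complexE.
have powC (u : R) k : (`|u| ^+ k)%:C = `|u|%:C ^+ k :> C by rewrite rmorphXn.
have le_pow (u : R) : `|u|%:C <= `|h| -> forall k, (`|u| ^+ k)%:C <= `|h| ^+ k.
  by move=> uh k; rewrite powC lerXn2r ?nnegrE ?normr_ge0 // ler0c normr_ge0.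
have facV k : (k`!%:R)^-1 <= 1 :> C.
  by rewrite invf_le1 ?ltr0n ?fact_gt0 // ler1n fact_gt0.
pose A : {poly C} := \poly_(k < K) (x%:C ^+ k / k`!%:R).
pose B : {poly C} := \poly_(k < K) (('i * y%:C) ^+ k / k`!%:R).
have AE j : (j < K)%N -> A`_j = x%:C ^+ j / j`!%:R by rewrite coef_poly => ->.
have BE j : (j < K)%N -> B`_j = ('i * y%:C) ^+ j / j`!%:R by rewrite coef_poly => ->.
set e := (expR x)%:C; set c := cos y +i* sin y.
have expE : expC h = e * c by [].
have A1 : A.[1] = (\sum_(k < K) exp_coeff x k)%:C.
  rewrite horner_poly rmorph_sum /=; apply: eq_bigr => k _.
  by rewrite expr1n mulr1 /exp_coeff /= rmorphM fmorphV rmorph_nat rmorphXn.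
have B1 : B.[1] = (\sum_(k < K) cos_coeff y k) +i* (\sum_(k < K) sin_coeff y k).
  rewrite horner_poly (eq_bigr (fun k : 'I_K => cos_coeff y k +i* sin_coeff y k)).
    by elim/big_rec3: _ => // k u v w _ ->.
  by move=> k _; rewrite expr1n mulr1 exp_coeff_i.
have eA : `|e - A.[1]| <= E * `|h| ^+ K.
  rewrite A1 /e -rmorphB normC_real mulrC; apply: le_trans (_ : (`|x| ^+ K * expR 1)%:C <= _).
    rewrite lecR; apply: series_tail => // [|n]; first exact: is_cvg_series_exp_coeff.
    by rewrite /exp_coeff /= normrM normfV normrX normr_nat.
  by rewrite rmorphM ler_wpM2r // le_pow.
have cB : `|c - B.[1]| <= 2 * E * `|h| ^+ K.
  have coefb (b : bool) n (u : R) : `|b%:R * (-1) ^+ n * u| <= `|u|.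
    rewrite !normrM normrX normrN1 expr1n mulr1 ler_piMl //.
    by case: b; rewrite ?normr1 ?normr0.
  apply: le_trans (normC_ReIm _) _; rewrite B1 /= rmorphD -mulrA mulr_natl mulr2n.
  rewrite [E * _]mulrC; apply: lerD.
    apply: le_trans (_ : (`|y| ^+ K * expR 1)%:C <= _).
      rewrite lecR; apply: series_tail => // [|n]; first by rewrite unlock; exact: is_cvg_series_cos_coeff.
      rewrite /cos_coeff /= -exprnP -mulrA; apply: le_trans (coefb _ _ _) _.
      by rewrite normrM normfV normrX normr_nat.
    by rewrite rmorphM ler_wpM2r // le_pow.
  apply: le_trans (_ : (`|y| ^+ K * expR 1)%:C <= _).
    rewrite lecR; apply: series_tail => // [|n]; first by rewrite unlock; exact: is_cvg_series_sin_coeff.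
    rewrite /sin_coeff /= -mulrA; apply: le_trans (coefb _ _ _) _.
    by rewrite normrM normfV normrX normr_nat.
  by rewrite rmorphM ler_wpM2r // le_pow.
have nA k : `|A`_k| <= `|h| ^+ k.
  rewrite coef_poly; case: ifP => _; last by rewrite normr0 exprn_ge0.
  rewrite normrM normrX normfV normr_nat normC_real; apply: le_trans (le_pow x xh k).
  by rewrite powC ler_piMr // exprn_ge0 // ler0c.
have nB k : `|B`_k| <= `|h| ^+ k.
  rewrite coef_poly; case: ifP => _; last by rewrite normr0 exprn_ge0.
  rewrite normrM normrX normfV normr_nat normrM normC_real.
  rewrite (_ : `|'i| = 1 :> C); last by rewrite normc_def /= expr0n add0r expr1n sqrtr1.
  rewrite mul1r; apply: le_trans (le_pow y yh k).
  by rewrite powC ler_piMr // exprn_ge0 // ler0c.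
have c2 : `|c| <= 2.
  apply: le_trans (normC_ReIm _) _; rewrite /= (_ : 2 = (1 + 1)%:C); last by rewrite rmorphD.
  by rewrite lecR lerD // ler_norml ?cos_geN1 ?cos_le1 ?sin_geN1 ?sin_le1.
have nA1 : `|A.[1]| <= K%:R.
  rewrite horner_poly; apply: le_trans (ler_norm_sum _ _ _) _.
  have -> : K%:R = \sum_(k < K) 1 :> C by rewrite sumr_const card_ord.
  apply: ler_sum => k _.
  rewrite expr1n mulr1; have := nA k; rewrite coef_poly ltn_ord => /le_trans; apply.
  by rewrite exprn_ile1.
have sA : (size A <= K)%N by exact: size_poly.
have sB : (size B <= K)%N by exact: size_poly.
clearbody A B.
(* The first [K] coefficients of A B sum to [expP] at [h] by the binomial theorem; each of the [K]
   others is a sum of at most 2K products bounded by |h|^K. *)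
have AB : `|A.[1] * B.[1] - (expP R K).[h]| <= K%:R * (K + K)%:R * `|h| ^+ K.
  rewrite -hornerM (@horner_coef_wide _ (K + K)); last first.
    apply: leq_trans (size_polyMleq _ _) _; apply: leq_trans (leq_pred _) _.
    by rewrite leq_add.
  under eq_bigr do rewrite expr1n mulr1.
  rewrite big_split_ord /= expPE addrAC -sumrB big1 ?add0r => [|k _]; last first.
    apply/eqP; rewrite subr_eq0 hE [_ + _ in X in _ == X]addrC exprDn coefM mulr_suml.
    apply/eqP; apply: eq_bigr => j _.
    have jk : (j <= k)%N by rewrite -ltnS.
    have jK : (j < K)%N by apply: leq_ltn_trans jk (ltn_ord k).
    have kK : (k - j < K)%N by apply: leq_ltn_trans (leq_subr _ _) (ltn_ord k).
    rewrite (AE j jK) (BE (k - j)%N kK).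
    have := bin_fact jk => /(congr1 (fun n => n%:R : C)); rewrite !natrM => <-.
    have f0 n : n`!%:R != 0 :> C by rewrite pnatr_eq0 -lt0n fact_gt0.
    have b0 : 'C(k, j)%:R != 0 :> C by rewrite pnatr_eq0 -lt0n bin_gt0.
    rewrite -mulr_natr; field; rewrite !f0 b0 //.
  apply: le_trans (ler_norm_sum _ _ _) _.
  have -> : K%:R * (K + K)%:R * `|h| ^+ K = \sum_(k < K) (K + K)%:R * `|h| ^+ K :> C.
    by rewrite sumr_const card_ord -mulrA mulr_natl.
  apply: ler_sum => k _.
  rewrite coefM; apply: le_trans (ler_norm_sum _ _ _) _.
  apply: (@le_trans _ _ (\sum_(j < (K + k).+1) `|h| ^+ K)).
    apply: ler_sum => j _; rewrite normrM.
    apply: le_trans (ler_pM (normr_ge0 _) (normr_ge0 _) (nA j) (nB _)) _.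
    rewrite -exprD subnKC; last by rewrite -ltnS.
    by rewrite exprD ler_piMr ?exprn_ge0 // exprn_ile1.
  rewrite sumr_const card_ord -[leLHS]mulr_natl ler_wpM2r ?exprn_ge0 // ler_nat.
  by rewrite -addnS leq_add2l.
have -> : expC h - (expP R K).[h] = (e - A.[1]) * c + A.[1] * (c - B.[1]) +
    (A.[1] * B.[1] - (expP R K).[h]).
  by rewrite expE mulrBl mulrBr addrA addrA addrNK subrK.
apply: le_trans (ler_normD _ _) _; rewrite [leRHS]mulrDl lerD //.
apply: le_trans (ler_normD _ _) _; rewrite [leRHS]mulrDl lerD // normrM.
  apply: le_trans (ler_pM (normr_ge0 _) (normr_ge0 _) eA c2) _.
  by rewrite [leLHS]mulrC [leLHS]mulrA.
by rewrite -[leRHS]mulrA ler_pM.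
Qed.
End ExpTaylor.

(** * Functions with Taylor expansions of every order *)

Section TaylorExpandable.
Variable C : numFieldType.
Implicit Types (F G : C -> C) (a h : C) (p Q : {poly C}).

(* [F] has Taylor polynomials of every order at [a]; this is a form of holomorphy
   that is visibly stable under division. *)
Definition tay_at F a := forall K, exists Q (M d : C),
  [/\ 0 <= M, 0 < d & forall h, `|h| < d -> `|F (a + h) - Q.[h]| <= M * `|h| ^+ K].

Definition tay F := forall a, tay_at F a.

Lemma poly_bounded p : exists2 B : C, 0 <= B & forall h, `|h| <= 1 -> `|p.[h]| <= B.
Proof.
exists (\sum_(i < size p) `|p`_i|) => [|h h1]; first by rewrite sumr_ge0.
rewrite horner_coef; apply: le_trans (ler_norm_sum _ _ _) _; apply: ler_sum => i _.
by rewrite normrM normrX ler_piMr // exprn_ile1.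
Qed.

(** The order of [C] is not total, so a formula, d e / (d + e), provides a bound below both
    radii. *)
Lemma norm_lt_min (d e : C) : 0 < d -> 0 < e ->
  exists2 c : C, 0 < c & forall x : C, `|x| < c -> `|x| < d /\ `|x| < e.
Proof.
move=> d0 e0; have de : 0 < d + e by rewrite addr_gt0.
exists (d * (e / (d + e))) => [|x]; first by rewrite mulr_gt0 // divr_gt0.
rewrite mulrA ltr_pdivlMr // => hde; split; rewrite -(ltr_pM2r de); apply: lt_le_trans hde _.
  by rewrite ler_wpM2l ?(ltW d0) // lerDr ltW.
by rewrite mulrC ler_wpM2l ?(ltW e0) // lerDl ltW.
Qed.

Lemma tay_at_near F G a : tay_at F a ->
  (exists2 d : C, 0 < d & forall h, `|h| < d -> F (a + h) = G (a + h)) -> tay_at G a.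
Proof.
move=> tF [e e0 FG] K; have [Q [M [d [M0 d0 H]]]] := tF K.
have [c c0 cP] := norm_lt_min d0 e0.
by exists Q, M, c; split=> // h /cP[hd he]; rewrite -FG //; apply: H.
Qed.

Lemma tay_poly p : tay (fun x => p.[x]).
Proof.
move=> a K; exists (p \Po ('X + a%:P)), 0, 1; split=> // h _.
by rewrite horner_comp hornerD hornerX hornerC [h + a]addrC subrr normr0 mul0r.
Qed.

Lemma tay_atD F G a : tay_at F a -> tay_at G a -> tay_at (fun x => F x + G x) a.
Proof.
move=> tF tG K; have [P [M [d [M0 d0 H]]]] := tF K; have [Q [N [e [N0 e0 H']]]] := tG K.
have [c c0 cP] := norm_lt_min d0 e0.
exists (P + Q), (M + N), c; split=> // [|h /cP[hd he]]; first exact: addr_ge0.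
rewrite hornerD opprD addrACA mulrDl; apply: le_trans (ler_normD _ _) _.
by rewrite lerD ?H ?H'.
Qed.

Lemma tay_atM F G a : tay_at F a -> tay_at G a -> tay_at (fun x => F x * G x) a.
Proof.
move=> tF tG K; have [P [M [d [M0 d0 H]]]] := tF K; have [Q [N [e [N0 e0 H']]]] := tG K.
have [c c0 cP] := norm_lt_min d0 e0; have [c' c'0 c'P] := norm_lt_min c0 (ltr01 : 0 < 1 :> C).
have [B B0 BP] := poly_bounded P; have [B' B'0 B'P] := poly_bounded Q.
exists (P * Q), (M * (B' + N) + B * N), c'; split=> // [|h /c'P[/cP[hd he] h1]].
  by rewrite addr_ge0 // mulr_ge0 // addr_ge0.
have {}h1 := ltW h1; have hK : `|h| ^+ K <= 1 by rewrite exprn_ile1.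
have -> : F (a + h) * G (a + h) - (P * Q).[h] = (F (a + h) - P.[h]) * G (a + h) +
  P.[h] * (G (a + h) - Q.[h]) by rewrite hornerM; ring.
rewrite [leRHS]mulrDl; apply: le_trans (ler_normD _ _) _; apply: lerD; rewrite normrM.
  rewrite -[leRHS]mulrA [(B' + N) * _]mulrC [leRHS]mulrA; apply: ler_pM => //; first exact: H.
  rewrite -(subrK Q.[h] (G (a + h))) addrC; apply: le_trans (ler_normD _ _) _.
  apply: lerD; first exact: B'P.
  apply: le_trans (H' _ he) _; exact: ler_piMr.
by rewrite -[leRHS]mulrA; apply: ler_pM => //; [exact: BP|exact: H'].
Qed.

Lemma tayD F G : tay F -> tay G -> tay (fun x => F x + G x).
Proof. by move=> tF tG a; apply: tay_atD. Qed.

Lemma tayM F G : tay F -> tay G -> tay (fun x => F x * G x).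
Proof. by move=> tF tG a; apply: tay_atM. Qed.

Lemma tay_comp F p : tay F -> tay (fun x => F p.[x]).
Proof.
move=> tF a K; have [Q [M [d [M0 d0 H]]]] := tF p.[a] K.
pose k := (p \Po ('X + a%:P)) - p.[a]%:P.
have kE h : k.[h] = p.[a + h] - p.[a].
  by rewrite /k hornerD hornerN hornerC horner_comp hornerD hornerX hornerC addrC [h + a]addrC addrC.
have [r rE] : exists r, k = r * 'X.
  by apply/dvdpP; rewrite -['X]subr0 -[0]/(0%:P) dvdp_XsubCl /root kE addr0 subrr.
have [B B0 BP] := poly_bounded r.
have B1 : 0 < B + 1 by rewrite ltr_wpDl.
have [c c0 cP] := norm_lt_min (ltr01 : 0 < 1 :> C) (divr_gt0 d0 B1).
exists (Q \Po k), (M * B ^+ K), c; split=> // [|h /cP[h1 hB]].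
  by rewrite mulr_ge0 // exprn_ge0.
have kB : `|k.[h]| <= B * `|h| by rewrite rE hornerM hornerX normrM ler_wpM2r // BP // ltW.
have kd : `|k.[h]| < d.
  apply: le_lt_trans kB _; move: hB; rewrite ltr_pdivlMr //; apply: le_lt_trans.
  by rewrite mulrC ler_wpM2l // lerDl ler01.
have := H _ kd; rewrite {1}kE [p.[a] + _]addrC subrK horner_comp => /le_trans; apply.
rewrite -mulrA ler_wpM2l // -exprMn lerXn2r // ?nnegrE //.
by rewrite mulr_ge0.
Qed.

(** Geometric series of 1 / (b + h), with remainder (- h / b)^K / (b + h). *)
Lemma tay_at_inv a c : c != a -> tay_at (fun x => (x - c)^-1) a.
Proof.
move=> ca K; pose b := a - c; have b0 : b != 0 by rewrite subr_eq0 eq_sym.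
have nb : 0 < `|b| by rewrite normr_gt0.
pose Q : {poly C} := \sum_(k < K) (b^-1)%:P * (- b^-1 *: 'X) ^+ k.
exists Q, (2 * `|b| ^- K.+1), (`|b| / 2); split.
- by rewrite mulr_ge0 // invr_ge0 exprn_ge0.
- by rewrite divr_gt0.
move=> h hb; have hb' : `|h| <= `|b| / 2 by apply: ltW.
have half : `|b| / 2 <= `|b + h|.
  apply: le_trans (lerB_normD _ _).
  by rewrite lerBrDr [leRHS](splitr `|b|) lerD2l.
have bh : b + h != 0 by rewrite -normr_gt0; apply: lt_le_trans half; rewrite divr_gt0.
have QE : Q.[h] * (b + h) = 1 - (- h / b) ^+ K.
  rewrite -[1](expr1n _ K) subrXX horner_sum mulr_suml mulr_sumr; apply: eq_bigr => k _.
  rewrite hornerM hornerC horner_exp hornerZ hornerX expr1n mul1r mulrAC; congr (_ * _).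
    by rewrite mulrDr mulVf // mulNr opprK mulrC.
  by rewrite mulrC mulrN mulNr.
have e : a + h - c = b + h by rewrite /b addrAC.
have -> : (a + h - c)^-1 - Q.[h] = (- h / b) ^+ K / (b + h).
  by apply: (mulIf bh); rewrite e mulrBl mulVf // QE divfK // subKr.
have inv2 : `|b + h|^-1 <= 2 * `|b|^-1.
  rewrite -[2]invrK -invfM lef_pV2 ?posrE ?normr_gt0 // ?divr_gt0 // mulrC //.
  by rewrite mulr_gt0 // invr_gt0.
have -> : `|(- h / b) ^+ K / (b + h)| = (`|h| ^+ K * `|b| ^- K) * `|b + h|^-1.
  by rewrite normrM normrX normrM normrN !normfV exprMn exprVn.
have -> : 2 * `|b| ^- K.+1 * `|h| ^+ K = (`|h| ^+ K * `|b| ^- K) * (2 * `|b|^-1).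
  by rewrite exprS invfM; ring.
by rewrite ler_wpM2l // mulr_ge0 ?invr_ge0 ?exprn_ge0.
Qed.

(** Off [r] the quotient is a product of functions with expansions; at [r] an expansion of [F],
    divided by 'X, expands the quotient. *)
Lemma tay_division F r : tay F -> F r = 0 -> exists2 G, tay G & forall x, F x = (x - r) * G x.
Proof.
move=> tF Fr.
have step K : exists Q (M d : C), [/\ 0 <= M, 0 < d &
    forall h, `|h| < d -> `|F (r + h) - h * Q.[h]| <= M * `|h| ^+ K.+1].
  have [Q [M [d [M0 d0 H]]]] := tF r K.+1.
  have Q0 : Q.[0] = 0.
    have := H 0; rewrite normr0 d0 addr0 Fr sub0r normrN expr0n mulr0 => /(_ isT).
    by rewrite normr_le0 => /eqP.
  have [Q' QE] : exists Q', Q = Q' * 'X.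
    by apply/dvdpP; rewrite -['X]subr0 -[0]/(0%:P) dvdp_XsubCl /root Q0.
  exists Q', M, d; split=> // h /H; rewrite QE hornerM hornerX mulrC //.
have [Q1 [M1 [d1 [M10 d10 H1]]]] := step 1.
pose G x := if x == r then Q1.[0] else F x / (x - r).
have GE x : F x = (x - r) * G x.
  rewrite /G; have [->|xr] := eqVneq x r; first by rewrite subrr mul0r.
  by rewrite mulrC divfK // subr_eq0.
exists G => // a; have [->|ar] := eqVneq a r; last first.
  apply: (@tay_at_near (fun x => F x * (x - r)^-1)).
    by apply: tay_atM => //; apply: tay_at_inv; rewrite eq_sym.
  exists `|a - r| => [|h hd]; first by rewrite normr_gt0 subr_eq0.
  rewrite /G; case: eqP => // ahr; move: hd.
  by rewrite -ahr opprD addrA subrr sub0r normrN ltxx.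
move=> K; have [Q [M [d [M0 d0 H]]]] := step K.+1.
(* One expansion fixed the value of [G] at [r]; the others have the same constant term, because D(h)
   = O(|h|). *)
have Q0 : Q.[0] = Q1.[0].
  apply/eqP; rewrite -subr_eq0; apply: contraT => q0.
  pose D := Q - Q1; have D0 : D.[0] != 0 by rewrite hornerD hornerN.
  have [T TE] : exists T, D - D.[0]%:P = T * 'X.
    by apply/dvdpP; rewrite -['X]subr0 -[0]/(0%:P) dvdp_XsubCl /root hornerD hornerN hornerC subrr.
  have [B B0 BP] := poly_bounded T; pose N := M + M1 + B.
  have N0 : 0 <= N by rewrite !addr_ge0.
  have [c c0 cP] := norm_lt_min d0 d10; have [c' c'0 c'P] := norm_lt_min c0 (ltr01 : 0 < 1 :> C).
  have nD : 0 < `|D.[0]| by rewrite normr_gt0.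
  have N1 : 0 < N + 1 by rewrite ltr_wpDl.
  have [e e0 eP] := norm_lt_min c'0 (divr_gt0 nD N1).
  pose h := e / 2; have h0 : 0 < h by rewrite divr_gt0.
  have hh : `|h| = h by rewrite gtr0_norm.
  have [/c'P[/cP[hd hd1] h1] hN] : `|h| < c' /\ `|h| < `|D.[0]| / (N + 1).
    by apply: eP; rewrite hh [ltRHS]splitr ltrDl.
  have {}h1 := ltW h1.
  have DB : `|D.[h]| <= (M + M1) * `|h|.
    rewrite -(ler_pM2l h0) -{1}hh -normrM.
    have -> : h * D.[h] = (F (r + h) - h * Q1.[h]) - (F (r + h) - h * Q.[h]).
      by rewrite /D hornerD hornerN; ring.
    apply: le_trans (ler_normB _ _) _.
    have -> : h * ((M + M1) * `|h|) = M1 * `|h| ^+ 2 + M * `|h| ^+ 2 by rewrite !hh; ring.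
    apply: lerD; first exact: H1.
    apply: le_trans (H _ hd) _; rewrite ler_wpM2l //.
    by rewrite 2!exprS [leRHS]exprS expr1 mulrA -[leRHS]mulr1 -mulrA mulrA ler_wpM2l ?mulr_ge0 // exprn_ile1.
  have : `|D.[0]| <= N * `|h|.
    have -> : D.[0] = D.[h] - T.[h] * h.
      by have := congr1 (horner^~ h) TE; rewrite hornerD hornerN hornerC hornerM hornerX => <-; rewrite subKr.
    apply: le_trans (ler_normB _ _) _; rewrite /N mulrDl lerD // normrM ler_wpM2r //.
    exact: BP.
  move: hN; rewrite ltr_pdivlMr // => hN /(lt_le_trans hN).
  by rewrite mulrC ltr_pM2r ?hh // gtrDl ltr10.
have GrE h : `|h| < d -> `|G (r + h) - Q.[h]| <= M * `|h| ^+ K.+1.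
  move=> hd; have [->|h0] := eqVneq h 0.
    by rewrite addr0 /G eqxx Q0 subrr normr0 mulr_ge0 // exprn_ge0.
  have nh : 0 < `|h| by rewrite normr_gt0.
  rewrite -(ler_pM2l nh) -normrM mulrBr mulrCA -exprS.
  have -> : h * G (r + h) = F (r + h) by rewrite GE addrAC subrr add0r.
  exact: H.
have [c c0 cP] := norm_lt_min d0 (ltr01 : 0 < 1 :> C).
exists Q, M, c; split=> // h /cP[hd h1]; apply: le_trans (GrE h hd) _.
by rewrite ler_wpM2l // exprS ler_piMl ?exprn_ge0 // ltW.
Qed.

Lemma poly_split p : exists T, p = p.[0]%:P + T * 'X.
Proof.
have [T TE] : exists T, p - p.[0]%:P = T * 'X.
  by apply/dvdpP; rewrite -['X]subr0 -[0]/(0%:P) dvdp_XsubCl /root hornerD hornerN hornerC subrr.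
by exists T; rewrite -TE addrC subrK.
Qed.

Lemma tay_differentiable F a : tay F -> differentiable F a.
Proof.
move=> tF; have [Q [M [d [M0 d0 H]]]] := tF a 2.
have Fa : F a = Q.[0].
  apply/eqP; rewrite -subr_eq0 -normr_le0 -[a in F a]addr0.
  by apply: le_trans (H 0 _) _; rewrite normr0 // expr0n mulr0.
have [T TE] := poly_split Q; have [U UE] := poly_split T.
have [B B0 BP] := poly_bounded U.
have [c c0 cP] := norm_lt_min d0 (ltr01 : 0 < 1 :> C).
apply/derivable1_diffP/cvg_ex; exists T.[0]; apply/cvgrPdist_le => e e0.
have MB : 0 < M + B + 1 by rewrite ltr_wpDl // addr_ge0.
have [c' c'0 c'P] := norm_lt_min c0 (divr_gt0 e0 MB).
near=> h.
have h0 : h != 0 by near: h; exact: nbhs_dnbhs_neq.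
have [/cP[hd h1] hB] : `|h| < c /\ `|h| < e / (M + B + 1).
  apply: c'P; near: h; apply: dnbhs0_lt => //.
have nh : 0 < `|h| by rewrite normr_gt0.
have -> : h *: 1%R = h by rewrite /GRing.scale /= mulr1.
rewrite -(ler_pM2l nh) -normrM /GRing.scale /=.
have -> : h * (T.[0] - h^-1 * (F (h + a) - F a)) = - (F (a + h) - Q.[h]) - U.[h] * h ^+ 2.
  have -> : Q.[h] = Q.[0] + (T.[0] + U.[h] * h) * h.
    by rewrite {1}TE hornerD hornerC hornerM hornerX {1}UE hornerD hornerC hornerM hornerX.
  by rewrite mulrBr mulrA mulfV // mul1r Fa [h + a]addrC; ring.
apply: le_trans (ler_normB _ _) _; rewrite normrN normrM normrX.
apply: (@le_trans _ _ (M * `|h| ^+ 2 + B * `|h| ^+ 2)).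
  by rewrite lerD ?H // ler_wpM2r ?exprn_ge0 // BP // ltW.
rewrite -mulrDl expr2 mulrCA ler_wpM2l //.
move: hB; rewrite ltr_pdivlMr // => /ltW; apply: le_trans.
by rewrite mulrC ler_wpM2l // lerDl.
Unshelve. all: by end_near. Qed.

End TaylorExpandable.

Lemma tay_bounded (C : numFieldType) (F : C -> C) a : tay F ->
  exists N d : C, [/\ 0 <= N, 0 < d & forall h, `|h| < d -> `|F (a + h)| <= N].
Proof.
move=> /(_ a 0%N)[Q [M [d [M0 d0 H]]]]; have [B B0 BP] := poly_bounded Q.
have [c c0 cP] := norm_lt_min d0 (ltr01 : 0 < 1 :> C).
exists (M + B), c; split=> // [|h /cP[hd h1]]; first exact: addr_ge0.
rewrite -(subrK Q.[h] (F _)); apply: le_trans (ler_normD _ _) _; apply: lerD.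
  by have := H _ hd; rewrite expr0 mulr1.
by apply: BP; apply: ltW.
Qed.

Section Interpolation.
Variable R : realType.
Let C : numFieldType := R[i].

Lemma tay_expC : tay (@expC R : C -> C).
Proof.
move=> a K; have [M M0 H] := expC_taylor R K.
exists (expC a *: expP R K), (`|expC a| * M), 1; split; rewrite ?mulr_ge0 // => h h1.
by rewrite expCD hornerZ -mulrBr normrM -mulrA ler_wpM2l // H // ltW.
Qed.

(** [E] is (exp u - 1) / u. If [E 0] were 0, comparison with the expansion 1 + h would give h =
    O(|h|^2). *)
Lemma expC_quotient : exists E : C -> C, [/\ tay E, E 0 != 0 & forall u, expC u = 1 + u * E u].
Proof.
have tF : tay (fun u : C => expC u + (-1)).
  apply: tayD; first exact: tay_expC.
  move=> a K; exists (-1)%:P, 0, 1; split=> // h _.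
  by rewrite hornerC subrr normr0 mul0r.
have F0 : expC (0 : C) + (-1) = 0 by rewrite expC0 subrr.
have [E tE HE] := tay_division tF F0.
have EE u : expC u = 1 + u * E u by rewrite -{2}[u]subr0 -HE addrC subrK.
exists E; split=> //; apply/eqP => E0.
have [E2 tE2 HE2] := tay_division tE E0.
have [N [d [N0 d0 HN]]] := tay_bounded 0 tE2.
have [M M0 HM] := expC_taylor R 2.
have MN : 0 < M + N + 1 by rewrite ltr_wpDl // addr_ge0.
have [c c0 cP] := norm_lt_min d0 (ltr01 : 0 < 1 :> C).
have [e e0 eP] := norm_lt_min c0 (divr_gt0 (ltr01 : 0 < 1 :> C) MN).
pose h := e / 2; have h0 : 0 < h by rewrite divr_gt0.
have hh : `|h| = h by rewrite gtr0_norm.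
have [/cP[hd h1] hN] : `|h| < c /\ `|h| < 1 / (M + N + 1).
  by apply: eP; rewrite hh [ltRHS]splitr ltrDl.
have : `|h| <= (M + N) * `|h| ^+ 2.
  have {1}-> : h = h * (h * E2 (0 + h)) - (expC h - (expP R 2).[h]).
    rewrite EE HE2 subr0 add0r expPE 2!big_ord_recr big_ord0 /= expr0 expr1 !divr1; ring.
  apply: le_trans (ler_normB _ _) _; rewrite [leRHS]mulrDl [leRHS]addrC; apply: lerD; last first.
    by apply: HM; apply: ltW.
  by rewrite mulrA -expr2 normrM normrX mulrC ler_wpM2r ?exprn_ge0 // HN.
rewrite hh; move: hN; rewrite ltr_pdivlMr // hh => hN.
rewrite expr2 mulrA -[leLHS]mul1r ler_pM2r // => /(lt_le_trans hN).
by rewrite mulrC ltr_pM2r // gtrDl ltr10.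
Qed.

(* Induction on the roots: [e] is multiplied by exp(c Pi), where Pi is the
   product over the previous roots and [c] makes the new [G] vanish at the next root. *)
Lemma exp_interp (rs : seq C) : all (fun r => r != 0) rs ->
  exists e e' G : C -> C, [/\ tay e', tay G, forall T, e T * e' T = 1 &
    forall T, e T = T + (\prod_(r <- rs) ('X - r%:P)).[T] * G T].
Proof.
have [E [tE E0 EE]] := expC_quotient.
move=> rs0; suff: exists e e' G : C -> C, [/\ tay e, tay e', tay G, forall T, e T * e' T = 1 &
    forall T, e T = T + (\prod_(r <- rs) ('X - r%:P)).[T] * G T].
  by move=> [e [e' [G [_ te' tG ee' eE]]]]; exists e, e', G.
elim: rs rs0 => [_|r rs IH /= /andP[r0 /IH{IH}[e [e' [G [te te' tG ee' eE]]]]]].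
  pose one x := (1%:P : {poly C}).[x].
  exists one, one, (fun x => (1%:P - 'X : {poly C}).[x]).
  split=> [|||T|T]; try exact: tay_poly; rewrite /one ?hornerC ?mulr1 //.
  by rewrite big_nil -polyC1 hornerD hornerN !hornerC hornerX mul1r addrC subrK.
have e0 T : e T != 0.
  by apply/eqP => eT; have := ee' T; rewrite eT mul0r => /eqP; rewrite eq_sym oner_eq0.
set Pi := \prod_(r <- rs) _ in eE *.
(* If Pi(r) is nonzero, [c] solves e(r) exp(c Pi(r)) = r, because the exponential takes all nonzero
   values; if [r] repeats a previous root, the equation is linear in [c], with nonzero slope e(r)
   E(0). *)
have [c cP] : exists c, G r + e r * (c * E (c * Pi.[r])) = 0.
  have [P0|P0] := eqVneq Pi.[r] 0.
    exists (- G r / (e r * E 0)); rewrite P0 mulr0; field.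
    by rewrite E0 e0.
  have [|z zE] := @expC_surj R (r / e r); first by rewrite mulf_neq0 ?invr_eq0.
  exists (z / Pi.[r]); apply: (mulfI P0); rewrite mulr0 divfK //.
  have := congr1 ( *%R (e r)) zE; rewrite EE [RHS]mulrC divfK // => H.
  have H2 : e r = e r * (1 + z * E z) + Pi.[r] * G r by rewrite H; exact: eE.
  have -> : Pi.[r] * (G r + e r * (z / Pi.[r] * E z)) = Pi.[r] * G r + e r * (z * E z) by field.
  by apply: (@addrI _ (e r)); rewrite addr0 [RHS]H2; ring.
pose G1 x := G x + e x * ((c%:P : {poly C}).[x] * E (c *: Pi).[x]).
have tG1 : tay G1.
  apply: tayD => //; apply: tayM => //; apply: tayM; first exact: tay_poly.
  exact: tay_comp.
have G1r : G1 r = 0 by rewrite /G1 hornerC hornerZ.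
have [G' tG' G'E] := tay_division tG1 G1r.
exists (fun x => e x * expC (c *: Pi).[x]), (fun x => e' x * expC (- (c *: Pi)).[x]), G'.
split=> // [||T|T].
- by apply: tayM => //; apply: tay_comp; exact: tay_expC.
- by apply: tayM => //; apply: tay_comp; exact: tay_expC.
- by rewrite mulrACA ee' mul1r -expCD hornerN subrr expC0.
rewrite big_cons hornerM hornerD hornerN hornerX hornerC hornerZ EE.
have := eE T; have := G'E T; rewrite /G1 hornerC hornerZ => H1 H2.
have -> : (T - r) * Pi.[T] * G' T = Pi.[T] * ((T - r) * G' T) by ring.
rewrite -H1; move: (E _) => Y; rewrite mulrDr mulr1 {1}H2; ring.
Qed.
End Interpolation.

(** * Overshears *)

Section DoubleCurve.
Variable C : numClosedFieldType.
Implicit Types (x y z q k : {poly C}) (B : {poly C} -> Prop).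

Definition separates z x y := forall t s, dq x t s = 0 -> dq y t s = 0 -> dq z t s != 0.

Lemma dvd_XsubC k (t : C) : k.[t] = 0 -> exists v, k = v * ('X - t%:P).
Proof. by move=> kt; apply/dvdpP; rewrite dvdp_XsubCl /root kt. Qed.

Lemma gen_ideal_dqp B x t : subalg B -> B x ->
  gen_ideal (vanishing_in B t) (('X - t%:P) * dqp x t).
Proof.
move=> [BC BD _] Bx; apply: gen_ideal_gen; rewrite dqpE; split; last by rewrite hornerD hornerN hornerC subrr.
by rewrite -polyCN; apply: BD.
Qed.

(** By [E] the ideal contains ('X - t) ('X - s). It also contains ('X - t) d, where d is a
    difference quotient that is nonzero at [s], and hence 'X - t. *)
Lemma simple_point_span B x y t s (a b : {poly C}) k : subalg B -> B x -> B y ->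
  a * dqp x t + b * dqp y t = 'X - s%:P -> ~ (dq x t s = 0 /\ dq y t s = 0) ->
  gen_ideal (vanishing_in B t) (k - k.[t]%:P).
Proof.
move=> sB Bx By E nbad; set J := gen_ideal _; have [JD JM] := gen_ideal_is_ideal (vanishing_in B t).
have Jx : J (('X - t%:P) * dqp x t) by apply: gen_ideal_dqp.
have Jy : J (('X - t%:P) * dqp y t) by apply: gen_ideal_dqp.
have Js : J (('X - t%:P) * ('X - s%:P)).
  rewrite -E mulrDr [_ * (a * _)]mulrCA [_ * (b * _)]mulrCA; apply: JD; exact: JM.
have unit d : J (('X - t%:P) * d) -> d.[s] != 0 -> J ('X - t%:P).
  move=> Jd ds; have [|v vE] := @dvd_XsubC (d - d.[s]%:P) s.
    by rewrite hornerD hornerN hornerC subrr.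
  have -> : 'X - t%:P = d.[s]^-1%:P * (('X - t%:P) * d) + (- d.[s]^-1%:P * v) * (('X - t%:P) * ('X - s%:P)).
    have -> : (- d.[s]^-1%:P * v) * (('X - t%:P) * ('X - s%:P)) =
      - d.[s]^-1%:P * ('X - t%:P) * (v * ('X - s%:P)) by ring.
    rewrite -vE; have -> : d.[s]^-1%:P * (('X - t%:P) * d) + - d.[s]^-1%:P * ('X - t%:P) * (d - d.[s]%:P)
      = (d.[s]^-1%:P * d.[s]%:P) * ('X - t%:P) by ring.
    by rewrite -polyCM mulVf // mul1r.
  by apply: JD; apply: JM.
rewrite -dqpE mulrC; apply: (JM).
have [dx|dx] := eqVneq (dq x t s) 0; last exact: unit dx.
apply: (unit (dqp y t)) => //; apply/eqP => dy; exact: nbad.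
Qed.

(** At a double point {t, s}, the elements of [B] that vanish at [t] generate an ideal containing
    ('X - t) ('X - s), and modulo this product the constants and [z] span C[t], because [z]
    separates. Elsewhere the constants suffice, and Nakayama's lemma concludes. *)
Lemma dbl_span B x y z : subalg B -> B x -> B y -> dbl x y -> separates z x y ->
  forall k, exists a b, [/\ B a, B b & k = a + b * z].
Proof.
move=> sB Bx By [sx x0 dblP] sep; have [BC BD BM] := sB.
pose S k := exists a b, [/\ B a, B b & k = a + b * z].
have mS : submod B S.
  split=> [|_ _ [a [b [Ba Bb ->]]] [a' [b' [Ba' Bb' ->]]]|c _ Bc [a [b [Ba Bb ->]]]].
  - by exists 0, 0; rewrite mul0r addr0; split=> //; apply: (BC 0).
  - by exists (a + a'), (b + b'); split; [exact: BD|exact: BD|ring].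
  - by exists (c * a), (c * b); split; [exact: BM|exact: BM|ring].
apply: (submod_full sB mS Bx sx) => t k.
have [JD JM] := gen_ideal_is_ideal (vanishing_in B t).
have [s [a [b E]]] := dblP t.
have [[dx dy]|nbad] := pselect (dq x t s = 0 /\ dq y t s = 0); last first.
  exists k.[t]%:P; last exact: simple_point_span E nbad.
  by exists k.[t]%:P, 0; rewrite mul0r addr0; split=> //; apply: (BC 0).
have dz := sep _ _ dx dy; pose c := dq k t s / dq z t s.
exists ((k.[t] - c * z.[t])%:P + c%:P * z); first by exists (k.[t] - c * z.[t])%:P, c%:P.
have [|v vE] := @dvd_XsubC (dqp k t - c%:P * dqp z t) s.
  by rewrite hornerD hornerN hornerM hornerC /c -/(dq z t s) divfK // subrr.
have -> : k - ((k.[t] - c * z.[t])%:P + c%:P * z) =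
  (v * a) * (('X - t%:P) * dqp x t) + (v * b) * (('X - t%:P) * dqp y t).
  have -> : v * a * (('X - t%:P) * dqp x t) + v * b * (('X - t%:P) * dqp y t) =
    ('X - t%:P) * (v * (a * dqp x t + b * dqp y t)) by ring.
  rewrite E -vE mulrBr mulrCA !dqpE polyCB polyCM; ring.
by apply: JD; apply: JM; apply: gen_ideal_dqp.
Qed.

(** The curve (x, y) has no double points on x = 0; elsewhere they may be arbitrary. *)
Definition good x y := (1 < size x)%N /\ forall t s, x.[t] = 0 -> dq x t s = 0 -> dq y t s != 0.

Lemma dbl_good x y : dbl x y -> good x y.
Proof.
move=> [sx x0 _]; split=> // t s xt dx; apply/eqP => dy.
by have := x0 _ _ dx dy; rewrite (dq_eq0 dx) xt eqxx.
Qed.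

(** Over the zeros of [x] the curve is embedded, so [B] maps onto C[t] modulo [x], and [conductor]
    applies. *)
Lemma good_conductor B x y : subalg B -> B x -> B y -> good x y ->
  exists2 F, F.[0] = 1 & forall k, B ((F \Po x) * k).
Proof.
move=> sB Bx By [sx gx]; have [BC BD BM] := sB.
have xn0 : x != 0 by apply: contraTneq sx => ->; rewrite size_poly0.
have [ts xE] := closed_field_poly_normal x.
apply: (conductor sB (subalg_submod sB) Bx sx) => k.
have [t tts {}k|s Bs sk] := submod_mod_prod (subalg_submod sB) (ts := ts) _ k; last first.
  by exists s => //; rewrite xE; apply: dvdp_trans sk; rewrite dvdpZl ?lead_coef_eq0.
have xt : x.[t] = 0.
  by apply/rootP; rewrite xE rootZ ?lead_coef_eq0 // root_prod_XsubC.
have d0 : dqp x t != 0 by rewrite dqp_eq0 -ltnNge.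
have /(coprimep_no_common_root d0)/Bezout_eq1_coprimepP[[a b] /= ab] s :
  root (dqp x t) s -> ~~ root (dqp y t) s by rewrite rootdq => /eqP/(gx _ _ xt); rewrite rootdq.
exists k.[t]%:P => //; have [JD JM] := gen_ideal_is_ideal (vanishing_in B t).
rewrite -dqpE mulrC; apply: (JM).
have -> : 'X - t%:P = a * (('X - t%:P) * dqp x t) + b * (('X - t%:P) * dqp y t).
  by rewrite ![_ * (('X - _) * _)]mulrCA -mulrDr ab mulr1.
by apply: (JD); apply: (JM); apply: gen_ideal_dqp.
Qed.

(* Used with v = 1 + x b. The cofactor P of v is chosen such that P(v) z lies in B,
   and P(0) <> 0, so that v + (v - 1) P(v) E can be made nowhere zero. *)
Lemma overshear_data B x y z q : subalg B -> B x -> B y -> dbl x y ->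
  separates z x y -> separates (z + q * x) x y ->
  exists a b c (rs : seq C), [/\ B a, B b, B c, all (fun r => r != 0) rs &
    q = a + b * z /\ c = (\prod_(r <- rs) ('X - r%:P) \Po (1 + x * b)) * z].
Proof.
move=> sB Bx By xy sz sz'; have [BC BD BM] := sB.
have [a [b [Ba Bb qE]]] := dbl_span sB Bx By xy sz q.
have [al [be [Bal Bbe zE]]] := dbl_span sB Bx By xy sz' z.
have [F F0 FB] := good_conductor sB Bx By (dbl_good xy).
pose m := F \Po x; have m0 : m != 0.
  rewrite comp_poly_eq0; last by case: xy.
  by apply: contraTneq (oner_neq0 C) => FE; rewrite -F0 FE horner0 eqxx.
pose v := 1 + x * b; have Bv : B v by apply: BD; [exact: (BC 1)|exact: BM].
(* From q = a + b z and z = al + be (z + q x) follows z = al + be x a + be v z: modulo [B],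
   multiplication by be v fixes [z]. *)
have Bbv : B ((1 - be * v) * z).
  have -> : (1 - be * v) * z = al + be * (a * x); last by apply: BD => //; do 2!apply: (BM) => //.
  rewrite /v mulrBl mul1r {1}zE qE; ring.
have [ts mE] := closed_field_poly_normal m.
pose rs := [seq r <- [seq v.[t] | t <- ts] | r != 0].
pose P := \prod_(r <- rs) ('X - r%:P).
(* The product over the values of [v] at the zeros of the conductor [m], composed with [v], is a
   multiple of [m]. Values that are 0 are not allowed in [rs] and give the factor [v ^+ d]. *)
have [d Pk] : exists d, \prod_(r <- [seq v.[t] | t <- ts]) ('X - r%:P) = 'X^d * P.
  rewrite /P /rs; elim: [seq _ | _ <- _] => [|r us [d IH]]; first by exists 0%N; rewrite expr0 mul1r.
  rewrite big_cons IH /=; have [->|r0] := eqVneq r 0; first by exists d.+1; rewrite subr0 exprS mulrA.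
  by exists d; rewrite big_cons mulrCA.
have PB w : B (v ^+ d * (P \Po v) * w).
  have -> : v ^+ d * (P \Po v) = ('X^d * P) \Po v by rewrite comp_polyM comp_Xn_poly.
  rewrite -Pk; have /dvdpP[u ->] : m %| \prod_(r <- [seq v.[t] | t <- ts]) ('X - r%:P) \Po v.
    rewrite mE dvdpZl ?lead_coef_eq0 // big_map; elim: ts {mE rs P Pk} => [|t ts IH].
      by rewrite !big_nil dvd1p.
    rewrite !big_cons comp_polyM dvdp_mul // comp_polyB comp_polyX comp_polyC.
    by rewrite dvdp_XsubCl /root hornerD hornerN hornerC subrr.
  by rewrite mulrAC mulrC; apply: FB.
exists a, b, ((P \Po v) * z), rs; split=> //; last by rewrite filter_all.
have BP : B (P \Po v) by apply: subalg_comp.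
have Bexp w n : B w -> B (w ^+ n).
  by move=> Bw; elim: n => [|n IH]; [exact: (BC 1)|rewrite exprS; apply: BM].
(* The factor [v ^+ d] is removed: (be v)^d also fixes [z] modulo [B], so P(v) z lies in [B] because
   v^d P(v) z does. *)
have Bk : B ((1 - (be * v) ^+ d) * z).
  have -> : (1 - (be * v) ^+ d) * z = (\sum_(i < d) (be * v) ^+ i) * ((1 - be * v) * z).
    have -> : 1 - (be * v) ^+ d = 1 ^+ d - (be * v) ^+ d by rewrite expr1n.
    rewrite subrXX mulrA [_ * (1 - _)]mulrC; congr (_ * _ * _).
    by apply: eq_bigr => i _; rewrite expr1n mul1r.
  apply: (BM) => //; have [B0 _ _] := subalg_submod sB.
  elim/big_ind: _ => // i _; apply: Bexp; exact: (BM).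
have -> : (P \Po v) * z = (P \Po v) * ((1 - (be * v) ^+ d) * z) + be ^+ d * (v ^+ d * (P \Po v) * z).
  rewrite exprMn; ring.
by apply: BD; apply: (BM) => //; exact: Bexp.
Qed.

End DoubleCurve.

(** * The row move with a coefficient that depends on the moved row *)

Section Overshear.
Variable C : numClosedFieldType.
Variables (n : nat) (K : ('M[C]_n -> C) -> Prop) (T : (C -> C) -> Prop).
Hypothesis cK : mxclass K.
Hypothesis TK : forall F f, T F -> K f -> K (fun M => F (f M)).
Hypothesis interp : forall rs : seq C, all (fun r => r != 0) rs ->
  exists e e' G : C -> C, [/\ T e', T G, forall t, e t * e' t = 1 &
    forall t, e t = t + (\prod_(r <- rs) ('X - r%:P)).[t] * G t].

(* With Phi = b + P(v) b E(v) and H = a - P(v) z b E(v), both functions of row j,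
   the map row i += (z Phi + H) row j adds q times row j along the line. It maps z
   to e(v) z + H x, so its inverse has coefficients - Phi / e(v) and - H / e(v). *)
Lemma overshear_row_move i j c c' (A : 'M[{poly C}]_n) q : i != j ->
  dbl (A j c) (A j c') -> separates (A i c) (A j c) (A j c') ->
  separates ((tv i j q *m A) i c) (A j c) (A j c') ->
  eqv K A (tv i j q *m A).
Proof.
move=> ij xy sz; rewrite tv_mulE eqxx => sz'.
pose S (k l : 'I_n) := k = j; have sB := inalg_subalg S A.
have Bj l : inalg S A (A j l) by apply: inalg_coord.
have [a [b [d [rs [[fa Pa fE] [fb Pb gE] [fc Pc hE] rs0 [qE dE]]]]]] :=
  overshear_data sB (Bj c) (Bj c') xy sz sz'.
(* The root 1 makes e(v) - v a multiple of v - 1 = x b, so that e(v) has the form 1 + x Phi. *)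
have rs1 : all (fun r => r != 0) (1 :: rs) by rewrite /= oner_neq0.
have [e [e' [E [Te' TE ee' eE]]]] := interp rs1.
have inv (f : 'M[C]_n -> C) u M : polyf S f -> f (tv i j u *m M) = f M.
  move=> Pf; apply: (Pf (fun g => g (tv i j u *m M) = g M)).
    by split=> // g h gM hM; rewrite ?gM ?hM.
  by move=> k l ->; rewrite tv_mulE eq_sym (negPf ij) addr0.
pose P := \prod_(r <- rs) ('X - r%:P).
pose V (M : 'M[C]_n) := 1 + M j c * fb M; pose Y M := fb M * E (V M).
pose Phi M := fb M + P.[V M] * Y M; pose H M := fa M - fc M * Y M.
have [rC rD rM] := mxclass_fring cK.
have Kf f : polyf S f -> K f by apply: polyf_mxclass.
have Kc k l : K (fun M => M k l) by apply: mxclass_coord.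
have KV : K V by apply: rD => //; apply: rM => //; apply: Kf.
have KP : K (fun M => P.[V M]).
  rewrite /P; elim: (rs) => [|r us IH].
    by under eq_fun do rewrite big_nil -polyC1 hornerC.
  under eq_fun do rewrite big_cons hornerM hornerD hornerN hornerC hornerX.
  by apply: (rM) => //; apply: (rD).
have KY : K Y by apply: rM; [apply: Kf|apply: TK].
have KPhi : K Phi by apply: rD; [apply: Kf|apply: rM].
have KH : K H.
  under [H]eq_fun do rewrite /H -mulN1r mulrA.
  apply: (rD); [exact: Kf|apply: (rM) => //; apply: (rM) => //; exact: Kf].
have KeV : K (fun M => e' (V M)) by apply: TK.
have Vi w (M : 'M[C]_n) : V (tv i j w *m M) = V M.
  by rewrite /V (inv fb) // tv_mulE eq_sym (negPf ij) addr0.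
have Yi w (M : 'M[C]_n) : Y (tv i j w *m M) = Y M by rewrite /Y Vi inv.
have Phii w (M : 'M[C]_n) : Phi (tv i j w *m M) = Phi M by rewrite /Phi Vi Yi inv.
have Hi w (M : 'M[C]_n) : H (tv i j w *m M) = H M by rewrite /H Yi !inv.
have PhiE (M : 'M[C]_n) : 1 + M j c * Phi M = e (V M).
  rewrite eE big_cons hornerM hornerD hornerN hornerX hornerC -/P /Phi /Y.
  have -> : V M - 1 = M j c * fb M by rewrite /V addrAC subrr add0r.
  by move: (E _) (P.[_]) => u w; rewrite /V; ring.
pose u (M : 'M[C]_n) := M i c * Phi M + H M; pose u' M := - (u M * e' (V M)).
have Ku : K u by apply: rD => //; apply: rM.
have Ku' : K u'.
  under [u']eq_fun do rewrite /u' -mulN1r.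
  by apply: (rM) => //; apply: (rM).
have mE w (M : 'M[C]_n) : (tv i j w *m M) i c = M i c + w * M j c by rewrite tv_mulE eqxx.
exists (fun M => tv i j (u M) *m M), (fun M => tv i j (u' M) *m M); split.
- by apply: mxmap_mul; [|exact: mxmap_tv|exact: mxmap_id].
- by apply: mxmap_mul; [|exact: mxmap_tv|exact: mxmap_id].
- move=> M M1; rewrite !det_mulmx !det_tv // !mul1r; split=> //.
    have -> : u' (tv i j (u M) *m M) = - u M; last by rewrite tvK.
    rewrite /u' /u mE Phii Hi Vi; congr (- _).
    have -> : (M i c + (M i c * Phi M + H M) * M j c) * Phi M + H M =
      u M * (1 + M j c * Phi M) by rewrite /u; ring.
    by rewrite PhiE -mulrA ee' mulr1.
  have uE : u (tv i j (u' M) *m M) = - u' M; last by rewrite uE tvK.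
  rewrite /u mE Phii Hi /u' opprK; apply: (mulIf (_ : e (V M) != 0)).
    by apply: contraTneq (oner_neq0 C) => eV; rewrite -(ee' (V M)) eV mul0r eqxx.
  rewrite -[RHS]mulrA [e' _ * e _]mulrC ee' mulr1.
  have -> : ((M i c + - (u M * e' (V M)) * M j c) * Phi M + H M) * e (V M) =
    M i c * Phi M * e (V M) + H M * e (V M) - u M * (e (V M) * e' (V M)) * M j c * Phi M by ring.
  by rewrite ee' -PhiE /u; ring.
move=> t; rewrite evmxM evmx_tv; congr (tv i j _ *m _).
have Yt : V (evmx A t) = (1 + A j c * b).[t].
  by rewrite /V gE evmxE hornerD hornerM -polyC1 hornerC.
rewrite /u /Phi /H /Y fE gE hE dE hornerM horner_comp -Yt -/P !evmxE qE hornerD hornerM.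
ring.
Qed.
End Overshear.

(** * The case n = 2 *)

Section GoodPairs.
Variable C : numClosedFieldType.
Implicit Types (p x y z q : {poly C}).

Definition quad (m l : C) : {poly C} := m%:P * 'X^2 + l%:P * 'X.

Lemma dq_quad m l t s : dq (quad m l) t s = m * (t + s) + l.
Proof.
by rewrite /quad dqD !dqCM expr2 dqM !dqX !hornerX mul1r !mulr1 addrC [s + t]addrC addrC.
Qed.

Lemma dq_size_gt1 p t s : dq p t s != 0 -> (1 < size p)%N.
Proof. by rewrite ltnNge -(dqp_eq0 _ t); apply: contra => /eqP; rewrite /dq => ->; rewrite horner0. Qed.

Lemma good_root x y : good x y -> exists t1, forall s, dq x t1 s = 0 -> dq y t1 s != 0.
Proof.
move=> [sx gx]; have /closed_rootP[t rt] : size x != 1 by rewrite gtn_eqF.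
by exists t => s; apply: gx; apply/rootP.
Qed.

(** On y0 = 0 the functions [x0] and [y1] are inverse to each other up to [e], so they separate the
    same points. This leads from rows to columns and back. *)
Lemma good_transfer (x0 y0 x1 y1 : {poly C}) (e : C) : e != 0 -> x0 * y1 - x1 * y0 = e%:P ->
  good y0 x0 -> good y0 y1.
Proof.
move=> e0 E [sy gy]; split=> // t s yt dy; apply/eqP => dy1.
have ys : y0.[s] = 0 by rewrite (dq_eq0 dy).
have := congr1 (fun p => dq p t s) E; rewrite dqB !dqM dqC dy dy1 ys !mulr0 !addr0 subr0 => /eqP.
rewrite mulf_eq0 (negPf (gy _ _ yt dy)) /= => /eqP y1s.
have := congr1 (fun p : {poly C} => p.[s]) E; rewrite hornerD hornerN !hornerM ys y1s !mulr0 subrr hornerC.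
by move/esym/eqP; rewrite (negPf e0).
Qed.

Lemma good_pencil x y : good x y -> (forall s, x.[s] = 0 -> y.[s] != 0) ->
  cofin (fun k => good (y + k%:P * x) x).
Proof. by move=> g cop; have [t1 t1P] := good_root g; apply: pencil_good t1P. Qed.

Lemma good_dbl x y : good y x -> cofin (fun m => cofin (fun l => dbl y (x + y * quad m l))).
Proof.
move=> [sy gy]; have := @generic_double C x y 'X sy; rewrite comp_polyX; apply.
- by rewrite polyX_eq0.
- by rewrite hornerX.
- by move=> t s; rewrite hornerX; apply: gy.
Qed.

(** A constant row becomes affine. Otherwise [k0] makes x + k0 y nonconstant, [n] yields a parameter
    [t1] without partner, and [pencil_good] provides [k]. *)
Lemma cofin_row_good x y : (forall s, x.[s] = 0 -> y.[s] != 0) ->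
  cofin (fun k0 => cofin (fun n => cofin (fun k =>
    good (y + (n%:P * 'X + k%:P) * (x + k0%:P * y)) (x + k0%:P * y)))).
Proof.
move=> cop.
have cop' k0 s : (x + k0%:P * y).[s] = 0 -> y.[s] != 0.
  rewrite hornerD hornerM hornerC => e; apply/eqP => ys; move: e; rewrite ys mulr0 addr0 => /cop.
  by rewrite ys eqxx.
have [/andP[/size1_polyC xE /size1_polyC yE]|] := boolP ((size x <= 1) && (size y <= 1))%N.
  move: (x`_0) (y`_0) xE yE => a b xE yE.
  have : cofin (fun k0 => a + k0 * b != 0).
    by apply: cofin_lin => b0; have := cop 0; rewrite xE yE !hornerC b0 eqxx; case: eqP => // a0 /(_ a0).
  apply: cofinW => k0 c0.
  have : cofin (fun n => 0 + n * 1 != 0 :> C) by apply: cofin_lin => /eqP; rewrite oner_eq0.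
  apply: cofinW => n; rewrite add0r mulr1 => n0; apply: cofinT => k.
  have d t s : dq (y + (n%:P * 'X + k%:P) * (x + k0%:P * y)) t s = n * (a + k0 * b).
    rewrite xE yE -polyCM -polyCD dqD dqM !dqC add0r mulr0 addr0 dqD dqCM dqX dqC addr0 mulr1.
    by rewrite hornerC.
  have nc : n * (a + k0 * b) != 0 by rewrite mulf_neq0.
  split=> [|t s _ /eqP]; last by rewrite d (negPf nc).
  by apply: (@dq_size_gt1 _ 0 0); rewrite d.
rewrite negb_and -!ltnNge => nc.
have [s ds] : exists s, dq y 0 s = 0 -> dq x 0 s != 0.
  have nz p : (1 < size p)%N -> exists s, dq p 0 s != 0.
    by move=> sp; apply: cofin_ex; apply: cofin_poly; rewrite dqp_eq0 -ltnNge.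
  case/orP: nc => /nz[s ds]; exists s => // /eqP; by rewrite (negPf ds).
apply: cofinW (cofin_lin ds) => k0; rewrite -dqCM -dqD => /dq_size_gt1.
move/cop': (k0); move: (x + _) => X copX sX.
have X0 : X != 0 by rewrite -size_poly_eq0 -lt0n ltnW.
have [t1 Xt] := cofin_ex (cofin_poly X0).
have : forall s, root (dqp X t1) s -> cofin (fun n => dq y t1 s + n * X.[s] != 0).
  move=> u; rewrite rootdq => /eqP/dq_eq0 Xu.
  by apply: cofin_lin => /eqP; rewrite Xu (negPf Xt).
have d0 : dqp X t1 != 0 by rewrite dqp_eq0 -ltnNge.
move=> /(cofin_roots d0); apply: cofinW => n nP.
have : cofin (fun k => good ((y + n%:P * 'X * X) + k%:P * X) X).
  apply: (@pencil_good _ _ _ t1) => [u Xu|u du].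
    by rewrite hornerD hornerM Xu mulr0 addr0; apply: copX.
  rewrite dqD dqM du mulr0 addr0 dqCM dqX mulr1; apply: nP; rewrite rootdq du //.
by apply: cofinW => k; rewrite -addrA -mulrDl.
Qed.

Lemma ord2P (a b u : 'I_2) : a != b -> u = a \/ u = b.
Proof.
move: a b u => [[|[|//]] la] [[|[|//]] lb] [[|[|//]] lu] //= _;
  by [left; apply: val_inj|right; apply: val_inj].
Qed.

Lemma det2 (A : 'M[{poly C}]_2) i j c c' : \det A = 1 -> i != j -> c != c' ->
  exists2 e : C, e != 0 & A j c * A i c' - A j c' * A i c = e%:P.
Proof.
have m1 : (-1 : C) != 0 by rewrite oppr_eq0 oner_eq0.
have -> : \det A = A 0 0 * A 1 1 - A 0 1 * A 1 0.
  rewrite (expand_det_row _ 0) !big_ord_recl big_ord0 addr0 /cofactor !det_mx11 !mxE /=.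
  have -> : lift (0 : 'I_2) (0 : 'I_1) = 1 by apply: val_inj.
  have -> : lift (1 : 'I_2) (0 : 'I_1) = 0 by apply: val_inj.
  by rewrite addn0 expr0 mul1r expr1 mulN1r mulrN.
move=> d.
have i2 (k : 'I_2) : k = 0 \/ k = 1 by apply: ord2P.
case: (i2 i) (i2 j) (i2 c) (i2 c') => -> [] -> [] -> [] -> //= _ _.
all: first [by exists 1; rewrite ?oner_neq0 // polyC1 -d; ring
           |by exists (-1); rewrite // polyCN polyC1 -d; ring].
Qed.

(** Row [j] leaves finitely many pairs (t, s) unseparated; at such a pair the difference quotient of
    row [i] is affine in [l], with slope row [j] at [s], which is not zero. *)
Lemma cofin_embT (A : 'M[{poly C}]_2) i j c c' m : \det A = 1 -> i != j -> c != c' ->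
  good (A j c) (A j c') -> cofin (fun l => embT (tv i j (quad m l) *m A)).
Proof.
move=> A1 ij cc g; have [e e0 dE] := det2 A1 ij cc.
have [t1 /finite_double2[D D0 DP]] := good_root g.
have : forall t, root D t -> cofin (fun l => forall s, root D s ->
    exists k, dq (A i k) t s + (m * (t + s) + l) * (A j k).[s] != 0).
  move=> t _; apply: (cofin_roots D0) => s _.
  have [k jk] : exists k, (A j k).[s] != 0.
    have [ac|] := eqVneq (A j c).[s] 0; last by exists c.
    exists c'; apply: contraNneq e0 => ac'; have := congr1 (fun p : {poly C} => p.[s]) dE.
    by rewrite hornerD hornerN !hornerM ac ac' !mul0r subrr hornerC => <-.
  have : cofin (fun l => (dq (A i k) t s + m * (t + s) * (A j k).[s]) + l * (A j k).[s] != 0).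
    by apply: cofin_lin => /eqP; rewrite (negPf jk).
  by apply: cofinW => l H; exists k; rewrite mulrDl addrA.
move=> /(cofin_roots D0); apply: cofinW => l H t s; apply/matrix0Pn.
have rowj k : (tv i j (quad m l) *m A) j k = A j k.
  by rewrite tv_mulE eq_sym (negPf ij) addr0.
have [dc|dc] := eqVneq (dq (A j c) t s) 0; last by exists j, c; rewrite mxE rowj.
have [dc'|dc'] := eqVneq (dq (A j c') t s) 0; last by exists j, c'; rewrite mxE rowj.
have [rt rs] := DP _ _ dc dc'; have [k kP] := H t rt s rs.
exists i, k; rewrite mxE tv_mulE eqxx dqD dqM dq_quad.
suff -> : dq (A j k) t s = 0 by rewrite mulr0 addr0.
by case: (ord2P k cc) => ->.
Qed.

(** At a double point of (x, y) that [z] did not separate, the determinant would give x times the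
    difference quotient of the fourth entry equal to 0. As x is nonzero there, no entry would
    separate the pair. *)
Lemma separates_row (A : 'M[{poly C}]_2) i j c c' : \det A = 1 -> embT A -> i != j -> c != c' ->
  dbl (A j c) (A j c') -> separates (A i c) (A j c) (A j c').
Proof.
move=> A1 eA ij cc [_ x0 _] t s dx dy; apply/eqP => dz.
have [e e0 dE] := det2 A1 ij cc.
have xs := x0 _ _ dx dy.
have := congr1 (fun p => dq p t s) dE; rewrite dqB !dqM dqC dx dy dz !mul0r !mulr0 !add0r subr0.
move/eqP; rewrite mulf_eq0 -(dq_eq0 dx) (negPf xs) /= => /eqP dw.
have /matrix0Pn[k [l]] := eA t s; rewrite mxE.
by case: (ord2P k ij) (ord2P l cc) => -> [] ->; rewrite ?dx ?dy ?dz ?dw eqxx.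
Qed.

End GoodPairs.

Section Path.
Variable C : numClosedFieldType.
Variable K : ('M[C]_2 -> C) -> Prop.
Hypothesis cK : mxclass K.
Hypothesis row_moveK : forall i j c c' (A : 'M[{poly C}]_2) q, i != j ->
  dbl (A j c) (A j c') -> separates (A i c) (A j c) (A j c') ->
  separates ((tv i j q *m A) i c) (A j c) (A j c') -> eqv K A (tv i j q *m A).
Implicit Types A L : 'M[{poly C}]_2.

Lemma row_move_dbl A i j c c' q : \det A = 1 -> embT A -> embT (tv i j q *m A) ->
  i != j -> c != c' -> dbl (A j c) (A j c') -> eqv K A (tv i j q *m A).
Proof.
move=> A1 eA eA' ij cc d; have A'1 : \det (tv i j q *m A) = 1 by rewrite det_mulmx A1 mulr1 det_tv.
have rowj k : (tv i j q *m A) j k = A j k.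
  by rewrite tv_mulE eq_sym (negPf ij) addr0.
apply: (row_moveK ij d); first exact: separates_row.
by have := separates_row A'1 eA' ij cc; rewrite !rowj; apply.
Qed.

Lemma col_move_dbl A i j c c' q : \det A = 1 -> embT A -> embT (A *m tv j i q) ->
  i != j -> c != c' -> dbl (A c j) (A c' j) -> eqv K A (A *m tv j i q).
Proof.
move=> A1 eA eA' ij cc d.
have := @row_move_dbl A^T i j c c' q; rewrite det_tr !mxE => H.
have : eqv K A^T (tv i j q *m A^T).
  apply: H => //; first exact: embT_tr.
  by have := embT_tr eA'; rewrite trmx_mul tr_tv.
by move/(eqv_tr cK); rewrite trmxK trmx_mul trmxK tr_tv.
Qed.
End Path.

Section Cofin5.
Variable C : numClosedFieldType.

(** The exceptional values of each parameter may depend on the preceding parameters. *)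
Definition cofin5 (P : C -> C -> C -> C -> C -> Prop) :=
  cofin (fun a => cofin (fun b => cofin (fun c => cofin (fun d => cofin (P a b c d))))).

Lemma cofin5W (P Q : C -> C -> C -> C -> C -> Prop) :
  (forall a b c d e, P a b c d e -> Q a b c d e) -> cofin5 P -> cofin5 Q.
Proof. by move=> PQ; do 5!(apply: cofinW => ?); apply: PQ. Qed.

Lemma cofin5I (P Q : C -> C -> C -> C -> C -> Prop) :
  cofin5 P -> cofin5 Q -> cofin5 (fun a b c d e => P a b c d e /\ Q a b c d e).
Proof.
move=> p q; do 4!(apply: cofinW (cofinI p q) => ? {p q} [p q]).
exact: cofinI.
Qed.

End Cofin5.

(** * Three generic column shears and the path from A to A R *)

Section Path.
Variable C : numClosedFieldType.
Variable K : ('M[C]_2 -> C) -> Prop.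
Hypothesis cK : mxclass K.
Hypothesis row_moveK : forall i j c c' (A : 'M[{poly C}]_2) q, i != j ->
  dbl (A j c) (A j c') -> separates (A i c) (A j c) (A j c') ->
  separates ((tv i j q *m A) i c) (A j c) (A j c') -> eqv K A (tv i j q *m A).
Implicit Types A L M : 'M[{poly C}]_2.

Lemma mul_tvE M i j q k l : (M *m tv i j q) k l = M k l + (if l == j then q * M k i else 0).
Proof. by have := tv_mulE j i q M^T l k; rewrite -(tr_tv i j) -trmx_mul !mxE. Qed.

Lemma det_tvr M i j q : i != j -> \det M = 1 -> \det (M *m tv i j q) = 1.
Proof. by move=> ij M1; rewrite det_mulmx M1 mul1r det_tv. Qed.

Lemma det_tvl M i j q : i != j -> \det M = 1 -> \det (tv i j q *m M) = 1.
Proof. by move=> ij M1; rewrite det_mulmx M1 mulr1 det_tv. Qed.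

(** Right multiplication by R, whose last shear is added in [twist]: [a], [b], [c] are the
    parameters of [cofin_row_good], and [d], [e] those of [good_dbl]. *)
Definition twist2 (a b c : C) L := L *m tv 1 0 a%:P *m tv 0 1 (b%:P * 'X + c%:P).
Definition twist (a b c d e : C) L := twist2 a b c L *m tv 1 0 (quad d e).

Lemma det_twist2 a b c L : \det L = 1 -> \det (twist2 a b c L) = 1.
Proof. by move=> L1; apply: det_tvr => //; apply: det_tvr. Qed.

Lemma det_twist a b c d e L : \det L = 1 -> \det (twist a b c d e L) = 1.
Proof. by move=> L1; apply: det_tvr => //; apply: det_twist2. Qed.

Lemma twist_mull a b c d e X L : twist a b c d e (X *m L) = X *m twist a b c d e L.
Proof. by rewrite /twist /twist2 !mulmxA. Qed.

Lemma row_cop L j s : \det L = 1 -> (L j 0).[s] = 0 -> (L j 1).[s] != 0.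
Proof.
move=> L1 x0; pose i : 'I_2 := if j == 0 then 1 else 0.
have ij : i != j by rewrite /i; case: j {x0} @i => -[|[|//]].
have [|e e0 E] := @det2 _ L i j 0 1 L1 ij; first by [].
apply: contraNneq e0 => y0; have := congr1 (fun p : {poly C} => p.[s]) E.
by rewrite hornerD hornerN !hornerM x0 y0 !mul0r subrr hornerC => <-.
Qed.

Lemma twist2_good L j : \det L = 1 -> cofin (fun a => cofin (fun b => cofin (fun c =>
  good (twist2 a b c L j 1) (twist2 a b c L j 0)))).
Proof.
move=> L1; have := cofin_row_good (fun s => @row_cop L j s L1).
apply: cofinW => a; apply: cofinW => b; apply: cofinW => c.
by rewrite /twist2 !mul_tvE /= !addr0.
Qed.

Lemma twist_dbl L j : \det L = 1 -> cofin5 (fun a b c d e =>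
  dbl (twist a b c d e L j 1) (twist a b c d e L j 0)).
Proof.
move=> /(twist2_good j); apply: cofinW => a; apply: cofinW => b; apply: cofinW => c /good_dbl.
apply: cofinW => d; apply: cofinW => e.
by rewrite /twist !(mul_tvE (twist2 _ _ _ _)) /= addr0 [quad _ _ * _]mulrC.
Qed.

Lemma good_col M : \det M = 1 -> good (M 0 1) (M 0 0) -> good (M 0 1) (M 1 1).
Proof.
move=> M1; have [|//|e e0 E] := @det2 _ M 1 0 0 1 M1; first by [].
by apply: (@good_transfer _ _ _ (M 1 0) _ e e0); rewrite -E [M 1 0 * _]mulrC.
Qed.

Lemma twist_emb L : \det L = 1 -> cofin5 (fun a b c d e => embT (twist a b c d e L)).
Proof.
move=> L1; have := twist2_good 0 L1; apply: cofinW => a; apply: cofinW => b; apply: cofinW => c g.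
apply: cofinT => d; rewrite /twist.
have M1 := det_twist2 a b c L1; move: (twist2 a b c L) M1 g => M M1 g.
have := @cofin_embT C M^T 0 1 0 1 d; rewrite det_tr !mxE => /(_ M1 isT isT (good_col M1 g)).
by apply: cofinW => e /embT_tr; rewrite trmx_mul trmxK tr_tv.
Qed.

(** A row shear of M is the same row shear of M R. For generic R, row [j] of M R is [dbl] and the
    lines before and after the shear embed, so the shear extends. For L = 1 the entry of R at (0, 1)
    is b 'X + c. *)
Lemma twist_std L : \det L = 1 -> cofin5 (fun a b c d e => eqv K (twist a b c d e L) (std C 0)).
Proof.
pose Q L := \det L = 1 /\ cofin5 (fun a b c d e => eqv K (twist a b c d e L) (std C 0)).
move=> L1; suff: Q L by case.
apply: SL_poly_ind L1 => [|i j q M ij [M1 QM]].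
  split; first exact: det1.
  apply: cofinT => a; have : cofin (fun b => 0 + b * 1 != 0 :> C) by apply: cofin_lin => /eqP; rewrite oner_eq0.
  apply: cofinW => b; rewrite add0r mulr1 => b0.
  apply: cofinT => c; apply: cofinT => d; apply: cofinT => e.
  have E : twist a b c d e 1%:M 0 1 = b%:P * 'X + c%:P.
    by rewrite /twist /twist2 !mul_tvE !mxE /= mulr0 !addr0 mulr1 add0r.
  apply: (@eqv_std_affine C 0 K cK _ (delta_mx 0 0) (delta_mx 1 0) b c _ b0).
    by apply: det_twist; rewrite det1.
  have mapd m n k l : map_mx polyC (delta_mx k l) = delta_mx k l :> 'M[{poly C}]_(m, n).
    by apply/matrixP => u v; rewrite !mxE rmorph_nat.
  by rewrite !mapd -rowE -colE 2!mxE.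
split; first exact: det_tvl.
have := cofin5I (cofin5I QM (twist_dbl j M1)) (cofin5I (twist_emb M1) (twist_emb (det_tvl q ij M1))).
apply: cofin5W => a b c d e [[eM dM] [e1 e2]]; rewrite twist_mull in e2 *.
have T1 := det_twist a b c d e M1.
have eT : eqv K (twist a b c d e M) (tv i j q *m twist a b c d e M).
  exact: (row_move_dbl row_moveK T1 e1 e2 ij (isT : 1 != 0 :> 'I_2) dM).
by apply: (eqv_trans cK (eqv_sym T1 eT)).
Qed.

Lemma map_tv (i j : 'I_2) (c : C) : map_mx polyC (tv i j c) = tv i j c%:P.
Proof. by apply/matrixP => k l; rewrite !mxE rmorphD rmorphM /= !rmorph_nat. Qed.

(** The generic shear E is [G]. It makes G A, [G *m M0], [G *m M2] and [G *m M3] embedded lines,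
    column 0 of [G *m M0] and column 1 of [G *m M2] being [dbl]. The rows 0 of A and [M3] are [dbl],
    so [G] can be applied to A and undone at [M3]. *)
Lemma eqv_std_dbl A : \det A = 1 -> embT A -> dbl (A 0 1) (A 0 0) -> eqv K A (std C 0).
Proof.
move=> A1 eA dA; have gA := dbl_good dA.
have cop s : (A 0 1).[s] = 0 -> (A 0 0).[s] != 0.
  by move=> y0; apply/eqP => x0; have := row_cop A1 x0; rewrite y0 eqxx.
have H : cofin5 (fun a b c d e => good (twist2 a b c A 0 1) (twist2 a b c A 0 0)).
  have := twist2_good 0 A1; do 3!(apply: cofinW => ?); move=> g.
  by apply: cofinT => ?; apply: cofinT.
have {H} := cofin5I (cofin5I (twist_std A1) (twist_dbl 0 A1)) (cofin5I (twist_emb A1) H).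
move=> /(cofinI (good_pencil gA cop))/cofin_ex[a [ga]].
move=> /cofin_ex[b /cofin_ex[c /cofin_ex[d /cofin_ex[e [[eT dT] [emT g2]]]]]].
pose M0 := A *m tv 1 0 a%:P; pose M2 := twist2 a b c A; pose M3 := twist a b c d e A.
have E0 : M0 = A *m map_mx polyC (tv 1 0 a) by rewrite map_tv.
have E2 : M2 = M0 *m tv 0 1 (b%:P * 'X + c%:P) by [].
have E3 : M3 = M2 *m tv 1 0 (quad d e) by [].
have M01 : \det M0 = 1 by apply: det_tvr.
have M21 : \det M2 = 1 by apply: det_twist2.
have M31 : \det M3 = 1 by apply: det_twist.
have {}eT : eqv K M3 (std C 0) := eT.
have {}emT : embT M3 := emT.
have {}dT : dbl (M3 0 1) (M3 0 0) := dT.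
have {}g2 : good (M2 0 1) (M2 0 0) := g2.
have g0 : good (M0 0 0) (M0 0 1) by rewrite /M0 !mul_tvE /= addr0.
clearbody M0 M2 M3.
have g0z : good (M0 0 0) (M0 1 0).
  have [|//|u u0 E] := @det2 _ M0 1 0 1 0 M01; first by [].
  by apply: (@good_transfer _ _ _ (M0 1 1) _ u u0 _ g0); rewrite -E [M0 1 1 * _]mulrC.
have g2w := good_col M21 g2.
have /cofin_ex[m [/cofinI h1 h2]] := cofinI (good_dbl g0z) (good_dbl g2w).
have /cofin_ex[l [[d0 d2] [eGA [eG0 [eG2 eG3]]]]] := cofinI (h1 _ h2)
  (cofinI (cofin_embT m A1 (isT : 1 != 0 :> 'I_2) (isT : 1 != 0 :> 'I_2) gA)
  (cofinI (cofin_embT m M01 (isT : 1 != 0 :> 'I_2) (isT : 0 != 1 :> 'I_2) g0)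
  (cofinI (cofin_embT m M21 (isT : 1 != 0 :> 'I_2) (isT : 1 != 0 :> 'I_2) g2)
  (cofin_embT m M31 (isT : 1 != 0 :> 'I_2) (isT : 1 != 0 :> 'I_2) (dbl_good dT))))).
set G : 'M[_]_2 := tv 1 0 (quad m l) in eGA eG0 eG2 eG3.
have mv M : \det M = 1 -> embT M -> embT (G *m M) -> dbl (M 0 1) (M 0 0) -> eqv K M (G *m M).
  by move=> m1 m2 m3; apply: (row_move_dbl row_moveK m1 m2 m3).
have Grow (M : 'M[{poly C}]_2) k : (G *m M) 0 k = M 0 k by rewrite tv_mulE addr0.
have Grow1 (M : 'M[{poly C}]_2) k : (G *m M) 1 k = M 1 k + M 0 k * quad m l by rewrite tv_mulE mulrC.
have G1 M : \det M = 1 -> \det (G *m M) = 1 by apply: det_tvl.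
clearbody G.
apply: (eqv_trans cK (mv _ A1 eA eGA dA)).
have s1 : eqv K (G *m A) (G *m M0).
  by rewrite E0 mulmxA; apply: eqv_mulr => //; rewrite det_tv.
have s2 : eqv K (G *m M0) (G *m M2).
  have E : G *m M2 = G *m M0 *m tv 0 1 (b%:P * 'X + c%:P) by rewrite E2 mulmxA.
  have := @col_move_dbl C K cK row_moveK (G *m M0) 1 0 0 1 (b%:P * 'X + c%:P) (G1 _ M01) eG0.
  by rewrite !Grow !Grow1 -E; apply.
have s3 : eqv K (G *m M2) (G *m M3).
  have E : G *m M3 = G *m M2 *m tv 1 0 (quad d e) by rewrite E3 mulmxA.
  have := @col_move_dbl C K cK row_moveK (G *m M2) 0 1 0 1 (quad d e) (G1 _ M21) eG2.
  by rewrite !Grow !Grow1 -E; apply.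
have s4 : eqv K M3 (G *m M3) by apply: mv.
apply: (eqv_trans cK s1); apply: (eqv_trans cK s2); apply: (eqv_trans cK s3).
exact: (eqv_trans cK (eqv_sym M31 s4)).
Qed.

End Path.

Section NTwo.
Variable C : numClosedFieldType.
Variable K : ('M[C]_2 -> C) -> Prop.
Hypothesis cK : mxclass K.
Hypothesis row_moveK : forall i j c c' (A : 'M[{poly C}]_2) q, i != j ->
  dbl (A j c) (A j c') -> separates (A i c) (A j c) (A j c') ->
  separates ((tv i j q *m A) i c) (A j c) (A j c') -> eqv K A (tv i j q *m A).
Implicit Types A L M : 'M[{poly C}]_2.

(** [finite_double_row] for the transpose gives a column with finitely many double points; a generic
    constant row shear moves them off the zeros of its upper entry. *)
Lemma eqv_good_col A : \det A = 1 -> embT A -> ~ (forall t s, rank1 (evmx A s - evmx A t)) ->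
  exists B, [/\ eqv K A B, \det B = 1, embT B & good (B 0 1) (B 1 1)].
Proof.
move=> A1 eA nd.
have [||ndT|s [D [s1 D0 DP]]] := @finite_double_row C 0 A^T; rewrite ?det_tr //.
- exact: embT_tr.
- apply: nd => t s i i' j j'; have := ndT t s j j' i i'.
  by rewrite !evmx_tr !mxE => ->; rewrite mulrC.
(* Exchanges the columns up to sign, within SL_2. *)
pose J : 'M[C]_2 := tv 0 1 1 *m tv 1 0 (-1) *m tv 0 1 1.
have J1 : \det J = 1 by rewrite !det_mulmx !det_tv // !mulr1.
set N := map_mx polyC s *m A^T in DP.
pose B := A *m map_mx polyC (s^T *m J).
have sJ1 : \det (s^T *m J) = 1 by rewrite det_mulmx det_tr s1 J1 mulr1.
have B1 : \det B = 1 by rewrite det_mulmx det_map_mx sJ1 A1 rmorph1 mulr1.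
have eB : embT B by apply: embT_mulr.
have AB : eqv K A B by apply: eqv_mulr.
have BN : B = N^T *m map_mx polyC J.
  by rewrite trmx_mul trmxK matrix.map_trmx /B map_mxM mulmxA.
clearbody N.
have colB k : B k 1 = N 0 k.
  rewrite BN /J !map_mxM !map_tv mulmxA mulmxA !mul_tvE /= !mxE !polyC1 polyCN polyC1; ring.
clearbody B.
have [t1 Dt] := cofin_ex (cofin_poly D0).
have cop u : (B 1 1).[u] = 0 -> (B 0 1).[u] != 0.
  move=> w0; apply/eqP => y0; have [|//|e e0 E] := @det2 _ B 1 0 0 1 B1; first by [].
  have := congr1 (fun p : {poly C} => p.[u]) E.
  by rewrite hornerD hornerN !hornerM w0 y0 mulr0 mul0r subrr hornerC => /eqP; rewrite eq_sym (negPf e0).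
have fin u : dq (B 1 1) t1 u = 0 -> dq (B 0 1) t1 u != 0.
  move=> d1; apply/eqP => d0; have [|] := DP t1 u; last by rewrite /root (negPf Dt).
  apply/rowP => k; rewrite !mxE -colB.
  by have [->|->] := @ord2P 0 1 k isT.
have [k gk] := cofin_ex (pencil_good cop fin).
pose M := map_mx polyC (tv 0 1 k) *m B.
exists M; split.
- by apply: (eqv_trans cK AB); apply: eqv_mull => //; rewrite det_tv.
- by rewrite /M map_tv; apply: det_tvl.
- by apply: embT_mull => //; rewrite det_tv.
by rewrite /M map_tv !tv_mulE /= addr0.
Qed.

(** Column 0 receives [h] times column 1, where [h] is a polynomial in column 1, so this move is
    algebraic. The multiples of the conductor F(y) are such polynomials, and [generic_double]
    applies with W = 'X F. Where F(y) vanishes and y does not, the term with [k] has to separate; on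
    y = 0 the entry x does. *)
Lemma eqv_dbl A : \det A = 1 -> embT A -> good (A 0 1) (A 1 1) ->
  exists B, [/\ eqv K A B, \det B = 1, embT B & dbl (B 0 1) (B 0 0)].
Proof.
move=> A1 eA gw; set x := A 0 0; set y := A 0 1; set z := A 1 0; set w := A 1 1.
have [|//|e e0 dE] := @det2 _ A 1 0 0 1 A1; first by [].
have {}dE : x * w - z * y = e%:P by rewrite -dE [z * y]mulrC.
have gx : good y x.
  by apply: (@good_transfer _ w y z x e e0) => //; rewrite -dE [w * x]mulrC.
pose S (k l : 'I_2) : Prop := k != 0.
(* The second condition is carried along to show at the end that the new line embeds. *)
pose Bx k := inalg S A^T k /\ forall t s, dq y t s = 0 -> dq w t s = 0 -> dq k t s = 0.
have [iC iD iM] := inalg_subalg S A^T.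
have sB : subalg Bx.
  split=> [c|p q [ip dp] [iq dq_]|p q [ip dp] [iq dq_]]; (split; first by auto).
  - by move=> t s _ _; rewrite dqC.
  - by move=> t s hy hw; rewrite dqD dp ?dq_ ?addr0.
  - by move=> t s hy hw; rewrite dqM dp ?dq_ // mul0r mulr0 addr0.
have iA l : inalg S A^T (A l 1) by have := @inalg_coord C _ S A^T 1 l isT; rewrite mxE.
have By : Bx y by split=> //; apply: iA.
have Bw : Bx w by split=> //; apply: iA.
have [F F0 FB] := good_conductor sB By Bw gw.
have [BC BD BM] := sB.
have Fn0 : F != 0 by apply: contraTneq (oner_neq0 C) => FE; rewrite -F0 FE horner0 eqxx.
have [sy gy] := gw; have [_ gyx] := gx.
have cE t s : dq x t s * w.[s] + x.[t] * dq w t s = dq z t s * y.[s] + z.[t] * dq y t s.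
  have := congr1 (fun p => dq p t s) dE; rewrite dqB !dqM dqC => /eqP.
  by rewrite subr_eq0 => /eqP.
have : forall t, root (F \Po y) t -> cofin (fun k => forall s, root (dqp y t) s ->
    y.[t] != 0 -> dq x t s + k * (dq w t s * y.[s]) != 0).
  move=> t _; apply: cofin_roots => [|s]; first by rewrite dqp_eq0 -ltnNge.
  rewrite rootdq => /eqP dy; have [_|yt] := eqVneq y.[t] 0; first exact: cofinT.
  have ys : y.[s] != 0 by rewrite (dq_eq0 dy).
  have : cofin (fun k => dq x t s + k * (dq w t s * y.[s]) != 0).
    apply: cofin_lin => /eqP; rewrite mulf_eq0 (negPf ys) orbF => /eqP dw.
    apply/eqP => dx; have := cE t s; rewrite dx dw dy mul0r !mulr0 !addr0 => /esym/eqP.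
    rewrite mulf_eq0 (negPf ys) orbF => /eqP dz.
    have /matrix0Pn[i [j]] := eA t s; rewrite mxE.
    by case: (@ord2P 0 1 i isT) (@ord2P 0 1 j isT) => -> [] ->; rewrite -/x -/y -/z -/w ?dx ?dy ?dz ?dw eqxx.
  by apply: cofinW => k kP _.
have Fy0 : F \Po y != 0 by rewrite comp_poly_eq0.
move=> /(cofin_roots Fy0)/cofin_ex[k kP].
pose X := x + k%:P * (w * y); pose W := 'X * F.
have WE : W \Po y = y * (F \Po y) by rewrite comp_polyM comp_polyX.
have dX t s : dq y t s = 0 -> dq X t s = dq x t s + k * (dq w t s * y.[s]).
  by move=> dy; rewrite dqD dqCM dqM dy mulr0 addr0.
have /cofin_ex[m /cofin_ex[l]] : cofin (fun m => cofin (fun l => dbl y (X + (W \Po y) * quad m l))).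
  apply: generic_double => //.
  - by rewrite mulf_neq0 // polyX_eq0.
  - by rewrite hornerM hornerX mul0r.
  - move=> t s Wt dy; rewrite dX //; have [yt|yt] := eqVneq y.[t] 0.
      by rewrite (dq_eq0 dy) yt !mulr0 addr0; apply: gyx.
    apply: kP => //; last by rewrite rootdq dy.
    by move/eqP: Wt; rewrite hornerM hornerX mulf_eq0 (negPf yt) /root horner_comp.
pose h := k%:P * w + (F \Po y) * quad m l.
have -> : X + (W \Po y) * quad m l = x + h * y by rewrite WE /X /h; ring.
move=> dth.
have [ih dh] : Bx h by apply: (BD) => //; apply: (BM).
exists (A *m tv 1 0 h); split.
- have : eqv K A^T (tv 0 1 h *m A^T).
    by apply: (row_move_alg cK).
  by move/(eqv_tr cK); rewrite trmxK trmx_mul trmxK tr_tv.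
- exact: det_tvr.
- move=> t s; apply/eqP => M0.
  have E i j : dq ((A *m tv 1 0 h) i j) t s = 0.
    by have /matrixP/(_ i j) := M0; rewrite !mxE.
  have dy : dq y t s = 0 by have := E 0 1; rewrite mul_tvE addr0.
  have dw : dq w t s = 0 by have := E 1 1; rewrite mul_tvE addr0.
  have dhts := dh _ _ dy dw.
  have dx : dq x t s = 0 by have := E 0 0; rewrite mul_tvE /= -/x -/y dqD dqM dhts dy mul0r mulr0 !addr0.
  have dz : dq z t s = 0 by have := E 1 0; rewrite mul_tvE /= -/z -/w dqD dqM dhts dw mul0r mulr0 !addr0.
  have /matrix0Pn[i [j]] := eA t s; rewrite mxE.
  by case: (@ord2P 0 1 i isT) (@ord2P 0 1 j isT) => -> [] ->; rewrite -/x -/y -/z -/w ?dx ?dy ?dz ?dw eqxx.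
by rewrite !mul_tvE /= addr0.
Qed.

Lemma eqv_std_2 A : \det A = 1 -> embT A -> eqv K A (std C 0).
Proof.
move=> A1 eA; have [rA|nd] := pselect (forall t s, rank1 (evmx A s - evmx A t)).
  exact: eqv_std_degenerate.
have [B [AB B1 eB gB]] := eqv_good_col A1 eA nd.
have [D [BD D1 eD dD]] := eqv_dbl B1 eB gB.
apply: (eqv_trans cK AB); apply: (eqv_trans cK BD).
exact: (eqv_std_dbl cK row_moveK D1 eD dD).
Qed.
End NTwo.

(** * Automorphisms of the variety SL_n *)

Section Holomorphic.
Variables (C : numClosedFieldType) (n : nat).

Definition entire (f : 'M[C]_n -> C) := forall M, differentiable f M.

Lemma differentiable_mx (h : 'M[C]_n -> 'M[C]_n) : mxmap entire h -> forall M, differentiable h M.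
Proof.
move=> Kh M.
have -> : h = \sum_(p : 'I_n * 'I_n) (fun M => h M p.1 p.2 *: (delta_mx p.1 p.2 : 'M[C]_n)).
  apply/funext => N; rewrite fct_sumE [LHS]matrix_sum_delta pair_bigA //.
elim/big_ind: _ => [|f g df dg|p _]; first exact: differentiable_cst.
  exact: differentiableD.
apply: differentiableZl; exact: Kh.
Qed.

Lemma mxclass_entire : mxclass entire.
Proof.
split; [split|..].
- by move=> c M; apply: differentiable_cst.
- by move=> f g df dg M; apply: differentiableD.
- by move=> f g df dg M; apply: differentiableM.
- by move=> i j M; apply: differentiable_coord.
- move=> f h df dh M; apply: (@differentiable_comp _ _ _ _ h f) => //.
  exact: differentiable_mx.
Qed.

Lemma entire_tay F f : tay F -> entire f -> entire (fun M => F (f M)).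
Proof.
move=> tF df M; apply: (@differentiable_comp _ _ _ _ f F) => //.
exact: tay_differentiable.
Qed.

End Holomorphic.

Section Varieties.
Variables (C : numClosedFieldType) (n : nat).
Implicit Types (p : mpoly.mpoly (n * n) C) (M : 'M[C]_n).

Definition evM p M : C := mpoly.meval (fun k => mxvec M 0 k) p.

Lemma fring_evM T (Q : (T -> C) -> Prop) (F : T -> 'M[C]_n) p : fring Q ->
  (forall i j, Q (fun x => F x i j)) -> Q (fun x => evM p (F x)).
Proof.
move=> rQ QF; under eq_fun do rewrite /evM mpoly.mevalE.
apply: fring_sum => // m; apply: fringM => //; first exact: fringC.
apply: fring_prod => // k; apply: fring_exp => //.
by case/mxvec_indexP: k => i j; under eq_fun do rewrite mxvecE.
Qed.

Lemma polyf_evM S (f : 'M[C]_n -> C) : polyf S f -> exists p, forall M, f M = evM p M.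
Proof.
move=> /(_ (fun f => exists p, forall M, f M = evM p M)); apply=> [|i j _]; first split.
- by move=> c; exists (mpoly.mpolyC _ c) => M; rewrite /evM mpoly.mevalC.
- by move=> f1 f2 [p1 E1] [p2 E2]; eexists => M; rewrite E1 E2; symmetry; apply: mpoly.mevalD.
- by move=> f1 f2 [p1 E1] [p2 E2]; eexists => M; rewrite E1 E2; symmetry; apply: mpoly.mevalM.
exists (mpoly.mpolyX C (mpoly.mnm1 (mxvec_index i j))) => M.
by rewrite /evM mpoly.mevalXU mxvecE.
Qed.

Lemma poly_ext (p q : {poly C}) : (forall t, p.[t] = q.[t]) -> p = q.
Proof.
move=> E; apply/eqP; rewrite -subr_eq0; apply: contraT => d0.
by have [t] := cofin_ex (cofin_poly d0); rewrite hornerD hornerN E subrr eqxx.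
Qed.

(** The inverse morphism is a polynomial in the entries whose value on the line is t. If all
    difference quotients of the entries vanished at some pair, so would that of 'X, which is 1. *)
Lemma embedding_mx (f : C -> SL C n) : algebraic_embedding f ->
  exists A : 'M[{poly C}]_n, [/\ \det A = 1, embT A & forall t, evmx A t = val (f t)].
Proof.
move=> [lf _ [r [[p pE] rK]]].
have /choice[F FE] : forall ij : 'I_n * 'I_n, exists q : {poly C},
    forall t, val (f t) ij.1 ij.2 = q.[t] by move=> [i j]; apply: lf.
pose A := \matrix_(i, j) F (i, j).
have AE t : evmx A t = val (f t).
  by apply/matrixP => i j; rewrite evmxE mxE -FE.
have A1 : \det A = 1.
  by apply: poly_ext => t; rewrite -det_evmx AE (eqP (valP (f t))) hornerC.
exists A; split=> // t s.
have [q qE dq0] : exists2 q : {poly C}, forall t, q.[t] = evM p (evmx A t) &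
    forall t s, dqmx A t s = 0 -> dq q t s = 0.
  apply: (@fring_evM _ (fun phi => exists2 q : {poly C}, forall t, q.[t] = phi t &
    forall t s, dqmx A t s = 0 -> dq q t s = 0)) => [|i j].
    split=> [c|f1 f2 [q1 E1 d1] [q2 E2 d2]|f1 f2 [q1 E1 d1] [q2 E2 d2]].
    - by exists c%:P => [u|u v _]; rewrite ?hornerC ?dqC.
    - by exists (q1 + q2) => [u|u v d]; rewrite ?hornerD ?E1 ?E2 // dqD d1 ?d2 ?addr0.
    - by exists (q1 * q2) => [u|u v d]; rewrite ?hornerM ?E1 ?E2 // dqM d1 ?d2 ?mul0r ?mulr0 ?addr0.
  exists (A i j) => [u|u v /matrixP/(_ i j)]; first by rewrite evmxE.
  by rewrite !mxE.
have qX : q = 'X.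
  apply: poly_ext => u; rewrite qE hornerX -[RHS]rK pE; last by exists u.
  by rewrite /evM AE.
by apply/eqP => /dq0/eqP; rewrite qX dqX oner_eq0.
Qed.

Lemma SL_inj (X Y : SL C n) : val X = val Y -> X = Y.
Proof. exact: val_inj. Qed.

Lemma eqv_automorphism (K : ('M[C]_n -> C) -> Prop) (f g : C -> SL C n) A B :
  (forall t, evmx A t = val (f t)) -> (forall t, evmx B t = val (g t)) -> eqv K A B ->
  exists phi psi : SL C n -> SL C n, exists h h' : 'M[C]_n -> 'M[C]_n,
  [/\ mxmap K h /\ mxmap K h', cancel phi psi, cancel psi phi, phi \o f = g &
   forall X, val (phi X) = h (val X) /\ val (psi X) = h' (val X)].
Proof.
move=> Af Bg [h [h' [Kh Kh' H E]]].
have H1 (X : SL C n) := H _ (eqP (valP X)).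
have h1 (X : SL C n) : \det (h (val X)) == 1 by have [->] := H1 X.
have h'1 (X : SL C n) : \det (h' (val X)) == 1 by have [_ ->] := H1 X.
pose mk M (M1 : \det M == 1) : SL C n := exist (fun M : 'M[C]_n => \det M == 1) M M1.
exists (fun X => mk _ (h1 X)), (fun X => mk _ (h'1 X)), h, h'; split=> //.
- by move=> X; apply: SL_inj => /=; have [] := H1 X.
- by move=> X; apply: SL_inj => /=; have [] := H1 X.
- by apply/funext => t; apply: SL_inj; rewrite /= -Af E Bg.
Qed.

Lemma polyf_algebraic (phi : SL C n -> SL C n) S h : mxmap (polyf S) h ->
  (forall X, val (phi X) = h (val X)) -> algebraic_morphism phi.
Proof.
move=> Kh E i j; have [p pE] := polyf_evM (Kh i j).
by exists p => X _; rewrite E pE.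
Qed.

Lemma entire_holomorphic (phi : SL C n -> SL C n) h : mxmap (@entire C n) h ->
  (forall X, val (phi X) = h (val X)) -> holomorphic_map phi.
Proof.
move=> Kh E X; exists setT, h; split=> //; first exact: openT.
by move=> M _; apply: differentiable_mx.
Qed.

End Varieties.

Lemma eqv_common n (C : numClosedFieldType) (K : ('M[C]_n -> C) -> Prop) S A B :
  mxclass K -> \det A = 1 -> \det B = 1 -> eqv K A S -> eqv K B S -> eqv K A B.
Proof. by move=> cK A1 B1 eA eB; apply: (eqv_trans cK eA); apply: eqv_sym. Qed.

Lemma algebraic_case (C : numClosedFieldType) (n : nat) (f g : C -> SL C n) : (3 <= n)%N ->
  algebraic_embedding f -> algebraic_embedding g ->
  exists phi : SL C n -> SL C n, algebraic_automorphism phi /\ phi \o f = g.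
Proof.
case: n f g => [|[|[|n]]] // f g _ /embedding_mx[A [A1 eA Af]] /embedding_mx[B [B1 eB Bg]].
have cK := @mxclass_polyf C n.+3.
have := eqv_common cK A1 B1 (eqv_std_ge3 cK A1 eA) (eqv_std_ge3 cK B1 eB).
move=> /(eqv_automorphism Af Bg)[phi [psi [h [h' [[Kh Kh'] pK qK pf E]]]]].
exists phi; split=> //; split; last exists psi; last split=> //.
  by apply: polyf_algebraic Kh _ => X; case: (E X).
by apply: polyf_algebraic Kh' _ => X; case: (E X).
Qed.

Lemma holomorphic_case (R : realType) (f g : R[i]%C -> SL R[i]%C 2) :
  algebraic_embedding f -> algebraic_embedding g ->
  exists phi : SL R[i]%C 2 -> SL R[i]%C 2, holomorphic_automorphism phi /\ phi \o f = g.
Proof.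
pose C : numClosedFieldType := R[i]%C.
have cK := @mxclass_entire C 2.
move=> /(@embedding_mx C)[A [A1 eA Af]] /(@embedding_mx C)[B [B1 eB Bg]].
have mv := @overshear_row_move C 2 (@entire C 2) (@tay C) cK (@entire_tay C 2) (@exp_interp R).
have := eqv_common cK A1 B1 (eqv_std_2 cK mv A1 eA) (eqv_std_2 cK mv B1 eB).
move=> /(eqv_automorphism Af Bg)[phi [psi [h [h' [[Kh Kh'] pK qK pf E]]]]].
exists phi; split=> //; split; last exists psi; last split=> //.
  by apply: (@entire_holomorphic C) Kh _ => X; case: (E X).
by apply: (@entire_holomorphic C) Kh' _ => X; case: (E X).
Qed.

Theorem mainTheorem1 (R : realType) (n : nat) (n_ge2 : (2 <= n)%N)
    (f g : R[i]%C -> SL R[i]%C n)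
    (f_emb : algebraic_embedding f) (g_emb : algebraic_embedding g) :
  ((3 <= n)%N ->
     exists phi : SL R[i]%C n -> SL R[i]%C n, algebraic_automorphism phi /\ phi \o f = g) /\
  (n = 2%N ->
     exists phi : SL R[i]%C n -> SL R[i]%C n, holomorphic_automorphism phi /\ phi \o f = g).
Proof.
split=> [n3|n2]; first exact: (@algebraic_case R[i]%C).
by move: f g f_emb g_emb; rewrite n2; apply: holomorphic_case.
Qed.
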